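(* Let $L\cong\mathbb{Z}^n$ be a lattice with $\mathbb{Z}$-basis $v_1,\dots,v_n$, let $\Lambda$ be a lattice of rank $k$, and let $\psi:L\to\Lambda$ be a homomorphism with finite cokernel. Let $R=\mathbb{C}[x_1,\dots,x_n]$. Then the only nonzero homology of the affine HHL complex of free $R$-modules $$0\rightarrow\bigoplus_{\sigma\in S_{k}} R\, e_{\sigma} \rightarrow \cdots \rightarrow \bigoplus_{\sigma\in S_{1}} R\, e_{\sigma} \rightarrow \bigoplus_{\sigma\in S_{0}} R\, e_{\sigma}\rightarrow 0$$ associated to $(L,\psi)$ is $H_0$, and $H_0\cong\mathbb{C}[C\cap M]$ as $R$-modules.
   Context: Stratifications. Let $\Lambda^*=\operatorname{Hom}(\Lambda,\mathbb{Z})$, $\Lambda^*_{\mathbb{R}}=\operatorname{Hom}(\Lambda,\mathbb{R})\cong\mathbb{R}^k$, and $T=\Lambda^*_{\mathbb{R}}/\Lambda^*=\operatorname{Hom}(\Lambda,\mathbb{R}/\mathbb{Z})$. For $i=1,\dots,n$ let $H_i:\Lambda^*_{\mathbb{R}}\to\mathbb{R}$, $H_i(f)=f(\psi(v_i))$. The hyperplanes $\{H_i=a\}$, $a\in\mathbb{Z}$, $1\le i\le n$, form a $\Lambda^*$-periodic hyperplane arrangement and induce a stratification $\widetilde S$ of $\Lambda^*_{\mathbb{R}}$: two points $x,y$ are in the (relative interior of the) same stratum iff for every $i$ either $H_i(x)=H_i(y)\in\mathbb{Z}$ or $H_i(x),H_i(y)$ lie in the same open interval $(a,a+1)$ with $a\in\mathbb{Z}$.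 It descends to a stratification $S$ of $T$ (the Bondal stratification), whose strata are the images of the strata of $\widetilde S$. Let $S_m$, $\widetilde S_m$ be the sets of $m$-dimensional strata. Since $\operatorname{coker}\psi$ is finite, the strata of $\widetilde S$ are bounded convex polytopes. For $\widetilde\sigma\in\widetilde S$, $H_i(\widetilde\sigma)$ denotes the value of $H_i$ at an arbitrary point of the relative interior of $\widetilde\sigma$; the integer $\lceil H_i(\widetilde\sigma)\rceil$ does not depend on the point. Differential. Fix orientations of all strata of $S$; these induce orientations of all their lifts in $\widetilde S$. For $\sigma\in S_m$ choose any lift $\widetilde\sigma\in\widetilde S_m$. The differential is the $R$-linear map $$d(e_\sigma)=\sum_{\widetilde\tau}\operatorname{sgn}(\widetilde\sigma,\widetilde\tau)\prod_{i=1}^n x_i^{\lceil H_i(\widetilde\sigma)\rceil-\lceil H_i(\widetilde\tau)\rceil}\,e_\tau,$$ where $\widetilde\tau$ runs over all facets ($(m-1)$-dimensional faces) of $\widetilde\sigma$, $\tau\in S_{m-1}$ is the image of $\widetilde\tau$ in $T$, and $\operatorname{sgn}(\widetilde\sigma,\widetilde\tau)=1$ if the orientations of $\widetilde\sigma$ and $\widetilde\tau$ are compatible (as in the cellular boundary map) and $-1$ otherwise. The exponents are $0$ or $1$. The complex does not depend on the choice of lifts, and different orientations give isomorphic complexes. The term $\bigoplus_{\sigma\in S_m}Re_\sigma$ is in homological degree $m$. The semigroup algebra. Let $L^*=\operatorname{Hom}(L,\mathbb{Z})$ with dual basis $v_1^*,\dots,v_n^*$, and regard $\Lambda^*$ as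 a subgroup of $L^*$ via the (injective) dual map $\psi^*$. Set $M=L^*/\Lambda^*$, a finitely generated abelian group, possibly with torsion. Let $M_{\mathbb{R}}=M\otimes\mathbb{R}=L^*_{\mathbb{R}}/\Lambda^*_{\mathbb{R}}$. $C\cap M$ denotes the subsemigroup of those $m\in M$ whose image in $M_{\mathbb{R}}$ lies in the image of the orthant $\sum_{i=1}^n\mathbb{R}_{\ge0}v_i^*\subseteq L^*_{\mathbb{R}}$ under $L^*_{\mathbb{R}}\to M_{\mathbb{R}}$. $\mathbb{C}[C\cap M]$ is its semigroup algebra, an $R$-module via the ring homomorphism $R\to\mathbb{C}[C\cap M]$ sending $x_i$ to the basis element of the class of $v_i^*$ in $M$. *)

(* Defs.v *)
From HB Require Import structures.
From mathcomp Require Import all_boot all_order all_algebra.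
From mathcomp Require Import finmap complex.
From mathcomp Require Import mpoly monalg.
From mathcomp Require Import boolp classical_sets functions cardinality fsbigop.
From mathcomp Require Import reals.

Set Implicit Arguments.
Unset Strict Implicit.
Unset Printing Implicit Defensive.

Import Order.TTheory GRing.Theory Num.Theory.
Local Open Scope classical_set_scope.
Local Open Scope ring_scope.
Local Open Scope quotient_scope.

Section AdditiveHom.
Context (U V : zmodType).
Implicit Types f g h : {additive U -> V}.

Lemma additive_ext f g : f =1 g -> f = g.
Proof.
move=> fg; have fgE : (f : U -> V) = g by apply/funext.
case: f g fgE {fg} => [f Hf] [g Hg] /= fgE; case: _ / fgE in Hg *.
congr Algebra.Additive.Pack.
case: Hf Hg => [[f0]] [[g0]].
by rewrite (Prop_irrelevance f0 g0).
Qed.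

HB.instance Definition _ := gen_eqMixin {additive U -> V}.
HB.instance Definition _ := gen_choiceMixin {additive U -> V}.

Definition hom_zero : {additive U -> V} := \0.
Definition hom_opp f : {additive U -> V} := \- f.
Definition hom_add f g : {additive U -> V} := f \+ g.

Fact hom_addA : associative hom_add.
Proof. by move=> f g h; apply: additive_ext => x /=; rewrite addrA. Qed.
Fact hom_addC : commutative hom_add.
Proof. by move=> f g; apply: additive_ext => x /=; rewrite addrC. Qed.
Fact hom_add0 : left_id hom_zero hom_add.
Proof. by move=> f; apply: additive_ext => x /=; rewrite add0r. Qed.
Fact hom_addN : left_inverse hom_zero hom_opp hom_add.
Proof. by move=> f; apply: additive_ext => x /=; rewrite addNr. Qed.

HB.instance Definition _ := GRing.isZmodule.Build {additive U -> V}
  hom_addA hom_addC hom_add0 hom_addN.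

Lemma hom0E x : (0 : {additive U -> V}) x = 0. Proof. by []. Qed.
Lemma homDE f g x : (f + g) x = f x + g x. Proof. by []. Qed.
Lemma homNE f x : (- f) x = - f x. Proof. by []. Qed.
End AdditiveHom.

Section RingHom.
Context (U : zmodType) (B : nzRingType).
Implicit Types f g : {additive U -> B}.

Definition hom_scale (a : B) f : {additive U -> B} := a \*o f.

Fact hom_scaleA a b f : hom_scale a (hom_scale b f) = hom_scale (a * b) f.
Proof. by apply: additive_ext => x /=; rewrite mulrA. Qed.
Fact hom_scale1 : left_id 1 hom_scale.
Proof. by move=> f; apply: additive_ext => x /=; rewrite mul1r. Qed.
Fact hom_scaleDr : right_distributive hom_scale +%R.
Proof. by move=> a f g; apply: additive_ext => x /=; rewrite mulrDr. Qed.
Fact hom_scaleDl f : {morph hom_scale^~ f : a b / a + b}.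
Proof. by move=> a b; apply: additive_ext => x /=; rewrite mulrDl. Qed.

HB.instance Definition _ := GRing.Zmodule_isLmodule.Build B {additive U -> B}
  hom_scaleA hom_scale1 hom_scaleDr hom_scaleDl.

Lemma homZE a f x : (a *: f) x = a * f x. Proof. by []. Qed.
End RingHom.

Section DualMap.
Context (N U V : zmodType) (f : {additive U -> V}).

Definition dual_map (g : {additive V -> N}) : {additive U -> N} := g \o f.

Fact dual_map_zmod_morphism : zmod_morphism dual_map.
Proof. by move=> g h; apply: additive_ext. Qed.
HB.instance Definition _ :=
  GRing.isZmodMorphism.Build _ _ dual_map dual_map_zmod_morphism.
End DualMap.

Section Realification.
Context (R : realType) (U : zmodType).

Definition real_hom (g : {additive U -> int}) : {additive U -> R} := intr \o g.

Fact real_hom_zmod_morphism : zmod_morphism real_hom.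
Proof. by move=> g h; apply: additive_ext => x /=; rewrite rmorphB. Qed.
HB.instance Definition _ :=
  GRing.isZmodMorphism.Build _ _ real_hom real_hom_zmod_morphism.
End Realification.

Section Cokernel.
Context (U V : zmodType) (f : {additive U -> V}).

Definition image_pred : {pred V} := fun y => `[< exists x, f x = y >].

Fact image_pred_zmod_closed : zmod_closed image_pred.
Proof.
split=> [|y z]; first by apply/asboolP; exists 0; rewrite raddf0.
by move=> /asboolP[a <-] /asboolP[b <-]; apply/asboolP; exists (a - b); rewrite raddfB.
Qed.
HB.instance Definition _ :=
  GRing.isZmodClosed.Build V image_pred image_pred_zmod_closed.

Definition coker := Quotient.quot (GRing.ZmodClosed.clone V image_pred _).
HB.instance Definition _ := EqQuotient.on coker.
HB.instance Definition _ := Choice.on coker.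
HB.instance Definition _ := GRing.Zmodule.on coker.

Definition coker_proj : V -> coker := \pi_coker.
Definition coker_repr : coker -> V := repr.

Lemma coker_reprK : cancel coker_repr coker_proj.
Proof. exact: reprK. Qed.

Lemma coker_projP x y : coker_proj x = coker_proj y <-> exists u, f u = x - y.
Proof.
split=> [/eqP|/asboolP xy].
  by rewrite -[_ == _]Quotient.idealrBE => /asboolP.
by apply/eqP; rewrite -[_ == _]Quotient.idealrBE.
Qed.

Fact coker_proj_zmod_morphism : zmod_morphism coker_proj.
Proof. by move=> x y; rewrite /coker_proj !piE. Qed.
HB.instance Definition _ :=
  GRing.isZmodMorphism.Build _ _ coker_proj coker_proj_zmod_morphism.
End Cokernel.

Section Homology.
Context (A : nzRingType) (C2 C1 C0 : lmodType A).
Context (f : {linear C2 -> C1}) (g : {linear C1 -> C0}).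

Definition cycle_pred : {pred C1} := fun x => g x == 0.

Fact cycle_pred_submod_closed : submod_closed cycle_pred.
Proof.
split=> [|a x y]; rewrite /cycle_pred !unfold_in /=; first by rewrite linear0.
by move=> /eqP gx /eqP gy; rewrite linearP gx gy scaler0 addr0.
Qed.
HB.instance Definition _ :=
  GRing.isSubmodClosed.Build A C1 cycle_pred cycle_pred_submod_closed.

Record cycles := Cycle { cycle_val :> C1; cycle_valP : cycle_val \in cycle_pred }.
HB.instance Definition _ := [isSub for cycle_val].
HB.instance Definition _ := [Choice of cycles by <:].
HB.instance Definition _ := [SubChoice_isSubLmodule of cycles by <:].

Definition boundary_pred : {pred cycles} := fun z => `[< exists u, f u = val z >].

Fact boundary_pred_submod_closed : submod_closed boundary_pred.
Proof.
split=> [|a x y]; first by apply/asboolP; exists 0; rewrite linear0.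
move=> /asboolP[u ux] /asboolP[w wy]; apply/asboolP; exists (a *: u + w).
by rewrite linearP ux wy.
Qed.
HB.instance Definition _ :=
  GRing.isSubmodClosed.Build A cycles boundary_pred boundary_pred_submod_closed.

(* [ker g / im f].  The quotient is taken modulo [im f `&` ker g], so that it
   makes sense before [g \o f = 0] is known. *)
Definition homology :=
  Quotient.quot (GRing.SubmodClosed.clone A cycles boundary_pred _).
HB.instance Definition _ := EqQuotient.on homology.
HB.instance Definition _ := Choice.on homology.
HB.instance Definition _ := GRing.Zmodule.on homology.

Definition homology_class : cycles -> homology := \pi_homology.

Lemma homology_classP x y :
  homology_class x = homology_class y <-> exists u, f u = val x - val y.
Proof.
split=> [/eqP|xy].
  by rewrite -[_ == _]Quotient.idealrBE => /asboolP.
by apply/eqP; rewrite -[_ == _]Quotient.idealrBE; apply/asboolP.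
Qed.

Fact homology_class_zmod_morphism : zmod_morphism homology_class.
Proof. by move=> x y; rewrite /homology_class !piE. Qed.
HB.instance Definition _ :=
  GRing.isZmodMorphism.Build _ _ homology_class homology_class_zmod_morphism.

Lemma homology_reprK (h : homology) : homology_class (repr h) = h.
Proof. exact: reprK. Qed.

Definition homology_scale (a : A) (h : homology) : homology :=
  homology_class (a *: (repr h : cycles)).

Lemma homology_class_scale a x :
  homology_scale a (homology_class x) = homology_class (a *: x).
Proof.
have /homology_classP[u ux] := homology_reprK (homology_class x).
by apply/homology_classP; exists (a *: u); rewrite linearZ [f u]ux /= scalerBr.
Qed.

Fact homology_scaleA a b h :
  homology_scale a (homology_scale b h) = homology_scale (a * b) h.
Proof. by rewrite -[h]homology_reprK !homology_class_scale scalerA. Qed.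
Fact homology_scale1 : left_id 1 homology_scale.
Proof. by move=> h; rewrite -[h]homology_reprK homology_class_scale scale1r. Qed.
Fact homology_scaleDr : right_distributive homology_scale +%R.
Proof.
move=> a h k; rewrite -[h]homology_reprK -[k]homology_reprK -raddfD.
by rewrite !homology_class_scale scalerDr raddfD.
Qed.
Fact homology_scaleDl h : {morph homology_scale^~ h : a b / a + b}.
Proof.
by move=> a b; rewrite -[h]homology_reprK !homology_class_scale scalerDl raddfD.
Qed.
HB.instance Definition _ := GRing.Zmodule_isLmodule.Build A homology
  homology_scaleA homology_scale1 homology_scaleDr homology_scaleDl.
End Homology.

Section SemigroupAlgebra.
Context (A : comNzRingType) (S : nmodType).

(* Multiplication on [malg] requires a [monomType], whose only invertible
   element is the identity; the semigroups considered below may have other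
   invertible elements. *)
Definition sgalg := {malg A[S]}.
HB.instance Definition _ := GRing.Lmodule.on sgalg.
Implicit Types x y z : sgalg.

Definition sgone : sgalg := << 1 *g 0 >>.
Definition sgmul x y : sgalg :=
  \sum_(s <- msupp x) \sum_(t <- msupp y) << mcoeff s x * mcoeff t y *g (s + t)%R >>.

Lemma sgmulw (d e : {fset S}) x y :
  fsubset (msupp x) d -> fsubset (msupp y) e ->
  sgmul x y = \sum_(s <- d) \sum_(t <- e) << mcoeff s x * mcoeff t y *g (s + t)%R >>.
Proof.
move=> xd ye; rewrite /sgmul (big_fset_incl _ xd) /=.
  apply/eq_bigr=> s _; apply/big_fset_incl => // t _ /mcoeff_outdom ->.
  by rewrite mulr0 monalgU0.
move=> s _ /mcoeff_outdom xs.
by rewrite big1 // => t _; rewrite xs mul0r monalgU0.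
Qed.

Lemma sgmulUU a b (s t : S) :
  sgmul << a *g s >> << b *g t >> = << a * b *g (s + t)%R >>.
Proof. by rewrite (sgmulw msuppU_le msuppU_le) !big_seq_fset1 !mcoeffUU. Qed.

Fact sgmulC : commutative sgmul.
Proof.
move=> x y; rewrite /sgmul exchange_big /=.
by apply: eq_bigr => t _; apply: eq_bigr => s _; rewrite mulrC addrC.
Qed.

Fact sgmulDl : left_distributive sgmul +%R.
Proof.
move=> x y z.
have xd : fsubset (msupp x) (fsetU (msupp x) (msupp y)) by exact: fsubsetUl.
have yd : fsubset (msupp y) (fsetU (msupp x) (msupp y)) by exact: fsubsetUr.
have zz := fsubset_refl (msupp z).
rewrite (sgmulw (msuppD_le x y) zz) (sgmulw xd zz) (sgmulw yd zz).
rewrite -big_split /=; apply/eq_bigr=> s _.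
rewrite -big_split /=; apply/eq_bigr=> t _.
by rewrite mcoeffD mulrDl monalgUD.
Qed.

Lemma sgmulDr : right_distributive sgmul +%R.
Proof. by move=> x y z; rewrite !(sgmulC x) sgmulDl. Qed.

Lemma sgmul0l : left_zero 0 sgmul.
Proof. by move=> x; rewrite /sgmul msupp0 big_seq_fset0. Qed.

Lemma sgmul0r : right_zero 0 sgmul.
Proof. by move=> x; rewrite sgmulC sgmul0l. Qed.

Lemma sgmul_suml I (r : seq I) (F : I -> sgalg) y :
  sgmul (\sum_(i <- r) F i) y = \sum_(i <- r) sgmul (F i) y.
Proof. exact: (big_morph (sgmul^~ y) (fun _ _ => sgmulDl _ _ _) (sgmul0l _)). Qed.

Lemma sgmul_sumr I (r : seq I) (F : I -> sgalg) x :
  sgmul x (\sum_(i <- r) F i) = \sum_(i <- r) sgmul x (F i).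
Proof. exact: (big_morph (sgmul x) (fun _ _ => sgmulDr _ _ _) (sgmul0r _)). Qed.

Fact sgmulA : associative sgmul.
Proof.
move=> x y z; rewrite [x]monalgE (sgmul_suml _ _ (sgmul y z)).
rewrite (sgmul_suml _ _ y) (sgmul_suml _ _ z); apply: eq_bigr => s _.
rewrite [y]monalgE (sgmul_suml _ _ z) (sgmul_sumr _ _ << mcoeff s x *g s >>).
rewrite (sgmul_sumr _ _ << mcoeff s x *g s >>) (sgmul_suml _ _ z).
apply: eq_bigr => t _; rewrite [z]monalgE.
rewrite (sgmul_sumr _ _ << mcoeff t y *g t >>).
rewrite (sgmul_sumr _ _ << mcoeff s x *g s >>) sgmulUU.
rewrite (sgmul_sumr _ _ << _ *g s + t >>); apply: eq_bigr => u _.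
by rewrite !sgmulUU mulrA addrA.
Qed.

Fact sgmul1 : left_id sgone sgmul.
Proof.
move=> x; rewrite {1}[x]monalgE sgmul_sumr [RHS]monalgE.
by apply: eq_bigr => s _; rewrite sgmulUU mul1r add0r.
Qed.

Fact sgone_neq0 : sgone != 0.
Proof. by rewrite monalgU_eq0 oner_neq0. Qed.

HB.instance Definition _ := GRing.Zmodule_isComNzRing.Build sgalg
  sgmulA sgmulC sgmul1 sgmulDl sgone_neq0.

Definition sgmon (s : S) : sgalg := << 1 *g s >>.
Definition sgconst (a : A) : sgalg := << a *g 0 >>.

Lemma sgmonD s t : sgmon (s + t) = sgmon s * sgmon t.
Proof. by rewrite [RHS]sgmulUU mul1r. Qed.

Fact sgconst_zmod_morphism : zmod_morphism sgconst.
Proof. by move=> a b; rewrite /sgconst monalgUB. Qed.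
Fact sgconst_monoid_morphism : monoid_morphism sgconst.
Proof. by split=> // a b; rewrite [RHS]sgmulUU addr0. Qed.
HB.instance Definition _ :=
  GRing.isZmodMorphism.Build A sgalg sgconst sgconst_zmod_morphism.
HB.instance Definition _ :=
  GRing.isMonoidMorphism.Build A sgalg sgconst sgconst_monoid_morphism.
End SemigroupAlgebra.

Definition is_zbasis (U : zmodType) m (b : 'I_m -> U) :=
  forall x, exists! c : {ffun 'I_m -> int}, x = \sum_i b i *~ c i.

Definition is_lattice_of_rank (U : zmodType) m := exists b : 'I_m -> U, is_zbasis b.

Section RealVectorSpace.
Context (R : realType) (V : lmodType R).

Definition span (B : set V) : set V :=
  [set w | exists m (c : 'I_m -> R) (u : 'I_m -> V),
     (forall i, B (u i)) /\ w = \sum_i c i *: u i].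

(* Direction space of the affine hull. *)
Definition direction (A : set V) : set V :=
  span [set w | exists x y, [/\ A x, A y & w = y - x]].

Definition is_basis (W : set V) m (e : m.-tuple V) :=
  (forall i : 'I_m, W e`_i) /\
  (forall w, W w -> exists! c : {ffun 'I_m -> R}, w = \sum_i c i *: e`_i).

Definition has_dim (A : set V) (m : nat) :=
  exists e : m.-tuple V, is_basis (direction A) e.

(* An orientation of an [m]-dimensional space is a labelling of its ordered
   bases by signs ([true] is positive), such that two bases have the same sign
   iff the change of basis has positive determinant.  For [m = 0] both signs of
   the empty basis are possible. *)
Definition is_orientation (W : set V) m (o : m.-tuple V -> bool) :=
  forall (e f : m.-tuple V) (P : 'M[R]_m), is_basis W e -> is_basis W f ->
    (forall j : 'I_m, f`_j = \sum_i P i j *: e`_i) ->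
    (o f == o e) = (0 < \det P).

Definition is_face (P F : set V) :=
  exists (l : {scalar V}) (c : R),
    (forall y, P y -> l y <= c) /\ F = P `&` [set y | l y = c].
End RealVectorSpace.

Section HHL.
Context (R : realType) (n : nat) (L Lam : zmodType).
Context (v : 'I_n -> L) (psi : {additive L -> Lam}).

Local Notation V := {additive Lam -> R}.
Local Notation Rx := {mpoly R[i][n]}.

Definition torus := coker (@real_hom R Lam).
HB.instance Definition _ := GRing.Zmodule.on torus.
Definition torus_proj : V -> torus := @coker_proj _ _ (@real_hom R Lam).

Definition height (i : 'I_n) (f : V) : R := f (psi (v i)).

Definition same_stratum (x y : V) := forall i, exists a : int,
  (height i x = a%:~R /\ height i y = a%:~R) \/
  (a%:~R < height i x < (a + 1)%:~R /\ a%:~R < height i y < (a + 1)%:~R).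

(* A stratum is represented by its relative interior. *)
Definition is_stratum (A : set V) := exists x, A = [set y | same_stratum x y].

(* [Hom(Lam, R)], isomorphic to R^k, has the topology of pointwise convergence. *)
Definition hom_closure (A : set V) : set V :=
  [set y | forall (s : seq Lam) (e : R), 0 < e ->
     exists2 x, A x & forall l, l \in s -> `|x l - y l| < e].

Definition cover_strata (m : nat) : set (set V) :=
  [set A | is_stratum A /\ has_dim A m].

Definition strata (m : nat) : set (set torus) :=
  [set torus_proj @` A | A in cover_strata m].

Fact stratum_image_subproof m (A : cover_strata m) :
  torus_proj @` val A \in strata m.
Proof. by rewrite inE; exists (val A) => //; apply: set_valP. Qed.

Definition stratum_image m (A : cover_strata m) : strata m :=
  SigSub (stratum_image_subproof A).

Definition is_facet m (A : cover_strata m.+1) (B : cover_strata m) :=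
  is_face (hom_closure (val A)) (hom_closure (val B)).

(* Any point of a stratum gives the same value. *)
Definition ceil_height (i : 'I_n) (A : set V) : int :=
  Num.ceil (height i (xget 0 A)).

Section Complex.
Context (lift : forall m, strata m -> cover_strata m).
Context (orn : forall m, strata m -> m.-tuple V -> bool).

(* Orientations are compatible when an outward vector followed by a basis of
   the facet has the same sign as this basis. *)
Definition compatible m (A : cover_strata m.+1) (B : cover_strata m) :=
  exists (e : m.-tuple V) (x y : V),
    [/\ is_basis (direction (val B)) e, val A x, val B y &
        orn (stratum_image A) [tuple of y - x :: e] = orn (stratum_image B) e].

Definition incidence_sign m (A : cover_strata m.+1) (B : cover_strata m) : Rx :=
  if `[< compatible A B >] then 1 else -1.

(* On facets the exponents are 0 or 1, so [absz] loses nothing. *)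
Definition facet_monomial m (A : cover_strata m.+1) (B : cover_strata m) : Rx :=
  \prod_(i < n) 'X_i ^+ absz (ceil_height i (val A) - ceil_height i (val B)).

(* There are no strata of dimension above the rank of [Lam], so these modules
   vanish in all degrees outside the range of the complex. *)
Definition chains (m : nat) := {malg Rx[strata m]}.
HB.instance Definition _ m := GRing.Lmodule.on (chains m).

(* The strata are polytopes, so this [\sum_(_ \in _)], which is 0 on infinite
   supports, is a genuine finite sum. *)
Definition differential_gen m (s : strata m.+1) : chains m :=
  \sum_(B \in [set B | is_facet (lift s) B])
    << incidence_sign (lift s) B * facet_monomial (lift s) B *g stratum_image B >>.

Definition differential m (c : chains m.+1) : chains m :=
  \sum_(s <- msupp c) mcoeff s c *: differential_gen s.

Lemma differentialw m (c : chains m.+1) (d : {fset strata m.+1}) :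
  fsubset (msupp c) d ->
  differential c = \sum_(s <- d) mcoeff s c *: differential_gen s.
Proof.
move=> cd; rewrite /differential (big_fset_incl _ cd) //=.
by move=> s _ /mcoeff_outdom ->; rewrite scale0r.
Qed.

Fact differential_linear m : linear (@differential m).
Proof.
move=> a c d.
have cu : fsubset (msupp c) (fsetU (msupp c) (msupp d)) by exact: fsubsetUl.
have du : fsubset (msupp d) (fsetU (msupp c) (msupp d)) by exact: fsubsetUr.
have su : fsubset (msupp (a *: c + d)) (fsetU (msupp c) (msupp d)).
  apply: fsubset_trans (msuppD_le _ _) _.
  by apply: fsetSU; exact: msuppZ_le.
rewrite (differentialw su) (differentialw cu) (differentialw du).
rewrite scaler_sumr -big_split /=; apply: eq_bigr => s _.
by rewrite mcoeffD mcoeffZ scalerDl scalerA.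
Qed.
HB.instance Definition _ m :=
  GRing.isLinear.Build Rx (chains m.+1) (chains m) *:%R (@differential m)
    (@differential_linear m).

Definition outgoing (m : nat) : {linear chains m -> chains m.-1} :=
  match m with
  | 0 => \0
  | m'.+1 => @differential m'
  end.

Definition hhl_homology (m : nat) := homology (@differential m) (outgoing m).
HB.instance Definition _ m := GRing.Lmodule.on (hhl_homology m).
End Complex.

(* [M = L^* / Lam^*] and [M (x) R = L^*_R / Lam^*_R]. *)
Definition gale_group := coker (@dual_map int L Lam psi).
HB.instance Definition _ := GRing.Zmodule.on gale_group.
Definition gale_space := coker (@dual_map R L Lam psi).
HB.instance Definition _ := GRing.Zmodule.on gale_space.

Definition gale_class : {additive L -> int} -> gale_group :=
  @coker_proj _ _ (@dual_map int L Lam psi).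
Definition gale_space_class : {additive L -> R} -> gale_space :=
  @coker_proj _ _ (@dual_map R L Lam psi).

(* The map [M -> M (x) R]; independence of the representative is
   [gale_real_class]. *)
Definition gale_real (m : gale_group) : gale_space :=
  gale_space_class (real_hom R (coker_repr m)).

Lemma gale_real_class f : gale_real (gale_class f) = gale_space_class (real_hom R f).
Proof.
apply/coker_projP.
have /coker_projP[g gE] : gale_class (coker_repr (gale_class f)) = gale_class f.
  exact: coker_reprK.
by exists (real_hom R g); rewrite -raddfB -gE; apply: additive_ext.
Qed.

Fact gale_real_nmod_morphism : nmod_morphism gale_real.
Proof.
have sD (f g : {additive L -> R}) :
  gale_space_class (f + g) = gale_space_class f + gale_space_class g.
  by rewrite /gale_space_class raddfD.
have cD (f g : {additive L -> int}) :
  gale_class (f + g) = gale_class f + gale_class g.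
  by rewrite /gale_class raddfD.
split=> [|x y].
  have -> : 0 = gale_class 0 by rewrite /gale_class raddf0.
  by rewrite gale_real_class raddf0 /gale_space_class raddf0.
have xE : gale_class (coker_repr x) = x by exact: coker_reprK.
have yE : gale_class (coker_repr y) = y by exact: coker_reprK.
by rewrite -xE -yE -cD !gale_real_class raddfD sD.
Qed.
HB.instance Definition _ :=
  GRing.isNmodMorphism.Build gale_group gale_space gale_real gale_real_nmod_morphism.

(* [v_i^*], uniquely determined when [v] is a basis of [L]. *)
Definition dual_basis (i : 'I_n) : {additive L -> int} :=
  xget 0 [set f : {additive L -> int} | forall j, f (v j) = (i == j)%:R].

Definition orthant : set {additive L -> R} :=
  [set f | exists c : 'I_n -> R,
     (forall i, 0 <= c i) /\ f = \sum_i c i *: real_hom R (dual_basis i)].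

Definition cone : set gale_space := gale_space_class @` orthant.

Definition cone_pred : {pred gale_group} := fun m => `[< cone (gale_real m) >].

Fact cone_pred_addr_closed : addr_closed cone_pred.
Proof.
have sD (f g : {additive L -> R}) :
  gale_space_class (f + g) = gale_space_class f + gale_space_class g.
  by rewrite /gale_space_class raddfD.
split=> [|x y].
  apply/asboolP; exists 0; last by rewrite raddf0 /gale_space_class raddf0.
  by exists (fun=> 0); split=> //; rewrite big1 // => i _; rewrite scale0r.
move=> /asboolP[f [c [c0 fE]] fx] /asboolP[g [d [d0 gE]] gy]; apply/asboolP.
exists (f + g); last by rewrite sD fx gy raddfD.
exists (fun i => c i + d i); split=> [i|]; first exact: addr_ge0.
by rewrite fE gE -big_split /=; apply: eq_bigr => i _; rewrite scalerDl.
Qed.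
HB.instance Definition _ :=
  GRing.isAddClosed.Build gale_group cone_pred cone_pred_addr_closed.

Record cone_semigroup :=
  ConeElt { cone_val :> gale_group; cone_valP : cone_val \in cone_pred }.
HB.instance Definition _ := [isSub for cone_val].
HB.instance Definition _ := [Choice of cone_semigroup by <:].
HB.instance Definition _ :=
  GRing.SubChoice_isSubNmodule.Build _ _ cone_semigroup cone_pred_addr_closed.

Fact dual_basis_cone i : gale_class (dual_basis i) \in cone_pred.
Proof.
apply/asboolP; rewrite gale_real_class; exists (real_hom R (dual_basis i)) => //.
exists (fun j => (i == j)%:R); split=> [j|]; first exact: ler0n.
rewrite (bigD1 i) //= eqxx scale1r big1 ?addr0 // => j ji.
by rewrite eq_sym (negbTE ji) scale0r.
Qed.

Definition dual_basis_class i : cone_semigroup := ConeElt (dual_basis_cone i).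

Definition cone_algebra := sgalg R[i] cone_semigroup.
HB.instance Definition _ := GRing.ComNzRing.on cone_algebra.

Definition structure_map : {rmorphism Rx -> cone_algebra} :=
  mpoly.mmap (@sgconst R[i] cone_semigroup)
       (fun i => sgmon R[i] (dual_basis_class i)).
End HHL.

Arguments cover_strata R {n L Lam} v psi m _.
Arguments strata R {n L Lam} v psi m _.

(* Main.v *)
From HB Require Import structures.
Require Import Defs.
From mathcomp Require Import all_boot all_order all_fingroup all_algebra.
From mathcomp Require Import finmap complex mpoly monalg.
From mathcomp Require Import boolp classical_sets functions cardinality fsbigop reals.
From mathcomp Require Import ring lra zify.

Set Implicit Arguments.
Unset Strict Implicit.
Unset Printing Implicit Defensive.

Import Order.TTheory GRing.Theory Num.Theory.
Local Open Scope classical_set_scope.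
Local Open Scope ring_scope.

(** Write [H i] for the height functions, [Lam'] for the dual lattice Hom(Lam, Z) and [M]
    for the quotient of Hom(L, Z) by [Lam'].  For integers [u i], let [P u] be the
    polyhedron of the points of Hom(Lam, R) where [H i <= u i] for all [i].

    The complex is graded by [M].  A monomial [x^a e_s] has as its degree the class of the
    homomorphism sending [v i] to [a i + ceil (H i A)], where [A] is any lift of the stratum
    [s]: another lift is a translate of [A] by an element of [Lam'], which does not change
    the class.  The exponents in the differential are such that it preserves degrees.  Fix a
    degree [g] and a representative [u] of it.  The monomials of degree [g] correspond to the
    strata [A] of the periodic arrangement contained in [P u] ([monomial_cell],
    [monomial_cell_unique]), and the differential becomes the cellular boundary of [P u]
    subdivided by the integer hyperplanes ([differential_mon]).  Hence the complex is a direct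
    sum of cellular chain complexes of convex polyhedra.  A nonempty convex polyhedron has the
    homology of a point, and [P u] is nonempty exactly when [g] lies in the cone
    ([cone_classP]).  So the homology is concentrated in degree 0, with one copy of the scalars
    for each element of the semigroup; the map [augment], which sends a monomial to plus or
    minus the basis element of its degree, identifies it with the semigroup algebra.

    The content of the proof is the acyclicity of [P u].  A cycle has finite support, so it
    lives in a bounded window [-N <= H i <= u i].  Homogenising turns the window into a closed
    cone in Hom(Lam, R) x R, cut by finitely many linear hyperplanes.  The cells of this cone
    are the cones over the strata in the window and the apex, and the incidence with the apex
    is the augmentation of the complex of the window.  Thus everything follows from the
    statement that the cell complex of a closed polyhedral cone is exact unless the cone is a
    linear subspace ([exact_closed]).  This is proved by induction on the number of
    functionals, with cells encoded by their sign vectors.  Two operations are needed: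
    subdividing the cells by one more hyperplane ([exact_free]), and passing to one side of
    it, by a Mayer-Vietoris argument ([exact_half]).

    Incidence numbers of cells are built from any system of signs that satisfies
    [orientation_system].  These axioms imply that the square of the boundary is zero
    ([diamond]) and that subdivision is a chain map ([boundary_subdiv]).  Determinants provide
    such a system ([orientP]), and rescaling every cell by a sign turns the resulting incidence
    numbers into those of an arbitrary choice of orientations of the strata
    ([compatible_incidence]). *)

(** * Signs and sign vectors *)

(** [None] stands for zero, [Some true] for positive and [Some false] for negative. *)
Definition sign := option bool.

Section SignOf.
Context (R : realFieldType).
Implicit Types (r a t : R).

Definition sgn r : sign := if r == 0 then None else Some (0 < r).

Variant sgn_spec r : sign -> Prop :=
  | SgnZero of r = 0 : sgn_spec r None
  | SgnPos of 0 < r : sgn_spec r (Some true)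
  | SgnNeg of r < 0 : sgn_spec r (Some false).

Lemma sgnP r : sgn_spec r (sgn r).
Proof.
rewrite /sgn; case: (ltrgt0P r) => r0; first exact: SgnPos; first exact: SgnNeg.
exact: SgnZero.
Qed.

Lemma sgn0 : sgn 0 = None. Proof. by rewrite /sgn eqxx. Qed.

Lemma sgn_eq0 r : (sgn r == None) = (r == 0).
Proof. by rewrite /sgn; case: (r == 0). Qed.

Lemma sgn_pos r : (sgn r == Some true) = (0 < r).
Proof. by rewrite /sgn; case: (ltrgt0P r). Qed.

Lemma sgn_neg r : (sgn r == Some false) = (r < 0).
Proof. by rewrite /sgn; case: (ltrgt0P r). Qed.

Lemma sgnN r : sgn (- r) = omap negb (sgn r).
Proof. by rewrite /sgn oppr_eq0 oppr_gt0; case: (ltrgt0P r). Qed.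

Lemma sgnM a r : 0 < a -> sgn (a * r) = sgn r.
Proof. by move=> a0; rewrite /sgn mulf_eq0 (gt_eqF a0) pmulr_rgt0. Qed.

Lemma sgn_perturb r a : exists2 e : R, 0 < e &
  forall t, 0 < t -> t <= e -> sgn (r + t * a) = if sgn r is Some b then Some b else sgn a.
Proof.
case: (eqVneq a 0) => [->|a0].
  exists 1 => // t t0 _; rewrite mulr0 addr0.
  by rewrite sgn0; case: (sgn r).
have a'0 : 0 < `|a| by rewrite normr_gt0.
case: (sgnP r) => r0.
- by exists 1 => // t t0 _; rewrite r0 add0r sgnM.
- exists (r / (2 * `|a|)) => [|t t0]; first by rewrite divr_gt0 ?mulr_gt0.
  rewrite ler_pdivlMr ?mulr_gt0 // => tr; apply/eqP; rewrite sgn_pos.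
  have := ler_norm (- a); rewrite normrN => aa.
  have : t * - a <= t * `|a| by rewrite ler_pM2l.
  lra.
- exists (- r / (2 * `|a|)) => [|t t0]; first by rewrite divr_gt0 ?mulr_gt0 ?oppr_gt0.
  rewrite ler_pdivlMr ?mulr_gt0 // => tr; apply/eqP; rewrite sgn_neg.
  have aa := ler_norm a.
  have : t * a <= t * `|a| by rewrite ler_pM2l.
  lra.
Qed.
End SignOf.

Fixpoint sign_vectors r : seq (seq sign) :=
  if r is r'.+1 then
    [seq None :: s | s <- sign_vectors r'] ++
    ([seq Some true :: s | s <- sign_vectors r'] ++
     [seq Some false :: s | s <- sign_vectors r'])
  else [:: [::]].

Lemma mem_sign_vectors r s : (s \in sign_vectors r) = (size s == r).
Proof.
elim: r s => [|r IH] [|a s] //=; rewrite !mem_cat.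
  by apply/negbTE; rewrite !negb_or; apply/and3P; split; apply/negP => /mapP[].
rewrite eqSS -IH; apply/or3P/idP => [[] /mapP[t tr [_ ->]] //|sr].
case: a => [[]|]; [apply: Or32|apply: Or33|apply: Or31]; exact: map_f.
Qed.

Lemma sign_vectors_uniq r : uniq (sign_vectors r).
Proof.
elim: r => //= r IH.
have inj (a : sign) : injective (cons a) by move=> ? ? [].
rewrite !cat_uniq !(map_inj_uniq (inj _)) IH /= andbT.
apply/andP; split; apply/hasPn => x; rewrite ?mem_cat.
  by case/orP => /mapP[s _ ->]; apply/negP => /mapP[].
by move=> /mapP[s _ ->]; apply/negP => /mapP[].
Qed.

Lemma big_sign_vectorsS (F : nmodType) r (f : seq sign -> F) :
  \sum_(s <- sign_vectors r.+1) f s =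
  \sum_(s <- sign_vectors r) f (None :: s) +
  (\sum_(s <- sign_vectors r) f (Some true :: s) +
   \sum_(s <- sign_vectors r) f (Some false :: s)).
Proof. by rewrite /= !big_cat !big_map. Qed.

(** The order on the cells: passing to a face, signs can only drop to zero. *)
Fixpoint sface (t s : seq sign) : bool :=
  match t, s with
  | [::], [::] => true
  | a :: t', b :: s' => ((a == None) || (a == b)) && sface t' s'
  | _, _ => false
  end.

Lemma sface_refl s : sface s s.
Proof. by elim: s => //= a s ->; rewrite eqxx orbT. Qed.

Lemma sface_size t s : sface t s -> size t = size s.
Proof. by elim: t s => [|a t IH] [|b s] //= /andP[_ /IH ->]. Qed.

Lemma sface_trans : transitive sface.
Proof.
move=> s t u; elim: s t u => [|b s IH] [|a t] [|c u] //= /andP[ab ts] /andP[bc su].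
rewrite (IH t u) // andbT.
by case/orP: ab => /eqP -> //; case/orP: bc => /eqP ->; rewrite eqxx ?orbT.
Qed.

Lemma sface_anti t s : sface t s -> sface s t -> t = s.
Proof.
elim: t s => [|a t IH] [|b s] //= /andP[ab ts] /andP[ba st].
rewrite (IH s) //; congr cons.
by case/orP: ab => /eqP ab //; case/orP: ba => /eqP -> //.
Qed.

(** The composition of oriented matroids: the signs met just after leaving a point with
    signs [a] in a direction with signs [b]. *)
Definition scomp1 (a b : sign) : sign := if a is Some c then Some c else b.
Fixpoint scomp (t s : seq sign) : seq sign :=
  match t, s with
  | a :: t', b :: s' => scomp1 a b :: scomp t' s'
  | _, _ => [::]
  end.

Lemma scomp_face t s : sface t s -> scomp t s = s.
Proof.
elim: t s => [|a t IH] [|b s] //= /andP[ab ts]; rewrite IH //.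
by case/orP: ab => /eqP -> //; case: b.
Qed.

(** The condition on the signs [t] of a vector for it to lie in the span of the cell [s]. *)
Fixpoint szero (t s : seq sign) : bool :=
  match t, s with
  | [::], [::] => true
  | a :: t', b :: s' => ((b == None) ==> (a == None)) && szero t' s'
  | _, _ => false
  end.

Lemma scomp_szero t s : szero t s -> scomp s t = s.
Proof.
elim: t s => [|a t IH] [|b s] //= /andP[ab ts]; rewrite IH //.
by case: b ab => //= /eqP ->.
Qed.

Lemma sface_szero t s : sface t s -> szero t s.
Proof.
elim: t s => [|a t IH] [|b s] //= /andP[ab ts]; rewrite IH // andbT.
by case/orP: ab => /eqP -> //; rewrite ?implybT ?implybb.
Qed.

Lemma szero_refl s : szero s s.
Proof. exact/sface_szero/sface_refl. Qed.

Lemma sface_szero_eq t s : sface t s -> szero s t -> t = s.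
Proof.
elim: t s => [|a t IH] [|b s] //= /andP[ab ts] /andP[ba st].
rewrite (IH s) //; congr cons; case/orP: ab => /eqP ab //.
by move: ba; rewrite ab eqxx => /eqP ->.
Qed.

(** * Cells of a linear arrangement *)

Section Arrangement.
Context (R : realFieldType) (W : vectType R).
Implicit Types (h : 'Hom(W, R^o)) (J : seq 'Hom(W, R^o)) (U : {vspace W}).
Implicit Types (s t : seq sign) (x y z : W).

Definition svec J x : seq sign := [seq sgn (h x : R) | h : 'Hom(W, R^o) <- J].

Lemma size_svec J x : size (svec J x) = size J.
Proof. exact: size_map. Qed.

(** Nonzero signs survive a small move, while zeros take the sign of the direction. *)
Lemma svec_perturb J x z : exists2 e : R, 0 < e &
  forall a : R, 0 < a -> a <= e -> svec J (x + a *: z) = scomp (svec J x) (svec J z).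
Proof.
elim: J => [|h J [e e0 He]] /=; first by exists 1.
have [f f0 Hf] := sgn_perturb (h x : R) (h z : R).
exists (Num.min e f) => [|a a0]; first by rewrite lt_min e0.
rewrite le_min => /andP[ae af]; rewrite He // linearD linearZ /=.
by congr cons; apply: Hf.
Qed.

Lemma svecZ J a x : 0 < a -> svec J (a *: x) = svec J x.
Proof. by move=> a0; apply: eq_map => h; rewrite linearZ /= sgnM. Qed.

Lemma svecN J x : svec J (- x) = [seq omap negb a | a <- svec J x].
Proof. by rewrite /svec -map_comp; apply: eq_map => h; rewrite /= linearN /= sgnN. Qed.

(** The span of the cell [s] of [U].  The kernels are intersected one at a time, so that the
    cells of [h :: J] lying in [lker h] are literally the cells of [J] in [U :&: lker h]; the
    inductions on [J] rest on this. *)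
Fixpoint flat J U s : {vspace W} :=
  match J, s with
  | h :: J', a :: s' => flat J' (if a is None then (U :&: lker h)%VS else U) s'
  | _, _ => U
  end.

Lemma mem_flat J U s x : size s = size J ->
  (x \in flat J U s) = (x \in U) && szero (svec J x) s.
Proof.
elim: J U s => [|h J IH] U [|a s] //=; first by rewrite andbT.
case=> sz; rewrite IH //; case: a => [b|] //=.
by rewrite memv_cap memv_ker sgn_eq0 andbA.
Qed.

Lemma flat_sub J U s : (flat J U s <= U)%VS.
Proof.
elim: J U s => [|h J IH] U [|a s] //=; apply: subv_trans (IH _ _) _.
by case: a => // ; apply: capvSl.
Qed.

Definition realizable J U s : Prop := exists x, x \in U /\ svec J x = s.

Lemma realizable_size J U s : realizable J U s -> size s = size J.
Proof. by case=> x [_ <-]; rewrite size_svec. Qed.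

Lemma svec_flat J U s x : x \in U -> svec J x = s -> x \in flat J U s.
Proof. by move=> xU <-; rewrite mem_flat ?size_svec // xU szero_refl. Qed.

Lemma flat_cap J U (V : {vspace W}) s : flat J (U :&: V)%VS s = (flat J U s :&: V)%VS.
Proof.
elim: J U s => [|h J IH] U [|a s] //=; rewrite -IH.
by case: a => //; rewrite -!capvA (capvC V).
Qed.

Lemma flat_face J U s t : sface t s -> (flat J U t <= flat J U s)%VS.
Proof.
elim: J U t s => [|h J IH] U; first by move=> t s _ /=; exact: (subvv U).
case=> [|a t] [|b s] //=.
move=> /andP[ab ts].
case: a ab => [a|] /=; first by move=> /eqP <-; apply: IH.
move=> _; case: b => [b|]; last exact: IH.
apply: subv_trans (IH U _ _ ts); rewrite flat_cap; exact: capvSl.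
Qed.

Lemma realizable_flat_face J U s t : realizable J U t -> size s = size J -> (flat J U t <= flat J U s)%VS ->
  szero t s.
Proof.
case=> x [xU xt] sz /subvP/(_ x); rewrite (svec_flat xU xt) => /(_ isT).
by rewrite mem_flat // xt => /andP[].
Qed.

Lemma flat_face_lt J U s t : realizable J U s -> sface t s -> t != s ->
  (\dim (flat J U t) < \dim (flat J U s))%N.
Proof.
move=> rs ts ne; rewrite ltnNge; apply/negP => le; case/eqP: ne.
have szt : size t = size J by rewrite (sface_size ts) (realizable_size rs).
apply: (sface_szero_eq ts); apply: (realizable_flat_face rs) => //.
by rewrite -(geq_leqif (dimv_leqif_sup (flat_face J U ts))).
Qed.

Definition cell_pt J U s : W := xget 0 [set x | x \in U /\ svec J x = s].

Lemma cell_ptP J U s : realizable J U s -> cell_pt J U s \in U /\ svec J (cell_pt J U s) = s.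
Proof. by case=> x xP; rewrite /cell_pt; case: xgetP => [_ -> //|/(_ x)]. Qed.

Definition facet J U s t : bool :=
  `[< [/\ realizable J U s, realizable J U t, sface t s &
          \dim (flat J U s) = (\dim (flat J U t)).+1] >].
End Arrangement.

Lemma sfaceP t s : size t = size s ->
  reflect (forall j, nth None t j = None \/ nth None t j = nth None s j) (sface t s).
Proof.
elim: t s => [|a t IH] [|b s] //=; first by move=> _; left=> j; left; rewrite nth_nil.
case=> /IH {}IH; apply: (iffP andP) => [[/orP ab /IH ts] [|j] //=|H].
  by case: ab => /eqP; [left|right].
split; last by apply/IH => j; exact: H j.+1.
by apply/orP; case: (H 0%N) => /= ->; [left|right].
Qed.

Lemma szeroP t s : size t = size s ->
  reflect (forall j, nth None s j = None -> nth None t j = None) (szero t s).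
Proof.
elim: t s => [|a t IH] [|b s] //=; first by move=> _; left=> j; rewrite nth_nil.
case=> /IH {}IH; apply: (iffP andP) => [[/implyP ab /IH ts] [|j] //=|H].
- by move=> /eqP/ab/eqP.
- exact: ts.
split; first by apply/implyP => /eqP/(H 0%N)/= ->.
by apply/IH => j; exact: H j.+1.
Qed.

Lemma nth_scomp t s j : size t = size s ->
  nth None (scomp t s) j = scomp1 (nth None t j) (nth None s j).
Proof.
elim: t s j => [|a t IH] [|b s] j //= => [_|[/IH {}IH]]; first by rewrite !nth_nil.
by case: j => [|j] //=.
Qed.

Lemma size_scomp t s : size t = size s -> size (scomp t s) = size t.
Proof. by elim: t s => [|a t IH] [|b s] //= [/IH ->]. Qed.

(** The pairs are affine functions [q.1 + t * q.2] of the time [t]; the exit is at the least of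
    the times [- q.1 / q.2] of the decreasing ones. *)
Lemma exit_time (R : realFieldType) (l : seq (R * R)) :
  all (fun q => 0 < q.1) l -> has (fun q => q.2 < 0) l ->
  exists t, [/\ 0 < t, all (fun q => 0 <= q.1 + t * q.2) l
              & has (fun q => q.1 + t * q.2 == 0) l].
Proof.
elim: l => //= -[a b] l IH /= /andP[a0 l0].
have back (s t : R) : 0 < s -> s <= t ->
    all (fun q => 0 <= q.1 + t * q.2) l -> all (fun q => 0 <= q.1 + s * q.2) l.
  move=> s0 st /allP lt; apply/allP => -[c d] cd /=.
  have := lt _ cd; have /= := allP l0 _ cd => c0 cd0.
  case: (lerP 0 d) => d0; first by rewrite addr_ge0 ?mulr_ge0 // ltW.
  by apply: le_trans cd0 _; rewrite lerD2l ler_nM2r.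
case: (boolP (has (fun q : R * R => q.2 < 0) l)) => [hl _|].
  have [t [t0 lt ht]] := IH l0 hl.
  case: (lerP 0 (a + t * b)) => ab; first by exists t; rewrite t0 lt ht ab orbT.
  have b0 : b < 0 by rewrite -(pmulr_rlt0 _ t0); lra.
  have s0 : 0 < a / - b by rewrite divr_gt0 ?oppr_gt0.
  have st : a / - b <= t by rewrite ler_pdivrMr ?oppr_gt0 // mulrN; lra.
  have e : a + a / - b * b = 0 by field; rewrite lt_eqF.
  by exists (a / - b); rewrite s0 e lexx eqxx /=; split=> //; apply: back lt.
move=> nl; rewrite orbF => b0.
have s0 : 0 < a / - b by rewrite divr_gt0 ?oppr_gt0.
have e : a + a / - b * b = 0 by field; rewrite lt_eqF.
exists (a / - b); rewrite s0 e lexx eqxx /=; split=> //.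
apply/allP => -[c d] cd /=; have /= c0 := allP l0 _ cd.
have /= := hasPn nl _ cd; rewrite -leNgt => d0.
by apply: addr_ge0; [exact: ltW | apply: mulr_ge0 => //; exact: ltW].
Qed.

Section Arrangement2.
Context (R : realFieldType) (W : vectType R).
Implicit Types (h : 'Hom(W, R^o)) (J : seq 'Hom(W, R^o)) (U : {vspace W}).
Implicit Types (s t : seq sign) (x y z : W).

Lemma svecD_face J x y : sface (svec J y) (svec J x) -> svec J (x + y) = svec J x.
Proof.
elim: J => //= h J IH /andP[yx /IH ->]; congr cons; rewrite linearD /=.
move: yx; rewrite sgn_eq0 => /orP[/eqP ->|]; first by rewrite addr0.
case: (sgnP (h x : R)) => hx; rewrite ?sgn_eq0 ?sgn_pos ?sgn_neg => hy.
- by apply/eqP; rewrite sgn_eq0 hx (eqP hy) addr0.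
- by apply/eqP; rewrite sgn_pos addr_gt0.
- by apply/eqP; rewrite sgn_neg; rewrite -oppr_gt0 opprD addr_gt0 ?oppr_gt0.
Qed.

Lemma svec_face0 J x y : sface (svec J (0 *: y)) (svec J x).
Proof. by elim: J => //= h J ->; rewrite scale0r linear0 sgn0. Qed.

Lemma svec_cone J s x y (a : R) : svec J x = s -> svec J y = s -> 0 <= a ->
  svec J (x + a *: y) = s.
Proof.
move=> xs ys; rewrite le_eqVlt => /orP[/eqP <-|a0]; rewrite -xs.
  by apply: svecD_face; apply: svec_face0.
by apply: svecD_face; rewrite svecZ // ys xs sface_refl.
Qed.

Lemma nth_svec J x j : (j < size J)%N -> nth None (svec J x) j = sgn ((nth 0 J j) x : R).
Proof. by move=> jJ; rewrite (nth_map 0). Qed.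

Lemma dim_line_add (Q : {vspace W}) y : y \notin Q -> \dim (Q + <[y]>) = (\dim Q).+1.
Proof.
move=> yQ; rewrite dimv_disjoint_sum; last first.
  apply/eqP; rewrite -subv0; apply/subvP => x; rewrite memv_cap memv0.
  case/andP => xQ /vlineP[a xE]; apply: contraNT yQ; rewrite xE scaler_eq0 negb_or.
  by case/andP => a0 _; rewrite -[y](scalerK a0) -xE memvZ.
rewrite dim_vline; case: eqVneq yQ => [->|]; first by rewrite mem0v.
by rewrite addn1.
Qed.

Lemma facetP J U s t : reflect [/\ realizable J U s, realizable J U t, sface t s &
          \dim (flat J U s) = (\dim (flat J U t)).+1] (facet J U s t).
Proof. exact: asboolP. Qed.

Lemma facet_neq J U s t : facet J U s t -> t != s.
Proof. by case/facetP => _ _ _ d; apply: contra_eq_neq d => ->; rewrite neq_ltn ltnSn. Qed.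

Lemma facet_notin J U s t x : facet J U s t -> x \in U -> svec J x = s ->
  x \notin flat J U t.
Proof.
move=> st xU xs; have /facetP[rs rt ts d] := st.
rewrite mem_flat ?(realizable_size rt) // xU xs /=; apply/negP => zs.
by have := facet_neq st; rewrite (sface_szero_eq ts zs) eqxx.
Qed.

Lemma facet_flat J U s t x : facet J U s t -> x \in U -> svec J x = s ->
  flat J U s = (flat J U t + <[x]>)%VS.
Proof.
move=> st xU xs; have xt := facet_notin st xU xs.
have /facetP[rs rt ts d] := st; apply/esym/eqP; rewrite eqEdim d dim_line_add // leqnn andbT.
by rewrite subv_add flat_face // -memvE; apply: svec_flat.
Qed.

End Arrangement2.

(** * Incidence numbers and the square of the boundary *)

(** [o S T w] is the sign with which the vector [w], put before the fixed orientation of the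
    hyperplane [T] of [S], gives the fixed orientation of [S].  By [or_pos] and [or_neg] it
    depends only on the side of [T] in [S] on which [w] lies.  By [or_swap] the two ways of
    reaching [S] from a subspace of codimension 2 have opposite signs. *)
Record orientation_system (R : realFieldType) (W : vectType R) (F : comNzRingType)
    (o : {vspace W} -> {vspace W} -> W -> F) : Prop := OrientationSystem {
  or_sq : forall S T w, o S T w * o S T w = 1;
  or_pos : forall (S T : {vspace W}) w t (a : R), (T <= S)%VS -> \dim S = (\dim T).+1 ->
    w \in S -> w \notin T -> t \in T -> 0 < a -> o S T (a *: w + t) = o S T w;
  or_neg : forall (S T : {vspace W}) w, (T <= S)%VS -> \dim S = (\dim T).+1 ->
    w \in S -> w \notin T -> o S T (- w) = - o S T w;
  or_swap : forall (S Q : {vspace W}) u w, (Q <= S)%VS -> \dim S = (\dim Q).+2 ->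
    u \in S -> w \in S -> u \notin (Q + <[w]>)%VS -> w \notin (Q + <[u]>)%VS ->
    o S (Q + <[w]>)%VS u * o (Q + <[w]>)%VS Q w =
    - (o S (Q + <[u]>)%VS w * o (Q + <[u]>)%VS Q u)
}.

Section Differential.
Context (R : realFieldType) (W : vectType R) (F : comNzRingType).
Context (o : {vspace W} -> {vspace W} -> W -> F).
Context (Ho : orientation_system o).
Implicit Types (h : 'Hom(W, R^o)) (J : seq 'Hom(W, R^o)) (U : {vspace W}).
Implicit Types (s t : seq sign) (x y z : W) (c : seq sign -> F).

(** A cell lies on one side of the span of each of its facets, so that the choice of the point
    [cell_pt] is immaterial ([incidence_pt]). *)
Definition incidence J U s t : F :=
  if facet J U s t then o (flat J U s) (flat J U t) (cell_pt J U s) else 0.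

Lemma incidence_nfacet J U s t : ~~ facet J U s t -> incidence J U s t = 0.
Proof. by rewrite /incidence => /negbTE ->. Qed.

Lemma incidence_pt J U s t x : facet J U s t -> x \in U -> svec J x = s ->
  incidence J U s t = o (flat J U s) (flat J U t) x.
Proof.
move=> st xU xs; rewrite /incidence st; have /facetP[rs rt ts d] := st.
have [pU ps] := cell_ptP rs; set p := cell_pt J U s in pU ps *.
have pS := svec_flat pU ps.
have xT := facet_notin st xU xs; have xS := svec_flat xU xs.
move: pS; rewrite {1}(facet_flat st xU xs) => /memv_addP[t0 t0T [_ /vlineP[a ->]]] pE.
have a0 : 0 < a.
  rewrite ltNge; apply/negP => a0.
  have t0E : t0 = p + (- a) *: x by rewrite pE scaleNr addrK.
  have t0s : svec J t0 = s by rewrite t0E; apply: svec_cone => //; rewrite oppr_ge0.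
  have t0U : t0 \in U by apply: (subvP (flat_sub J U t)).
  by have := facet_notin st t0U t0s; rewrite t0T.
by rewrite pE addrC (or_pos Ho) // ?flat_face.
Qed.

Lemma incidence_sq J U s t : facet J U s t -> incidence J U s t * incidence J U s t = 1.
Proof. by move=> st; rewrite /incidence st (or_sq Ho). Qed.

(** Chains mix all dimensions: the grading is carried by [facet]. *)
Definition boundary J U c t : F := \sum_(s <- sign_vectors (size J)) c s * incidence J U s t.
End Differential.

Section Diamond.
Context (R : realFieldType) (W : vectType R) (J : seq 'Hom(W, R^o)) (U : {vspace W}).
Context (s r t0 : seq sign) (Hst : facet J U s t0) (Htr : facet J U t0 r).
Implicit Types (x y w : W).

Let S := flat J U s.
Let Q := flat J U r.

Let rs : realizable J U s. Proof. by case/facetP: Hst. Qed.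
Let rr : realizable J U r. Proof. by case/facetP: Htr. Qed.
Let rt : realizable J U t0. Proof. by case/facetP: Hst. Qed.
Let szs : size s = size J. Proof. exact: realizable_size rs. Qed.
Let szr : size r = size J. Proof. exact: realizable_size rr. Qed.
Let fst0 : sface t0 s. Proof. by case/facetP: Hst. Qed.
Let frt0 : sface r t0. Proof. by case/facetP: Htr. Qed.
Let frs : sface r s. Proof. exact: sface_trans frt0 fst0. Qed.

Let dimSQ : \dim S = (\dim Q).+2.
Proof. by case/facetP: Hst => _ _ _ ->; case/facetP: Htr => _ _ _ ->. Qed.

(** The functionals that separate [s] from its face [r] of codimension 2; [linkf] gives them
    the sign that makes them positive on [s].  Modulo the span of [r], the cell [s] is the
    plane sector where they are positive. *)
Definition link : seq nat :=
  [seq j <- iota 0 (size J) | (nth None r j == None) && (nth None s j != None)].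

Definition linkf (j : nat) x : R :=
  (if nth None s j == Some true then 1 else -1) * ((nth 0 J j) x : R).

Definition link_sum x : R := \sum_(j <- link) linkf j x.

Lemma linkfD j x y : linkf j (x + y) = linkf j x + linkf j y.
Proof. by rewrite /linkf linearD /= mulrDr. Qed.

Lemma linkfZ j (a : R) x : linkf j (a *: x) = a * linkf j x.
Proof. by rewrite /linkf linearZ /= mulrCA. Qed.

Lemma link_sumD x y : link_sum (x + y) = link_sum x + link_sum y.
Proof. by rewrite /link_sum -big_split /=; apply: eq_bigr => j _; rewrite linkfD. Qed.

Lemma link_sumZ (a : R) x : link_sum (a *: x) = a * link_sum x.
Proof. by rewrite /link_sum mulr_sumr; apply: eq_bigr => j _; rewrite linkfZ. Qed.

Lemma mem_link j : j \in link -> [/\ (j < size J)%N, nth None r j = None & nth None s j != None].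
Proof. by rewrite mem_filter mem_iota add0n => /andP[/andP[/eqP ? ?] /andP[_ ?]]. Qed.

Lemma in_link j : nth None r j = None -> nth None s j != None -> j \in link.
Proof.
move=> rj sj; rewrite mem_filter rj sj mem_iota add0n /= ltnNge; apply: contra sj => jJ.
by rewrite nth_default ?szs.
Qed.

Lemma nth_r j : nth None r j = None \/ nth None r j = nth None s j.
Proof. by move/sfaceP: frs; apply; rewrite szr szs. Qed.

Lemma mem_S_zero j x : x \in S -> (j < size J)%N -> nth None s j = None -> nth 0 J j x = 0.
Proof.
rewrite mem_flat // => /andP[_ /szeroP]; rewrite size_svec szs => /(_ erefl) H jJ /H.
by rewrite nth_svec // => /eqP; rewrite sgn_eq0 => /eqP.
Qed.

Lemma mem_Q x : x \in S -> (x \in Q) = all (fun j => linkf j x == 0) link.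
Proof.
move=> xS; have xU : x \in U by apply: (subvP (flat_sub J U s)).
rewrite mem_flat // xU /=; apply/idP/allP => [/szeroP|H].
  rewrite size_svec szr => /(_ erefl) H j /mem_link[jJ rj sj].
  have := H _ rj; rewrite nth_svec // => /eqP; rewrite sgn_eq0 => /eqP jx.
  by rewrite /linkf jx mulr0.
apply/szeroP => [|j rj]; first by rewrite size_svec szr.
case: (ltnP j (size J)) => jJ; last by rewrite nth_default ?size_svec.
rewrite nth_svec //; apply/eqP; rewrite sgn_eq0.
case: (eqVneq (nth None s j) None) => sj; first by rewrite mem_S_zero.
have := H j (in_link rj sj); rewrite mulf_eq0 => /orP[|//].
by case: (_ == Some true); rewrite ?oppr_eq0 oner_eq0.
Qed.

Lemma linkf_ge0 y t j : svec J y = t -> sface t s -> j \in link -> 0 <= linkf j y.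
Proof.
move=> yt ts /mem_link[jJ rj sj].
have /sfaceP := ts; rewrite (sface_size ts) => /(_ erefl j).
rewrite -yt nth_svec // /linkf; case: sgnP => jy.
- by rewrite jy mulr0.
- by case=> // <-; rewrite eqxx mul1r ltW.
- by case=> // <- /=; rewrite mulN1r oppr_ge0 ltW.
Qed.

Lemma linkf_eq0 y t j : svec J y = t -> j \in link -> (linkf j y == 0) = (nth None t j == None).
Proof.
move=> yt /mem_link[jJ rj sj]; rewrite -yt nth_svec // sgn_eq0 /linkf mulf_eq0.
by case: (_ == Some true); rewrite ?oppr_eq0 oner_eq0.
Qed.

Lemma between_zero t : facet J U s t -> facet J U t r -> exists2 j, j \in link & nth None t j = None.
Proof.
move=> st tr; have /facetP[_ rt' ts _] := st; have /facetP[_ _ rtf _] := tr.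
have szt := realizable_size rt'.
have : ~~ szero s t by apply/negP => /(sface_szero_eq ts)/eqP; rewrite (negbTE (facet_neq st)).
move=> nz; apply/not_exists2P => H; case/negP: nz; apply/szeroP; first by rewrite szs szt.
move=> j tj; apply/eqP; case: (eqVneq (nth None s j) None) => // sj; exfalso.
have rj : nth None r j = None.
  by have /sfaceP := rtf; rewrite szr szt => /(_ erefl j); rewrite tj => -[].
by case: (H j) => [|//]; apply; apply: in_link.
Qed.

Context (p w : W) (pU : p \in U) (ps : svec J p = s) (wS : w \in S) (wQ : w \notin Q).
Context (w0 : link_sum w = 0).

Lemma linkf_p_gt0 j : j \in link -> 0 < linkf j p.
Proof.
move=> jl; rewrite lt_def (linkf_ge0 ps (sface_refl s) jl) andbT.
by rewrite (linkf_eq0 ps jl); case/mem_link: jl.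
Qed.

Let pS : p \in S. Proof. exact: svec_flat. Qed.

Lemma link_sum_p_gt0 : 0 < link_sum p.
Proof.
have [j jl _] := between_zero Hst Htr.
rewrite /link_sum (perm_big _ (perm_to_rem jl)) big_cons /=.
apply: ltr_pwDl; first exact: linkf_p_gt0.
by rewrite big_seq sumr_ge0 // => i /mem_rem/linkf_p_gt0/ltW.
Qed.

Lemma link_neg : has (fun j => linkf j w < 0) link.
Proof.
apply/negPn/negP => /hasPn H; case/negP: wQ; rewrite mem_Q //.
have := w0; rewrite /link_sum big_seq => /eqP; rewrite psumr_eq0 => [/allP H' |j /H].
  by apply/allP => j jl; have := H' j jl; rewrite jl.
by rewrite -leNgt.
Qed.

(** Modulo the span [Q] of [r], the cell [s] is a sector in a plane and [w] spans the line
    where [link_sum], a positive function on the sector, vanishes.  So the half line from [p]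
    in the direction [w] has to leave the sector, and it does so on a bounding ray.  This ray
    is a cell [t] between [r] and [s], and the only one whose points have a positive
    coefficient of [w] in terms of [p], [w] and [Q]. *)
Lemma diamond_half : exists (a : R) t,
  [/\ 0 < a, facet J U s t, facet J U t r, flat J U t = (Q + <[p + a *: w]>)%VS
    & (exists2 y, y \in U /\ svec J y = t & exists2 e : R, 0 < e &
        exists2 q, q \in Q & y = e *: (p + a *: w) + q) /\
      forall t' q (b c : R), facet J U s t' -> facet J U t' r -> q \in Q -> 0 < c ->
        svec J (q + b *: p + c *: w) = t' -> t' = t].
Proof.
have [a [a0 Hall Hhas]] : exists a : R, [/\ 0 < a,
    forall j, j \in link -> 0 <= linkf j (p + a *: w)
    & exists2 j, j \in link & linkf j (p + a *: w) = 0].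
  have [||a [a0 /allP Ha /hasP[q ql /eqP q0]]] :=
    @exit_time R [seq (linkf j p, linkf j w) | j <- link].
  - by apply/allP => _ /mapP[j jl ->] /=; apply: linkf_p_gt0.
  - by rewrite has_map; apply: link_neg.
  exists a; split=> // [j jl|].
    by have := Ha _ (map_f _ jl); rewrite /= linkfD linkfZ.
  by case/mapP: ql q0 => j jl -> /= e; exists j; rewrite // linkfD linkfZ.
set y := p + a *: w in Hall Hhas *.
have yS : y \in S by rewrite memvD // memvZ.
have yU : y \in U by apply: (subvP (flat_sub J U s)).
have gy : link_sum y = link_sum p by rewrite link_sumD link_sumZ w0 mulr0 addr0.
have yQ : y \notin Q.
  apply: contraTN link_sum_p_gt0; rewrite -gy mem_Q // => /allP H.
  by rewrite /link_sum big_seq big1 ?ltxx // => j /H/eqP.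
have [q0 [q0U q0r]] := rr.
have [e e0 He] := svec_perturb J q0 y.
(* the cell met on leaving a point of [r] towards the exit point [y] *)
set t := scomp r (svec J y).
have szt : size t = size J by rewrite size_scomp ?szr ?size_svec.
have tE : svec J (q0 + e *: y) = t by rewrite He // q0r.
have ntht j : nth None t j = scomp1 (nth None r j) (nth None (svec J y) j).
  by rewrite nth_scomp // szr size_svec.
have ty : realizable J U t by exists (q0 + e *: y); rewrite memvD ?memvZ.
have frt : sface r t.
  apply/sfaceP => [|j]; rewrite ?szr ?szt // ntht.
  by case: (nth None r j) => [b|]; [right|left].
have nthts j : nth None r j = None -> nth None t j = nth None (svec J y) j.
  by rewrite ntht => ->.
have fts : sface t s.
  apply/sfaceP => [|j]; rewrite ?szs ?szt //.
  case: (eqVneq (nth None r j) None) => rj; last first.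
    right; rewrite ntht; case: (nth_r j) rj => [->|<-]; first by rewrite eqxx.
    by case: (nth None r j).
  rewrite nthts //; case: (ltnP j (size J)) => jJ; last by left; rewrite nth_default ?size_svec.
  rewrite nth_svec //; case: (eqVneq (nth None s j) None) => sj.
    by left; rewrite mem_S_zero // sgn0.
  have := Hall j (in_link rj sj); rewrite /linkf.
  case E : (nth None s j) sj => [[]|] //= _; rewrite ?mul1r ?mulN1r ?oppr_ge0.
    by case: sgnP; [left|right|move=> ?; rewrite leNgt => /negP].
  by case: sgnP; [left|move=> ?; rewrite leNgt => /negP|right].
have nts : t != s.
  have [j jl jy] := Hhas; have [jJ rj sj] := mem_link jl.
  apply: contra_neq sj => <-; rewrite nthts //.
  by apply/eqP; rewrite -(linkf_eq0 erefl jl) jy.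
have QyT : (Q + <[y]> <= flat J U t)%VS.
  rewrite subv_add flat_face //= -memvE mem_flat // yU /=.
  apply/szeroP => [|j]; rewrite ?size_svec ?szt // ntht.
  by case: (nth None r j).
have dlt := flat_face_lt rs fts nts.
have dQy : \dim (Q + <[y]>) = (\dim Q).+1 by apply: dim_line_add.
have flt : flat J U t = (Q + <[y]>)%VS.
  apply/esym/eqP; rewrite eqEdim QyT dQy /= -ltnS -dimSQ.
  exact: leq_trans dlt _.
have st : facet J U s t by apply/facetP; split=> //; rewrite flt dQy -dimSQ.
have tr : facet J U t r by apply/facetP; split=> //; rewrite flt dQy.
have link_t j : j \in link -> nth None t j = sgn ((nth 0 J j) y : R).
  by move=> /mem_link[jJ rj _]; rewrite nthts // nth_svec.
exists a, t; split=> //; split.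
  exists (q0 + e *: y); first by rewrite memvD ?memvZ.
  by exists e => //; exists q0; [apply: svec_flat | rewrite addrC].
move=> t' q b c st' t'r qQ c0; set y' := _ + _ => y't.
have /facetP[_ rt' ft's _] := st'; have /facetP[_ _ frt' _] := t'r.
have szt' := realizable_size rt'.
have QS := flat_face J U frs; rewrite -/Q -/S in QS.
have qS : q \in S by apply: (subvP QS).
have linkq j : j \in link -> linkf j q = 0.
  by move: qQ; rewrite mem_Q // => /allP H /H/eqP.
have y'S : y' \in S by rewrite !memvD ?memvZ.
have y'U : y' \in U by apply: (subvP (flat_sub J U s)).
have y'Q : y' \notin Q.
  by have := facet_notin t'r y'U y't.
have ly' j : j \in link -> linkf j y' = b * linkf j p + c * linkf j w.
  by move=> jl; rewrite !linkfD !linkfZ linkq ?add0r.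
(* evaluating [link_sum], which vanishes on [w] and [Q] *)
have b0 : 0 < b.
  have g0 : 0 <= link_sum y'.
    by rewrite /link_sum big_seq sumr_ge0 // => j; apply: linkf_ge0 y't ft's.
  have gy' : link_sum y' = b * link_sum p.
    rewrite !link_sumD !link_sumZ w0 mulr0 addr0 -[RHS]add0r; congr (_ + _).
    by rewrite /link_sum big_seq big1 // => j /linkq.
  rewrite lt_def -(pmulr_lge0 _ link_sum_p_gt0) -gy' g0 andbT.
  apply: contraNneq y'Q => b0; rewrite mem_Q //; apply/allP => j jl.
  have := gy'; rewrite b0 mul0r /link_sum big_seq => /eqP.
  rewrite psumr_eq0 => [/allP/(_ _ jl)|i]; first by rewrite jl.
  exact: linkf_ge0 y't ft's.
(* [y'] is zero on some functional of the link, as [y] is: both are at the exit time *)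
have cb : c = b * a.
  have [j' jl' t'j'] := between_zero st' t'r.
  have z' : linkf j' y' = 0 by apply/eqP; rewrite (linkf_eq0 y't jl') t'j'.
  have [j jl z] := Hhas.
  have h1 := linkf_ge0 y't ft's jl; have h2 := Hall _ jl'.
  have pj := linkf_p_gt0 jl; have pj' := linkf_p_gt0 jl'.
  move: z z' h1 h2; rewrite !ly' // !linkfD !linkfZ => z z' h1 h2.
  have wj : linkf j w < 0 by rewrite -(pmulr_rlt0 _ a0); lra.
  have wj' : linkf j' w < 0 by rewrite -(pmulr_rlt0 _ c0); have := mulr_gt0 b0 pj'; lra.
  apply/eqP; rewrite eq_le; apply/andP; split.
    rewrite -(ler_nM2r wj); apply: le_trans (_ : - (b * linkf j p) <= _); last by lra.
    by rewrite -mulrA (_ : a * linkf j w = - linkf j p); lra.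
  rewrite -(ler_nM2r wj'); apply: le_trans (_ : - (b * linkf j' p) <= _); first by lra.
  by rewrite -mulrA -mulrN ler_pM2l //; lra.
apply: (@eq_from_nth _ None) => [|j]; rewrite ?szt ?szt' // => jJ.
case: (eqVneq (nth None r j) None) => rj; last first.
  have /sfaceP := frt'; rewrite szr szt' => /(_ erefl j)[/eqP|<-]; first by rewrite (negbTE rj).
  by rewrite ntht; case: (nth None r j) rj.
case: (eqVneq (nth None s j) None) => sj.
  have /sfaceP := ft's; rewrite szs szt' => /(_ erefl j)[->|->];
  by have /sfaceP := fts; rewrite szs szt => /(_ erefl j)[->|->].
rewrite (link_t j) ?in_link // -y't nth_svec // -[RHS](sgnM _ b0).
congr sgn; rewrite /y' /y cb; do ![rewrite linearD /= | rewrite linearZ /=].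
have := linkq j (in_link rj sj) => /eqP; rewrite mulf_eq0 => /orP[|/eqP ->].
  by case: ifP; rewrite ?oppr_eq0 oner_eq0.
by rewrite add0r mulrDr mulrA.
Qed.
End Diamond.

Section DD.
Context (R : realFieldType) (W : vectType R) (F : comNzRingType).
Context (o : {vspace W} -> {vspace W} -> W -> F).
Context (Ho : orientation_system o).
Context (J : seq 'Hom(W, R^o)) (U : {vspace W}).

(** Modulo the span of [r], the cell [s] is a sector with exactly two bounding rays, reached
    from a point [p] of [s] in the directions [w] and [- w].  As [p] is a positive combination
    of the two exit points [u1] and [u2], the two terms cancel by [or_swap]. *)
Lemma diamond s r : \sum_(t <- sign_vectors (size J)) incidence o J U s t * incidence o J U t r = 0.
Proof.
have [[t0 [st0 t0r]]|no] := pselect (exists t, facet J U s t /\ facet J U t r); last first.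
  rewrite big1 // => t _; case: (boolP (facet J U s t)) => st; last by rewrite incidence_nfacet ?mul0r.
  case: (boolP (facet J U t r)) => tr; last by rewrite [X in _ * X]incidence_nfacet ?mulr0.
  by case: no; exists t.
have /facetP[rs rt ft0s d1] := st0; have /facetP[_ rr frt0 d2] := t0r.
have dSQ : \dim (flat J U s) = (\dim (flat J U r)).+2 by rewrite d1 d2.
have [p [pU ps]] := rs; have [y0 [y0U y0t]] := rt.
have gp := link_sum_p_gt0 st0 t0r ps.
pose ls := link_sum J s r.
(* [w] is the projection of a point of [t0] to the kernel of [ls] along [p] *)
pose b := ls y0 / ls p.
have [w wdef] : exists w, w = y0 - b *: p by exists (y0 - b *: p).
have pS := svec_flat pU ps.
have y0T := svec_flat y0U y0t.
have y0S : y0 \in flat J U s by apply: (subvP (flat_face J U ft0s)).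
have wS : w \in flat J U s by rewrite wdef memvB ?memvZ.
have w0 : ls w = 0.
  rewrite wdef /ls link_sumD -scaleNr link_sumZ -/ls mulNr /b divfK ?subrr //.
  by rewrite gt_eqF.
have y0Q : y0 \notin flat J U r by apply: facet_notin t0r _ _.
have wQ : w \notin flat J U r.
  apply: contraNN y0Q => wQ.
  have [j jl t0j] := between_zero st0 t0r st0 t0r.
  have : linkf J s j w = 0 by move: wQ; rewrite (mem_Q st0 t0r) // => /allP/(_ _ jl)/eqP.
  have /eqP z : linkf J s j y0 == 0 by rewrite (linkf_eq0 y0t jl) t0j.
  rewrite wdef linkfD -scaleNr linkfZ z add0r mulNr => /eqP.
  rewrite oppr_eq0 mulf_eq0 (gt_eqF (linkf_p_gt0 ps jl)) orbF => /eqP b0.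
  by move: wQ; rewrite wdef b0 scale0r subr0.
have NwS : - w \in flat J U s by rewrite memvN.
have NwQ : - w \notin flat J U r by rewrite memvN.
have Nw0 : ls (- w) = 0 by rewrite -scaleN1r /ls link_sumZ -/ls w0 mulr0.
have [a1 [t1 [a10 st1 t1r flt1 [[y1 [y1U y1t] [e1 e10 [q1 q1Q y1E]]] uniq1]]]] :=
  diamond_half st0 t0r pU ps wS wQ w0.
have [a2 [t2 [a20 st2 t2r flt2 [[y2 [y2U y2t] [e2 e20 [q2 q2Q y2E]]] uniq2]]]] :=
  diamond_half st0 t0r pU ps NwS NwQ Nw0.
have QS := flat_face J U (sface_trans frt0 ft0s).
set S := flat J U s in pS y0S wS NwS dSQ flt1 flt2 QS *; set Q := flat J U r in y0Q dSQ wQ NwQ flt1 flt2 q1Q q2Q QS *.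
set u1 := p + a1 *: w in flt1 y1E; set u2 := p + a2 *: - w in flt2 y2E.
have u1S : u1 \in S by rewrite memvD ?memvZ.
have u2S : u2 \in S by rewrite memvD ?memvZ.
have u1Q : u1 \notin Q.
  apply: contraTN (ltr0Sn R 0) => u1Q; have := facet_notin t1r y1U y1t.
  by rewrite y1E memvD ?memvZ.
have u2Q : u2 \notin Q.
  apply: contraTN (ltr0Sn R 0) => u2Q; have := facet_notin t2r y2U y2t.
  by rewrite y2E memvD ?memvZ.
have a12 : a1 + a2 != 0 by rewrite gt_eqF ?addr_gt0.
have pE1 : p = (a1 / (a1 + a2)) *: u2 + (a2 / (a1 + a2)) *: u1.
  rewrite /u1 /u2 !scalerDr !scalerN addrACA -scalerDl scalerA.
  rewrite (_ : a1 / (a1 + a2) + a2 / (a1 + a2) = 1); last by field.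
  rewrite scale1r !scalerA (_ : a2 / (a1 + a2) * a1 = a1 / (a1 + a2) * a2); last by field.
  by rewrite addNr addr0.
have pT1 := facet_notin st1 pU ps; have pT2 := facet_notin st2 pU ps.
rewrite flt1 in pT1; rewrite flt2 in pT2.
have u1T1 : u1 \in (Q + <[u1]>)%VS by rewrite memvE addvSr.
have u2T2 : u2 \in (Q + <[u2]>)%VS by rewrite memvE addvSr.
have u2T1 : u2 \notin (Q + <[u1]>)%VS.
  by apply: contraNN pT1 => u2T1; rewrite pE1 memvD ?memvZ.
have u1T2 : u1 \notin (Q + <[u2]>)%VS.
  by apply: contraNN pT2 => u1T2; rewrite pE1 memvD ?memvZ.
have T1S : (Q + <[u1]> <= S)%VS by rewrite subv_add QS -memvE.
have T2S : (Q + <[u2]> <= S)%VS by rewrite subv_add QS -memvE.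
have dT1 : \dim (Q + <[u1]>) = (\dim Q).+1 by apply: dim_line_add.
have dT2 : \dim (Q + <[u2]>) = (\dim Q).+1 by apply: dim_line_add.
have t12 : t1 != t2.
  by apply: contraNneq u2T1 => t12; rewrite -flt1 t12 flt2.
have E1 : incidence o J U s t1 * incidence o J U t1 r = o S (Q + <[u1]>)%VS u2 * o (Q + <[u1]>)%VS Q u1.
  rewrite (incidence_pt Ho st1 pU ps) (incidence_pt Ho t1r y1U y1t) flt1 -/S -/Q; congr (_ * _).
    by rewrite pE1 (or_pos Ho) ?dT1 ?memvZ // divr_gt0 ?addr_gt0.
  by rewrite y1E (or_pos Ho) ?dT1 ?addvSl.
have E2 : incidence o J U s t2 * incidence o J U t2 r = o S (Q + <[u2]>)%VS u1 * o (Q + <[u2]>)%VS Q u2.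
  rewrite (incidence_pt Ho st2 pU ps) (incidence_pt Ho t2r y2U y2t) flt2 -/S -/Q; congr (_ * _).
    by rewrite pE1 addrC (or_pos Ho) ?dT2 ?memvZ // divr_gt0 ?addr_gt0.
  by rewrite y2E (or_pos Ho) ?dT2 ?addvSl.
have szv t : facet J U s t -> t \in sign_vectors (size J).
  by case/facetP => _ /realizable_size rst _ _; rewrite mem_sign_vectors rst.
rewrite (bigD1_seq t1) ?szv ?sign_vectors_uniq //= -big_filter.
rewrite (bigD1_seq t2) ?filter_uniq ?sign_vectors_uniq //=; last first.
  by rewrite mem_filter eq_sym t12 szv.
rewrite -big_filter big_seq big1; last first.
  move=> t; rewrite !mem_filter => /and3P[tt2 tt1 tsv].
  case: (boolP (facet J U s t)) => st; last by rewrite incidence_nfacet ?mul0r.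
  case: (boolP (facet J U t r)) => tr; last by rewrite [X in _ * X]incidence_nfacet ?mulr0.
  (* a third cell would have a point [q + c p + d w]: the sign of [d] decides *)
  exfalso; have /facetP[_ [y [yU yt]] fts _] := st; have /facetP[_ _ frt _] := tr.
  have yS : y \in S by apply: (subvP (flat_face J U fts)); apply: svec_flat.
  have wp : w \in (Q + <[p]> + <[w]>)%VS by rewrite memvE addvSr.
  have pQ : p \notin Q by apply: contraNN pT1; apply: (subvP (addvSl _ _)).
  have wQp : w \notin (Q + <[p]>)%VS.
    apply/negP => /memv_addP[q qQ [_ /vlineP[c ->]] wE].
    have ls_q : ls q = 0.
      have qS : q \in S by apply: (subvP QS).
      move: qQ; rewrite (mem_Q st0 t0r) // => /allP H.
      by rewrite /ls /link_sum big_seq big1 // => j /H/eqP.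
    have := w0; rewrite wE /ls link_sumD link_sumZ -/ls ls_q add0r => /eqP.
    rewrite mulf_eq0 (gt_eqF gp) orbF => /eqP c0.
    by case/negP: wQ; rewrite wE c0 scale0r addr0.
  have SE : S = (Q + <[p]> + <[w]>)%VS.
    apply/esym/eqP; rewrite eqEdim dim_line_add // dim_line_add // dSQ leqnn andbT.
    by rewrite !subv_add QS -!memvE pS.
  move: yS; rewrite SE => /memv_addP[_ /memv_addP[q qQ [_ /vlineP[c ->] ->]] [_ /vlineP[d ->]] yE].
  case: (ltrgt0P d) => d0.
  - have e : t = t1 by apply: (uniq1 t q c d) => //; rewrite -yE.
    by rewrite e eqxx in tt1.
  - have e : t = t2 by apply: (uniq2 t q c (- d)); rewrite ?oppr_gt0 // scaleNr scalerN opprK -yE.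
    by rewrite e eqxx in tt2.
  - have [j jl tj] := between_zero st0 t0r st tr.
    have /eqP := linkf_eq0 yt jl; rewrite tj eqxx => /eqP/eqP jy.
    have qS : q \in S by apply: (subvP QS).
    have /eqP jq : linkf J s j q == 0 by move: qQ; rewrite (mem_Q st0 t0r) // => /allP; apply.
    have jp := linkf_p_gt0 ps jl.
    move: jy; rewrite yE d0 scale0r addr0 linkfD linkfZ jq add0r => /eqP.
    rewrite mulf_eq0 (gt_eqF jp) orbF => /eqP c0.
    have yq : y = q by rewrite yE c0 d0 !scale0r !addr0.
    by have := facet_notin tr yU yt; rewrite yq -/Q qQ.
by rewrite addr0 E1 E2 (or_swap Ho) // addrC subrr.
Qed.

Lemma boundary_boundary c r : boundary o J U (boundary o J U c) r = 0.
Proof.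
rewrite /boundary; under eq_bigr do rewrite mulr_suml.
rewrite exchange_big /= big1 // => s _.
by under eq_bigr do rewrite -mulrA; rewrite -mulr_sumr diamond mulr0.
Qed.
End DD.

(** * Subdivision by one more hyperplane *)

Section AddHyperplane.
Context (R : realFieldType) (W : vectType R) (F : comNzRingType).
Context (o : {vspace W} -> {vspace W} -> W -> F).
Context (Ho : orientation_system o).
Context (h : 'Hom(W, R^o)) (J : seq 'Hom(W, R^o)) (U : {vspace W}).
Implicit Types (s t : seq sign) (x y z : W) (c : seq sign -> F).

Local Notation U0 := (U :&: lker h)%VS.
Local Notation hJ := (h :: J).

Lemma realizable_None s : realizable hJ U (None :: s) = realizable J U0 s.
Proof.
apply: propext; split=> -[x [xU xs]]; exists x; move: xs xU.
  by case=> /eqP; rewrite sgn_eq0 => hx <- xU; rewrite memv_cap xU memv_ker.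
rewrite memv_cap memv_ker => <- /andP[-> /eqP hx]; split=> //.
by congr cons; rewrite hx sgn0.
Qed.

Lemma cell_pt_None s : cell_pt hJ U (None :: s) = cell_pt J U0 s.
Proof.
rewrite /cell_pt; congr (xget 0 _); apply/predeqP => x /=; rewrite memv_cap memv_ker.
split=> [[xU [/eqP]]|[/andP[-> /eqP ->] <-]]; last by rewrite sgn0.
by rewrite sgn_eq0 xU => -> ->.
Qed.

Lemma facet_None s t : facet hJ U (None :: s) (None :: t) = facet J U0 s t.
Proof. by apply/facetP/facetP => /=; rewrite !realizable_None. Qed.

Lemma incidence_None s t : incidence o hJ U (None :: s) (None :: t) = incidence o J U0 s t.
Proof. by rewrite /incidence facet_None cell_pt_None. Qed.

Lemma realizable_behead a s : realizable hJ U (a :: s) -> realizable J U s.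
Proof. by case=> x [xU [_ xs]]; exists x. Qed.

Lemma realizable_cases s : realizable J U s -> exists a, realizable hJ U (a :: s).
Proof. by case=> x [xU xs]; exists (sgn (h x : R)), x; rewrite /= xs. Qed.

Lemma realizable_above b s t : realizable hJ U (Some b :: t) -> realizable J U s -> sface t s ->
  realizable hJ U (Some b :: s).
Proof.
case=> y [yU [yb yt]] [x [xU xs]] ts.
have [e e0 He] := svec_perturb hJ y x.
exists (y + e *: x); rewrite memvD ?memvZ //; split=> //.
by rewrite He //= yb yt xs scomp_face.
Qed.

Lemma facet_Some b b' s t : facet hJ U (Some b :: s) (Some b' :: t) <->
  [/\ b' = b, realizable hJ U (Some b' :: t) & facet J U s t].
Proof.
split=> [/facetP[rs rt /= /andP[/eqP[bb] ts] d]|[-> rt /facetP[rs _ ts d]]].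
  split=> //; apply/facetP; split=> //; [exact: realizable_behead rs|exact: realizable_behead rt].
by apply/facetP; rewrite /= eqxx; split=> //; apply: realizable_above rt _ _.
Qed.

Lemma incidence_Some b b' s t : incidence o hJ U (Some b :: s) (Some b' :: t) =
  if (b' == b) && `[< realizable hJ U (Some b' :: t) >] then incidence o J U s t else 0.
Proof.
case: (boolP (facet hJ U (Some b :: s) (Some b' :: t))) => f.
  have /facet_Some[bb rt st] := f; subst b'; rewrite eqxx asboolT //=.
  have /facetP[[x [xU xs]] _ _ _] := f.
  by rewrite (incidence_pt Ho f xU xs) (incidence_pt Ho st xU) //; case: xs.
rewrite incidence_nfacet //; case: eqP => //= bb; case: asboolP => // rt.
by rewrite incidence_nfacet //; apply: contra f => st; apply/facet_Some.
Qed.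

Lemma incidence_NoneSome b s t : incidence o hJ U (None :: s) (Some b :: t) = 0.
Proof. by apply: incidence_nfacet; apply/facetP => -[]. Qed.

Definition cut s : bool :=
  `[< realizable hJ U (Some true :: s) /\ realizable hJ U (Some false :: s) >].

Lemma cutP s : reflect (forall b, realizable hJ U (Some b :: s)) (cut s).
Proof. by rewrite /cut; apply: (iffP (asboolP _)) => [[? ?] []|H]. Qed.

Lemma cut_None s : cut s -> realizable hJ U (None :: s).
Proof.
move=> /cutP H; have [x [xU [/eqP hx xs]]] := H true; have [y [yU [/eqP hy ys]]] := H false.
rewrite sgn_pos in hx; rewrite sgn_neg in hy.
exists (x + (- (h x : R) / (h y : R)) *: y); rewrite memvD ?memvZ //; split=> //.
have a0 : 0 < - (h x : R) / (h y : R) by rewrite mulNr oppr_gt0 pmulr_rlt0 // invr_lt0.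
congr cons; last by apply: svec_cone => //; rewrite ltW.
apply/eqP; rewrite sgn_eq0 linearD linearZ /= -[_ *: _]/(_ * _) divfK ?subrr //.
by rewrite lt_eqF.
Qed.

Lemma realizable_Some_flat b s : realizable hJ U (Some b :: s) -> ~~ (flat J U s <= lker h)%VS.
Proof.
case=> x [xU [hx xs]]; apply/negP => /subvP/(_ x); rewrite svec_flat // => /(_ isT).
by rewrite memv_ker -sgn_eq0 hx.
Qed.

(** From a point of the cell [s] on the wall, a vector [z] of the span of [s] outside the wall
    leads to either side, along [z] and along [- z], without leaving the cell. *)
Lemma realizable_None_cut s : realizable hJ U (None :: s) -> ~~ (flat J U s <= lker h)%VS -> cut s.
Proof.
case=> x [xU [hx xs]] /subvPn[z zs hz].
have szs : size s = size J by rewrite -xs size_svec.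
have Ho' y : y \in flat J U s -> realizable hJ U (sgn (h y : R) :: s).
  rewrite mem_flat // => /andP[yU ys].
  have [e e0 He] := svec_perturb hJ x y.
  exists (x + e *: y); rewrite memvD ?memvZ //; split=> //.
  by rewrite He //= hx xs scomp_szero.
have Hz := Ho' _ zs; have HNz : realizable hJ U (sgn (h (- z) : R) :: s) by apply: Ho'; rewrite memvN.
rewrite linearN /= sgnN in HNz; rewrite memv_ker -sgn_eq0 in hz.
by apply/cutP => b; move: Hz HNz hz; case: (sgn _) => //= -[]; case: b.
Qed.

Lemma dim_cap_ker (V : {vspace W}) : ~~ (V <= lker h)%VS -> \dim V = (\dim (V :&: lker h)).+1.
Proof.
move=> Vh; have := limg_ker_dim h V; rewrite addnC => <-; rewrite -add1n; congr (_ + _)%N.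
apply/eqP; rewrite eqn_leq; apply/andP; split.
  by have := dimvS (subvf (h @: V)); rewrite dimvf.
rewrite lt0n dimv_eq0; apply: contra Vh => /eqP h0; apply/subvP => x xV.
by rewrite memv_ker -memv0 -h0 memv_img.
Qed.

Lemma facet_cut b s : realizable hJ U (Some b :: s) -> realizable hJ U (None :: s) ->
  facet hJ U (Some b :: s) (None :: s).
Proof.
move=> rb r0; apply/facetP; split=> //=; first exact: sface_refl.
by rewrite flat_cap; apply: dim_cap_ker; apply: realizable_Some_flat rb.
Qed.

(** A piece of [s] on one side of the wall has, as facets on the wall, the wall of [s] itself
    and the facets of [s] contained in the wall. *)
Lemma facet_SomeNone b s t : facet hJ U (Some b :: s) (None :: t) ->
  t = s \/ (flat J U t <= lker h)%VS /\ facet J U s t.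
Proof.
case/facetP => rs rt /= ts; rewrite flat_cap => d.
have rs' := realizable_behead rs; have rt' := realizable_behead rt.
case: (eqVneq t s) => ts'; [by left|right].
have := flat_face_lt rs' ts ts'; rewrite d ltnS => d'.
have E : (flat J U t :&: lker h)%VS = flat J U t by apply/eqP; rewrite eqEdim capvSl.
split; first by rewrite -E capvSr.
by apply/facetP; split=> //; rewrite -{1}E.
Qed.

(** The two halves of a cut cell are on opposite sides of their common wall. *)
Lemma incidence_cut_opp s : cut s ->
  incidence o hJ U (Some false :: s) (None :: s) = - incidence o hJ U (Some true :: s) (None :: s).
Proof.
move=> cs; have r0 := cut_None cs; move/cutP: cs => H.
have [x [xU xs]] := H true; have [y [yU ys]] := H false.
have fp := facet_cut (H true) r0; have fm := facet_cut (H false) r0.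
rewrite (incidence_pt Ho fp xU xs) (incidence_pt Ho fm yU ys) /=.
have /facetP[_ _ _ d] := fp.
have xT := facet_notin fp xU xs; have yT := facet_notin fm yU ys.
have xS := svec_flat xU xs; have yS := svec_flat yU ys.
have TS : (flat hJ U (None :: s) <= flat hJ U (Some true :: s))%VS.
  by apply: flat_face; rewrite /= sface_refl.
rewrite /= in d xT yT xS yS TS *.
case: xs => /eqP; rewrite sgn_pos => hx xs; case: ys => /eqP; rewrite sgn_neg => hy ys.
pose a : R := - (h y : R) / (h x : R).
have a0 : 0 < a by rewrite divr_gt0 ?oppr_gt0.
apply: oppr_inj; rewrite opprK -(or_neg Ho) //.
rewrite (_ : - y = a *: x + (- y - a *: x)); last by rewrite addrCA subrr addr0.
rewrite (or_pos Ho) //.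
rewrite flat_cap memv_cap memv_ker memvB ?memvN ?memvZ //= linearB linearN linearZ /=.
by rewrite subr_eq0 -[_ *: _]/(_ * _) /a divfK // gt_eqF.
Qed.

Lemma boundary_None c t : boundary o hJ U c (None :: t) =
  \sum_(s <- sign_vectors (size J)) c (None :: s) * incidence o hJ U (None :: s) (None :: t) +
  (\sum_(s <- sign_vectors (size J)) c (Some true :: s) * incidence o hJ U (Some true :: s) (None :: t) +
   \sum_(s <- sign_vectors (size J)) c (Some false :: s) * incidence o hJ U (Some false :: s) (None :: t)).
Proof. exact: big_sign_vectorsS. Qed.

Lemma boundary_Some c b t : boundary o hJ U c (Some b :: t) =
  if `[< realizable hJ U (Some b :: t) >] then
    \sum_(s <- sign_vectors (size J)) c (Some b :: s) * incidence o J U s t else 0.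
Proof.
rewrite /boundary big_sign_vectorsS big1 ?add0r; last by move=> s _; rewrite incidence_NoneSome mulr0.
case: asboolP => rt; last first.
  by rewrite !big1 ?addr0 // => s _; rewrite incidence_Some asboolF ?andbF ?mulr0.
have E b' : \sum_(s <- sign_vectors (size J)) c (Some b' :: s) * incidence o hJ U (Some b' :: s) (Some b :: t)
    = if b' == b then \sum_(s <- sign_vectors (size J)) c (Some b' :: s) * incidence o J U s t else 0.
  case: eqP => [->|b'b]; last by apply: big1 => s _; rewrite incidence_Some eq_sym; case: eqP => // _; rewrite mulr0.
  by apply: eq_bigr => s _; rewrite incidence_Some eqxx asboolT.
by rewrite !E; case: b {rt E}; rewrite /= ?addr0 ?add0r.
Qed.

(** The hypothesis says that [c] vanishes on the walls inside cut cells.  Near the wall of [t],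
    only the two halves of [t] remain to contribute. *)
Lemma boundary_cut c t : cut t ->
  (forall s, c (None :: s) != 0 -> (flat J U s <= lker h)%VS) ->
  boundary o hJ U c (None :: t) =
    (c (Some true :: t) - c (Some false :: t)) * incidence o hJ U (Some true :: t) (None :: t).
Proof.
move=> ct c0; have /cutP ct' := ct; have nt := realizable_Some_flat (ct' true).
have tsv : t \in sign_vectors (size J).
  by rewrite mem_sign_vectors (realizable_size (realizable_behead (ct' true))).
have E b : \sum_(s <- sign_vectors (size J)) c (Some b :: s) * incidence o hJ U (Some b :: s) (None :: t)
    = c (Some b :: t) * incidence o hJ U (Some b :: t) (None :: t).
  rewrite (bigD1_seq t) ?sign_vectors_uniq //= big1 ?addr0 // => s st.
  rewrite incidence_nfacet ?mulr0 //; apply/negP => /facet_SomeNone[ts|[th _]].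
    by rewrite ts eqxx in st.
  by rewrite th in nt.
rewrite boundary_None !E incidence_cut_opp // mulrN mulrBl big1 ?add0r // => s _.
case: (eqVneq (c (None :: s)) 0) => [->|/c0 sh]; first by rewrite mul0r.
rewrite incidence_nfacet ?mulr0 //; apply/negP => /facetP[_ _ /= ts _].
by case/negP: nt; apply: subv_trans (flat_face J U ts) sh.
Qed.

(** The subdivision of a chain: a cell becomes the sum of its pieces of the same dimension,
    that is, of all its pieces except the wall when it is cut. *)
Definition subdiv c s : F :=
  if s is a :: s' then
    if `[< realizable hJ U s >] && ~~ ((a == None) && cut s') then c s' else 0
  else 0.

(** A cell [s] with a facet [t] in the hyperplane is not cut, since the points of its span on
    the hyperplane are those of the span of [t], unless [s] lies in the hyperplane altogether.
    Hence exactly one of the three pieces of [s] exists. *)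
Lemma incidence_subdiv s t : realizable hJ U (None :: t) -> (flat J U t <= lker h)%VS ->
  incidence o J U s t = (if (flat J U s <= lker h)%VS then incidence o hJ U (None :: s) (None :: t) else 0)
    + (incidence o hJ U (Some true :: s) (None :: t) + incidence o hJ U (Some false :: s) (None :: t)).
Proof.
move=> rt th; have nct b : ~ realizable hJ U (Some b :: t).
  by move=> /realizable_Some_flat; rewrite th.
have dcap V : (V <= lker h)%VS -> (V :&: lker h)%VS = V.
  by move=> Vh; apply/eqP; rewrite eqEdim capvSl /=; apply: dimvS; rewrite subv_cap Vh subvv.
case: (boolP (facet J U s t)) => st; last first.
  have nb b : incidence o hJ U (Some b :: s) (None :: t) = 0.
    apply: incidence_nfacet; apply/negP => f; have [ts|[_]] := facet_SomeNone f; last by apply/negP.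
    by apply: (nct b); rewrite ts; case/facetP: f.
  rewrite !nb !addr0 incidence_nfacet //; case: ifP => // sh.
  rewrite incidence_nfacet //; apply: contra st => /facetP[rs _ /= ts]; rewrite !flat_cap !dcap // => d.
  by apply/facetP; split=> //; [apply: realizable_behead rs|apply: realizable_behead rt].
have /facetP[rs rt' ts d] := st; have [x [xU xs]] := rs.
case: ifP => [sh|/negbT sh].
  have nb b : incidence o hJ U (Some b :: s) (None :: t) = 0.
    by apply: incidence_nfacet; apply/negP => /facetP[/realizable_Some_flat]; rewrite sh.
  have rs0 : realizable hJ U (None :: s).
    have [[b|] //] := realizable_cases rs; by move=> /realizable_Some_flat; rewrite sh.
  have f : facet hJ U (None :: s) (None :: t) by apply/facetP; split; rewrite //= !flat_cap !dcap.
  rewrite !nb !addr0 (incidence_pt Ho st xU xs).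
  have [y [yU ys]] := rs0; rewrite (incidence_pt Ho f yU ys) /= !flat_cap !dcap //.
  by rewrite -(incidence_pt Ho st yU) ?(incidence_pt Ho st xU xs) //; case: ys.
rewrite add0r.
have fE : (flat J U s :&: lker h)%VS = flat J U t.
  apply/esym/eqP; rewrite eqEdim subv_cap flat_face //= th /=.
  by rewrite -ltnS -d -dim_cap_ker.
have hx y : y \in U -> svec J y = s -> h y != 0.
  move=> yU ys; apply/eqP => hy; have := facet_notin st yU ys.
  by rewrite -fE memv_cap svec_flat // memv_ker hy eqxx.
have [b [rb nrb]] : exists b, realizable hJ U (Some b :: s) /\ ~ realizable hJ U (Some (~~ b) :: s).
  have nc : ~ cut s.
    by move=> /cut_None[y [yU [/eqP]]]; rewrite sgn_eq0 => hy ys; have := hx y yU ys; rewrite hy.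
  exists (0 < (h x : R)); split.
    exists x; split=> //=; rewrite xs /sgn.
    by have := hx x xU xs => /negbTE ->.
  move=> H; apply: nc; apply/cutP => b'.
  have H' : realizable hJ U (Some (0 < (h x : R)) :: s).
    exists x; split=> //=; rewrite xs /sgn.
    by have := hx x xU xs => /negbTE ->.
  by case: b' (0 < _) H H' => [] [].
have f : facet hJ U (Some b :: s) (None :: t).
  by apply/facetP; split; rewrite //= flat_cap dcap.
have -> : incidence o hJ U (Some true :: s) (None :: t) + incidence o hJ U (Some false :: s) (None :: t) =
    incidence o hJ U (Some b :: s) (None :: t).
  have n0 : incidence o hJ U (Some (~~ b) :: s) (None :: t) = 0.
    by apply: incidence_nfacet; apply/negP => /facetP[].
  by case: b n0 {rb nrb f} => /= ->; rewrite ?addr0 ?add0r.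
have [y [yU ys]] := rb; rewrite (incidence_pt Ho f yU ys) /= flat_cap dcap //.
by apply: incidence_pt => //; case: ys.
Qed.

(** On the wall of a cut cell, both sides vanish: there the boundaries of the two halves cancel
    by [incidence_cut_opp].  On the other cells the terms agree one by one. *)
Lemma boundary_subdiv c t : boundary o hJ U (subdiv c) t = subdiv (boundary o J U c) t.
Proof.
case: t => [|a t].
  by rewrite /boundary big1 // => s _; rewrite incidence_nfacet ?mulr0 //; apply/facetP => -[_ /realizable_size].
case: (asboolP (realizable hJ U (a :: t))) => rt; last first.
  rewrite /= asboolF //= /boundary big1 // => s _; rewrite incidence_nfacet ?mulr0 //.
  by apply/facetP => -[].
case: a rt => [b|] rt.
  rewrite boundary_Some asboolT //= asboolT //=; apply: eq_bigr => s _.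
  case: (boolP (facet J U s t)) => st; last by rewrite incidence_nfacet ?mulr0.
  have /facetP[rs _ ts _] := st.
  by rewrite asboolT //; apply: realizable_above rt rs ts.
have [ct|nct] := boolP (cut t).
  rewrite boundary_cut //= => [|s].
    have /cutP ct' := ct; by rewrite !asboolT // ct /= subrr mul0r.
  case: asboolP => //= rs; last by rewrite eqxx.
  case: (boolP (cut s)) => [|ncs _] /=; first by rewrite eqxx.
  by apply: contraNT ncs; apply: realizable_None_cut.
have th : (flat J U t <= lker h)%VS by apply: contraNT nct; apply: realizable_None_cut.
rewrite boundary_None /= asboolT // nct /= -!big_split /=; apply: eq_bigr => s _.
rewrite (incidence_subdiv s rt th) mulrDr mulrDr; congr (_ + (_ + _)).
- case: (asboolP (realizable hJ U (None :: s))) => rs /=; last first.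
    rewrite mul0r; case: ifP; rewrite ?mulr0 // => _; rewrite incidence_nfacet ?mulr0 //.
    by apply/facetP => -[].
  case: (boolP (flat J U s <= lker h)%VS) => sh.
    by rewrite ifT //; apply: contraL sh => /cutP/(_ true)/realizable_Some_flat.
  by rewrite realizable_None_cut //= mul0r mulr0.
- case: (asboolP (realizable hJ U (Some true :: s))) => rs //=.
  by rewrite incidence_nfacet ?mulr0 //; apply/facetP => -[].
- case: (asboolP (realizable hJ U (Some false :: s))) => rs //=.
  by rewrite incidence_nfacet ?mulr0 //; apply/facetP => -[].
Qed.
End AddHyperplane.

(** * Acyclicity of cones *)

(** [None] imposes nothing, [Some a] imposes a sign in the closure of [a]. *)
Definition constraint := option sign.

Fixpoint admissible (k : seq constraint) (s : seq sign) : bool :=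
  match k, s with
  | [::], [::] => true
  | a :: k', b :: s' => (if a is Some a' then (b == None) || (b == a') else true) && admissible k' s'
  | _, _ => false
  end.

Lemma admissible_face k s t : sface t s -> admissible k s -> admissible k t.
Proof.
elim: k s t => [|a k IH] [|b s] [|b' t] //= /andP[bb ts] /andP[ab ks].
rewrite (IH _ _ ts ks) andbT; case: a ab => // a ab.
by case/orP: bb => /eqP ->.
Qed.

Section Exactness.
Context (R : realFieldType) (W : vectType R) (F : comNzRingType).
Context (o : {vspace W} -> {vspace W} -> W -> F).
Context (Ho : orientation_system o).
Implicit Types (h : 'Hom(W, R^o)) (J : seq 'Hom(W, R^o)) (U : {vspace W}).
Implicit Types (s t : seq sign) (x y z : W) (c : seq sign -> F) (k : seq constraint).

Definition cone_cell J U k s : bool := `[< realizable J U s >] && admissible k s.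

Definition supported J U k c := forall s, ~~ cone_cell J U k s -> c s = 0.

Definition exact_cone J U k := forall c, supported J U k c ->
  (forall t, boundary o J U c t = 0) ->
  exists2 b, supported J U k b & forall t, boundary o J U b t = c t.

(** A convex cone which is not a linear subspace has a point whose opposite is not in it. *)
Definition nonlinear_cone J U k := exists x,
  [/\ x \in U, admissible k (svec J x) & ~~ admissible k (svec J (- x))].

Lemma boundaryB J U b c t : boundary o J U (fun s => b s - c s) t = boundary o J U b t - boundary o J U c t.
Proof. by rewrite /boundary -sumrB; apply: eq_bigr => s _; rewrite mulrBl. Qed.

Lemma boundaryD J U b c t : boundary o J U (fun s => b s + c s) t = boundary o J U b t + boundary o J U c t.
Proof. by rewrite /boundary -big_split; apply: eq_bigr => s _; rewrite /= mulrDl. Qed.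

Lemma eq_boundary J U b c t : b =1 c -> boundary o J U b t = boundary o J U c t.
Proof. by move=> bc; apply: eq_bigr => s _; rewrite bc. Qed.

Lemma boundary_supported J U k c : supported J U k c -> supported J U k (boundary o J U c).
Proof.
move=> ck t nt; rewrite /boundary big1 // => s _.
case: (boolP (facet J U s t)) => st; last by rewrite incidence_nfacet ?mulr0.
rewrite ck ?mul0r //; apply: contra nt => /andP[_ ks]; have /facetP[_ rt ts _] := st.
by rewrite /cone_cell asboolT //=; apply: admissible_face ts ks.
Qed.

Lemma supportedB J U k b c : supported J U k b -> supported J U k c ->
  supported J U k (fun s => b s - c s).
Proof. by move=> bk ck s ns; rewrite bk ?ck ?subrr. Qed.

(** Subdividing preserves exactness.  Let [z] be a cycle of the subdivision.  Subtracting the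
    boundary of a chain [y] on the positive halves of the cut cells removes the coefficients
    on the walls inside them.  Then the cycle condition at such a wall says that the
    coefficients on the two halves agree, so that the rest [z'] is the subdivision of a chain
    [w] of the coarse complex, which is a cycle and bounds there. *)
Lemma exact_free h J U k : exact_cone J U k -> exact_cone (h :: J) U (None :: k).
Proof.
move=> exJ z zk dz.
pose y s := if s is Some true :: s' then
    if cut h J U s' then z (None :: s') * incidence o (h :: J) U s (None :: s') else 0 else 0.
have yk : supported (h :: J) U (None :: k) y.
  move=> [|[[]|] s] //= ns; case: ifP => // cs; rewrite zk ?mul0r //.
  by apply: contra ns => /andP[_ /= ks]; rewrite /cone_cell /= ks andbT asboolT //; have /cutP := cs; apply.
pose z' s := z s - boundary o (h :: J) U y s.
have z'k : supported (h :: J) U (None :: k) z' by apply: supportedB => //; apply: boundary_supported.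
have dz' t : boundary o (h :: J) U z' t = 0 by rewrite boundaryB dz (boundary_boundary Ho) subrr.
have z'0 s : cut h J U s -> z' (None :: s) = 0.
  move=> cs; rewrite /z' (boundary_cut Ho) //= => [|s']; last by rewrite eqxx.
  rewrite cs subr0 -mulrA (incidence_sq Ho) ?mulr1 ?subrr //.
  by have /cutP H := cs; apply: facet_cut => //; apply: cut_None.
have z'h s : z' (None :: s) != 0 -> (flat J U s <= lker h)%VS.
  move=> nz; have rs : realizable (h :: J) U (None :: s).
    by apply/asboolP; apply: contraNT nz => nrs; rewrite z'k // /cone_cell (negbTE nrs).
  by apply: contraNT nz => sh; rewrite z'0 //; apply: realizable_None_cut.
have z'pm s : cut h J U s -> z' (Some true :: s) = z' (Some false :: s).
  move=> cs; have := dz' (None :: s); rewrite (boundary_cut Ho) // => /(congr1 (fun a =>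
    a * incidence o (h :: J) U (Some true :: s) (None :: s))).
  rewrite mul0r -mulrA (incidence_sq Ho) ?mulr1; first by move/subr0_eq.
  by have /cutP H := cs; apply: facet_cut => //; apply: cut_None.
pose w s := if cut h J U s then z' (Some true :: s)
  else z' (None :: s) + (z' (Some true :: s) + z' (Some false :: s)).
have z'n a s : ~ realizable (h :: J) U (a :: s) -> z' (a :: s) = 0.
  by move=> nr; apply: z'k; rewrite /cone_cell asboolF.
have z'E s : z' s = subdiv h J U w s.
  case: s => [|a s].
    by apply: z'k; rewrite /cone_cell andbF.
  rewrite /=; case: asboolP => [rs|/z'n -> //] /=.
  case: (boolP (cut h J U s)) => cs.
    rewrite andbT /w cs; case: a rs => [[]|] //= _; [by rewrite z'pm|exact: z'0].
  rewrite andbF /= /w (negbTE cs).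
  have n2 b b' : realizable (h :: J) U (b :: s) -> realizable (h :: J) U (b' :: s) -> b = b'.
    move=> rb rb'; apply/eqP; apply: contraNT cs => bb.
    case: b b' rb rb' bb => [b|] [b'|] // rb rb' bb.
    - by apply/cutP => -[]; case: b b' rb rb' bb => [] [].
    - by apply: realizable_None_cut => //; apply: realizable_Some_flat rb.
    - by apply: realizable_None_cut => //; apply: realizable_Some_flat rb'.
  have only b : b != a -> z' (b :: s) = 0.
    by move=> ba; apply: z'n => /(n2 _ _ rs) ab; rewrite ab eqxx in ba.
  case: a rs only => [[]|] rs only.
  - by rewrite (only None) // (only (Some false)) // addr0 add0r.
  - by rewrite (only None) // (only (Some true)) // !add0r.
  - by rewrite (only (Some true)) // (only (Some false)) // !addr0.
have wk : supported J U k w.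
  move=> s ns; have z's a : z' (a :: s) = 0.
    apply: z'k; apply: contra ns => /andP[/asboolP/realizable_behead rs /= ks].
    by rewrite /cone_cell ks andbT asboolT.
  by rewrite /w !z's !addr0; case: ifP.
have dw t : boundary o J U w t = 0.
  have [rt|nrt] := pselect (realizable J U t); last first.
    rewrite /boundary big1 // => s _; rewrite incidence_nfacet ?mulr0 //; by apply/facetP => -[].
  have Hs a : realizable (h :: J) U (a :: t) -> ~~ ((a == None) && cut h J U t) -> boundary o J U w t = 0.
    move=> ra na; have := dz' (a :: t); rewrite (eq_boundary _ _ _ z'E) (boundary_subdiv Ho) /= asboolT //.
    by rewrite na.
  case: (boolP (cut h J U t)) => ct; first by have /cutP H := ct; apply: (Hs (Some true)).
  by have [a ra] := realizable_cases h rt; apply: (Hs a) => //; rewrite (negbTE ct) andbF.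
have [v vk dv] := exJ w wk dw.
exists (fun s => subdiv h J U v s + y s) => [s ns|t].
  rewrite yk // addr0; case: s ns => [|a s] // ns /=.
  case: asboolP => //= ra; rewrite vk ?if_same //.
  apply: contra ns => /andP[_ ks]; by rewrite /cone_cell asboolT.
rewrite boundaryD (boundary_subdiv Ho).
have -> : subdiv h J U (boundary o J U v) t = subdiv h J U w t by case: t => //= a t; rewrite dv.
by rewrite -z'E /z' subrK.
Qed.

Lemma exact_zero h J U k : exact_cone J (U :&: lker h)%VS k ->
  exact_cone (h :: J) U (Some None :: k).
Proof.
move=> exJ z zk dz.
have z0 b s : z (Some b :: s) = 0 by apply: zk; rewrite /cone_cell /= andbF.
have zn : z [::] = 0 by apply: zk; rewrite /cone_cell /= andbF.
have bdE c t : (forall b s, c (Some b :: s) = 0) ->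
    boundary o (h :: J) U c (None :: t) = boundary o J (U :&: lker h)%VS (fun s => c (None :: s)) t.
  move=> c0; rewrite boundary_None [X in _ + X]addrC !(big1 _ _ (fun s => c (Some _ :: s) * _)) ?addr0.
  - by apply: eq_bigr => s _; rewrite incidence_None.
  - by move=> s _; rewrite c0 mul0r.
  - by move=> s _; rewrite c0 mul0r.
have cellE s : cone_cell (h :: J) U (Some None :: k) (None :: s) = cone_cell J (U :&: lker h)%VS k s.
  by rewrite /cone_cell /= realizable_None.
have [||v vk dv] := exJ (fun s => z (None :: s)).
- by move=> s ns; apply: zk; rewrite cellE.
- by move=> t; rewrite -bdE.
exists (fun s => if s is None :: s' then v s' else 0) => [[|[b|] s] //|].
  by rewrite cellE => /vk.
case=> [|[b|] t].
- by rewrite zn; apply: big1 => s _; rewrite incidence_nfacet ?mulr0 //; apply/facetP => -[_ /realizable_size].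
- rewrite z0; apply: big1 => -[|[b'|] s] _; rewrite ?mul0r //.
  by rewrite incidence_NoneSome mulr0.
- by rewrite bdE.
Qed.

(** Mayer-Vietoris for the two halves of a cone cut by [h].  A cycle [z] on one half is the
    boundary of a chain [v1 + v2] of the whole cone, split along the hyperplane.  Then
    [z - boundary v1 = boundary v2] is supported on both halves, that is, on the wall, where
    it bounds. *)
Lemma exact_half h J U k b : exact_cone (h :: J) U (None :: k) ->
  exact_cone (h :: J) U (Some None :: k) -> exact_cone (h :: J) U (Some (Some b) :: k).
Proof.
move=> exN ex0 z zk dz.
have [|v vk dv] := exN z _ dz.
  move=> [|a s] ns; apply: zk; apply: contra ns => /andP[rs] //= /andP[_ ks].
  by rewrite /cone_cell rs.
pose half s := if s is a :: _ then (a == None) || (a == Some b) else false.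
pose v1 s := if half s then v s else 0.
pose v2 s := if half s then 0 else v s.
have vE s : v s = v1 s + v2 s by rewrite /v1 /v2; case: ifP; rewrite ?addr0 ?add0r.
have v1k : supported (h :: J) U (Some (Some b) :: k) v1.
  move=> [|a s] // ns; rewrite /v1 /=; case: ifP => // as'; apply: vk.
  by apply: contra ns => /andP[rs /= ks]; rewrite /cone_cell rs /= as'.
have v2k : supported (h :: J) U (Some (Some (~~ b)) :: k) v2.
  move=> [|a s] ns; rewrite /v2 /=.
    by apply: vk; rewrite /cone_cell andbF.
  case: ifP => // as'; apply: vk; apply: contra ns => /andP[rs /= ks].
  by rewrite /cone_cell rs /= ks andbT; move: as'; clear; case: a => [[]|]; case: b.
pose w s := z s - boundary o (h :: J) U v1 s.
have wE s : w s = boundary o (h :: J) U v2 s.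
  by rewrite /w -dv (eq_boundary _ _ _ vE) boundaryD addrC addKr.
have w0 : supported (h :: J) U (Some None :: k) w.
  move=> s ns.
  case: (boolP (cone_cell (h :: J) U (Some (Some b) :: k) s)) => s1; last first.
    by apply: supportedB s1 => //; apply: boundary_supported.
  rewrite wE; apply: (boundary_supported v2k); apply: contra ns.
  case/andP: s1 => rs; case: s rs => [|a s] rs //= /andP[as' ks] /andP[_ /= /andP[as'' _]].
  rewrite /cone_cell rs /= ks andbT.
  by move: as' as''; clear; case: a => [[]|]; case: b.
have [t|u uk du] := ex0 w w0; first by rewrite boundaryB dz (boundary_boundary Ho) subrr.
exists (fun s => v1 s + u s) => [s ns|t].
  rewrite v1k // uk ?addr0 //; apply: contra ns; case: s => [|a s]; rewrite /cone_cell ?andbF //=.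
  by move=> /and3P[-> /orP[] /eqP -> ->]; rewrite eqxx.
by rewrite boundaryD du /w addrC subrK.
Qed.
End Exactness.

Section NonlinearCones.
Context (R : realFieldType) (W : vectType R) (F : comNzRingType).
Context (o : {vspace W} -> {vspace W} -> W -> F).
Context (Ho : orientation_system o).
Implicit Types (h : 'Hom(W, R^o)) (J : seq 'Hom(W, R^o)) (U : {vspace W}).
Implicit Types (s t : seq sign) (x y z : W) (c : seq sign -> F) (k : seq constraint).

Lemma admissible_closed (s t : seq sign) : admissible [seq Some a | a <- s] t = sface t s.
Proof. by elim: s t => [|a s IH] [|b t] //=; rewrite IH. Qed.

Lemma sface_cone J s x y (a : R) : 0 <= a -> sface (svec J x) s -> sface (svec J y) s ->
  sface (svec J (x + a *: y)) s.
Proof.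
move=> a0; elim: J s => [|h J IH] [|b s] //= /andP[xb xs] /andP[yb ys].
rewrite IH // andbT linearD linearZ /= -[_ *: _]/(_ * _).
case: b xb yb => [[]|]; rewrite !sgn_eq0 ?sgn_pos ?sgn_neg; last first.
- by rewrite !orbb => /eqP -> /eqP ->; rewrite mulr0 addr0 eqxx.
- rewrite ![_ == 0 :> R]eq_sym !(eq_sym 0) -!le_eqVlt => hx hy.
  by rewrite -oppr_ge0 opprD -mulrN addr_ge0 ?mulr_ge0 ?oppr_ge0.
- rewrite !(eq_sym _ 0) -!le_eqVlt => hx hy.
  by rewrite addr_ge0 ?mulr_ge0.
Qed.

Lemma sface_opp s t : sface t s -> sface [seq omap negb a | a <- t] s -> t = nseq (size t) None.
Proof.
elim: t s => [|a t IH] [|b s] //= /andP[ab ts] /andP[ab' ts']; rewrite -(IH _ ts ts').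
by congr cons; move: ab ab'; clear; case: a => [[]|] //; case: b => [[]|].
Qed.

Lemma svec0 J : svec J (0 : W) = nseq (size J) None.
Proof. by elim: J => //= h J ->; rewrite linear0 sgn0. Qed.

(** Induction on the number of constraints.  Let [C] be the cone of the constraints other than
    the one on [h].  When [C] is not a subspace and reaches the side of [h] which is excluded,
    the two halves and the wall are compared by [exact_half]; the wall is again nonlinear.
    When [C] does not reach that side, the constraint on [h] is automatic.  When [C] is a
    subspace, its half has just two cells, and the complex is an isomorphism between them. *)
Lemma exact_closed J U s : size s = size J ->
  nonlinear_cone J U [seq Some a | a <- s] -> exact_cone o J U [seq Some a | a <- s].
Proof.
elim: J U s => [|h J IH] U [|a s] //; first by move=> _ [x []].
case=> sz [x []]; rewrite !admissible_closed => xU xs nxs.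
have pt0 y : y \in U -> h y = 0 -> sface (svec J y) s -> ~~ sface (svec J (- y)) s ->
    exact_cone o J (U :&: lker h)%VS [seq Some a | a <- s].
  move=> yU hy ys nys; apply: IH => //; exists y.
  by rewrite !admissible_closed memv_cap yU memv_ker hy eqxx.
case: a xs nxs => [b|] /=; last first.
  rewrite orbb linearN /= !sgn_eq0 oppr_eq0 orbb => /andP[/eqP hx xs].
  by rewrite hx eqxx /= => nxs; apply: exact_zero; apply: pt0 xU hx xs nxs.
move=> /andP[xb xs] nxs.
have [[q [qU]]|np] := pselect (nonlinear_cone J U [seq Some a | a <- s]).
  rewrite !admissible_closed => qs nqs.
  have exN : exact_cone o (h :: J) U (None :: [seq Some a | a <- s]).
    apply: (exact_free Ho); apply: IH => //; exists q.
    by rewrite !admissible_closed qU qs.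
  have [[y [yU ys yb]]|ny] := pselect (exists y, [/\ y \in U, sface (svec J y) s
      & sgn (h y : R) = Some (~~ b)]).
    apply: (exact_half Ho exN); apply: exact_zero.
    (* a point of the wall whose opposite is outside [C]: it is [x] or [q] if one of them is
       on the wall, and otherwise a positive combination of [q] and a point across the wall *)
    have [hx|hx] := eqVneq (h x : R) 0.
      by apply: (pt0 x) => //; move: nxs; rewrite linearN /= hx oppr0 sgn0 eqxx.
    have hxb : sgn (h x : R) = Some b by move: xb; rewrite sgn_eq0 (negbTE hx) => /eqP.
    have [hq|hq] := eqVneq (h q : R) 0; first exact: (pt0 q).
    have [y' [y'U y's y'q]] : exists y', [/\ y' \in U, sface (svec J y') s &
        0 < - (h q : R) / (h y' : R)].
      have sgnq : sgn (h q : R) = Some b \/ sgn (h q : R) = Some (~~ b).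
        by move: hq; rewrite -sgn_eq0; case: (sgn _) => // -[]; case: b {hxb xb yb nxs}; [left|right|right|left].
      have opp (u v : R) (c : bool) : sgn u = Some c -> sgn v = Some (~~ c) -> 0 < - u / v.
        case: c => /eqP; rewrite ?sgn_pos ?sgn_neg => u0 /eqP; rewrite ?sgn_pos ?sgn_neg => v0.
          by rewrite mulNr oppr_gt0 pmulr_rlt0 // invr_lt0.
        by rewrite divr_gt0 // oppr_gt0.
      case: sgnq => sq; [exists y|exists x]; split=> //; first exact: opp sq yb.
      by apply: opp sq _; rewrite negbK.
    set a : R := _ / _ in y'q.
    have y'0 : (h y' : R) != 0.
      by apply: contraTneq y'q => y'0; rewrite /a y'0 invr0 mulr0 ltxx.
    apply: (pt0 (q + a *: y')).
    - by rewrite memvD ?memvZ.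
    - by rewrite linearD linearZ /= -[_ *: _]/(_ * _) /a divfK ?addrN.
    - exact: sface_cone (ltW y'q) qs y's.
    - apply: contra nqs => H; have := sface_cone (ltW y'q) H y's.
      by rewrite opprD subrK.
  have nyb t : realizable (h :: J) U t -> admissible (None :: [seq Some a | a <- s]) t ->
      admissible (Some (Some b) :: [seq Some a | a <- s]) t.
    case=> y [yU <-] /=; rewrite admissible_closed => ys; rewrite ys andbT.
    have : sgn (h y : R) <> Some (~~ b) by move=> yb; apply: ny; exists y.
    by clear; case: (sgn _) => // -[]; case: b.
  move=> z zk dz; have [|v vk dv] := exN z _ dz.
    move=> t nt; apply: zk; apply: contra nt; rewrite /cone_cell; case: t => [|c t] /=.
      by rewrite andbF.
    by move=> /and3P[-> _ ->].
  exists v => // t nt; apply: vk; apply: contra nt => /andP[rt kt].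
  by rewrite /cone_cell rt nyb //; apply/asboolP.
(* [C] is a subspace, so all functionals of [J] vanish on it *)
have lin y : y \in U -> sface (svec J y) s -> svec J y = nseq (size J) None.
  move=> yU ys; rewrite -(size_svec J y); apply: (sface_opp ys); rewrite -svecN.
  apply: contrapT => /negP nys; apply: np; exists y.
  by rewrite !admissible_closed.
have xz := lin x xU xs; have hxb : sgn (h x : R) = Some b.
  move: xb; case: (eqVneq (sgn (h x : R)) None) => //= [hx _|_ /eqP //].
  case/negP: nxs; rewrite linearN /= sgnN hx /= svecN xz.
  by rewrite map_nseq /= -xz.
pose s1 := Some b :: nseq (size J) None; pose s0 := (None : sign) :: nseq (size J) None.
have r1 : realizable (h :: J) U s1 by exists x; rewrite /= hxb xz.
have r0 : realizable (h :: J) U s0.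
  by exists 0; rewrite mem0v; split=> //=; rewrite linear0 sgn0 svec0.
have cells t : cone_cell (h :: J) U [seq Some a | a <- Some b :: s] t -> t = s0 \/ t = s1.
  case/andP => /asboolP[y [yU <-]]; rewrite admissible_closed /= => /andP[yb ys].
  by rewrite (lin y) //; case/orP: yb => /eqP ->; [left|right].
have f10 : facet (h :: J) U s1 s0 by apply: facet_cut.
have s0k : cone_cell (h :: J) U [seq Some a | a <- Some b :: s] s0.
  rewrite /cone_cell asboolT //= admissible_closed; apply: sface_trans xs.
  by rewrite xz sface_refl.
have s1k : cone_cell (h :: J) U [seq Some a | a <- Some b :: s] s1.
  by rewrite /cone_cell asboolT //= admissible_closed eqxx -xz.
have s1sv : s1 \in sign_vectors (size (h :: J)) by rewrite mem_sign_vectors (realizable_size r1).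
have only0 t : t <> s0 -> incidence o (h :: J) U s1 t = 0.
  move=> t0; apply: incidence_nfacet; apply/negP => f; have := facet_neq f.
  case/facetP: f => _ rt ts _; have [|//|->] := cells t _; last by rewrite eqxx.
  rewrite /cone_cell asboolT // admissible_closed; apply: sface_trans ts _.
  by rewrite /= eqxx -xz.
have bd1 c t : (forall s', s' <> s1 -> c s' * incidence o (h :: J) U s' t = 0) ->
    boundary o (h :: J) U c t = c s1 * incidence o (h :: J) U s1 t.
  move=> H; rewrite /boundary (bigD1_seq s1) ?sign_vectors_uniq //= big1 ?addr0 // => s' /eqP.
  exact: H.
have bot t : incidence o (h :: J) U s0 t = 0.
  apply: incidence_nfacet; apply/negP => f; have := facet_neq f; case/facetP: f => _ _ ts _.
  case/eqP; apply: (sface_szero_eq ts); apply/szeroP => [|j]; first by rewrite (sface_size ts).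
  by move=> _; rewrite -[s0]/(nseq (size J).+1 None) nth_nseq if_same.
move=> z zk dz; pose i := incidence o (h :: J) U s1 s0.
have ii : i * i = 1 by apply: incidence_sq.
have zsupp t : t <> s0 -> t <> s1 -> z t = 0.
  by move=> t0 t1; apply: zk; apply/negP => /cells[].
have z1 : z s1 = 0.
  have := dz s0; rewrite bd1 => [|s' s'1]; last first.
    by have [->|/eqP s'0] := eqVneq s' s0; [rewrite bot mulr0|rewrite zsupp ?mul0r].
  by move=> /(congr1 (fun a => a * i)); rewrite mul0r -mulrA ii mulr1.
exists (fun t => if t == s1 then z s0 * i else 0) => [t nt|t].
  by case: eqP => // ts1; rewrite ts1 s1k in nt.
rewrite bd1 => [|s' /eqP/negbTE ->]; last by rewrite mul0r.
rewrite eqxx; have [->|/eqP t0] := eqVneq t s0; first by rewrite -mulrA ii mulr1.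
rewrite only0 // mulr0; have [->|/eqP t1] := eqVneq t s1; first by rewrite z1.
by rewrite zsupp.
Qed.

(** The unconstrained functionals only subdivide the cone. *)
Lemma exact_nonlinear_cone J U m s : (m + size s = size J)%N ->
  nonlinear_cone J U (nseq m None ++ [seq Some a | a <- s]) ->
  exact_cone o J U (nseq m None ++ [seq Some a | a <- s]).
Proof.
elim: m J => [|m IH] J; first by move=> sz; apply: exact_closed.
case: J => // h J [sz] [x [xU /= xk nxk]]; apply: (exact_free Ho); apply: IH => //.
by exists x.
Qed.
End NonlinearCones.

(** * Orientations from determinants *)

Section SignRing.
Context (R : realFieldType) (F : comNzRingType).
Definition signr (a : R) : F := if 0 < a then 1 else -1.
Lemma signr_sq a : signr a * signr a = 1.
Proof. by rewrite /signr; case: ifP; rewrite ?mulrNN mulr1. Qed.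
Lemma signrM a b : a != 0 -> b != 0 -> signr (a * b) = signr a * signr b.
Proof.
rewrite /signr; case: (ltrgt0P a) => // a0 _; case: (ltrgt0P b) => // b0 _.
- by rewrite mulr_gt0 // mulr1.
- by rewrite ltNge ltW ?nmulr_llt0 // mul1r.
- by rewrite ltNge ltW ?nmulr_rlt0 // mulr1.
- by rewrite nmulr_lgt0 // a0 mulrNN mulr1.
Qed.
Lemma signrN a : a != 0 -> signr (- a) = - signr a.
Proof.
rewrite /signr oppr_gt0; case: (ltrgt0P a) => // _ _; by rewrite opprK.
Qed.
End SignRing.

Section OrientedBases.
Context (R : realFieldType) (W : vectType R).
Implicit Types (S T Q : {vspace W}) (e f : seq W) (x w : W) (p : nat -> nat -> R).

Definition vcoord T (i : nat) x : R :=
  if insub i is Some k then coord (vbasis T) k x else 0.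

Lemma vcoord_ord T (k : 'I_(\dim T)) x : vcoord T k x = coord (vbasis T) k x.
Proof. by rewrite /vcoord valK. Qed.

Lemma vcoord_sum T x : x \in T -> x = \sum_(i < \dim T) vcoord T i x *: (vbasis T)`_i.
Proof. by move=> /coord_vbasis {1}->; apply: eq_bigr => i _; rewrite vcoord_ord. Qed.

Definition coord_mx S e : 'M[R]_(\dim S) := \matrix_(i, j) coord (vbasis S) j e`_i.

(** Determinant of a list of vectors in the basis [vbasis S] of [S]; entries beyond the
    dimension are ignored and missing ones are zero. *)
Definition odet S e : R := \det (coord_mx S e).

Lemma odet_change S e f p :
  (forall j, (j < \dim S)%N -> f`_j = \sum_(i < \dim S) p i j *: e`_i) ->
  odet S f = \det (\matrix_(j < \dim S, i < \dim S) p i j) * odet S e.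
Proof.
move=> fE; rewrite /odet -det_mulmx; congr (\det _); apply/matrixP => i j.
rewrite !mxE fE // linear_sum; apply: eq_bigr => k _.
by rewrite linearZ !mxE.
Qed.

Lemma odet_vbasis S : odet S (vbasis S) = 1.
Proof.
rewrite /odet (_ : coord_mx _ _ = 1%:M) ?det1 //; apply/matrixP => i j.
by rewrite !mxE coord_free ?(basis_free (vbasisP S)) // eq_sym.
Qed.

Lemma odet_basis S e : size e = \dim S -> (S <= <<e>>)%VS -> odet S e != 0.
Proof.
move=> sz Se.
have H x : x \in S -> exists c : nat -> R, x = \sum_(i < \dim S) c i *: e`_i.
  move=> /(subvP Se); rewrite -sz.
  rewrite -(in_tupleE e) => /coord_span xE.
  exists (fun i => if insub i is Some k then coord (in_tuple e) k x else 0).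
  by rewrite {1}xE; apply: eq_bigr => i _; rewrite valK.
have /choice[p pE] : forall j, exists c : nat -> R, (j < \dim S)%N ->
    (vbasis S)`_j = \sum_(i < \dim S) c i *: e`_i.
  move=> j; case: (ltnP j (\dim S)) => jS; last by exists (fun=> 0).
  by have [|c cE] := H (vbasis S)`_j; [rewrite vbasis_mem ?mem_nth ?size_tuple|exists c].
have := odet_change (p := fun i j => p j i) pE; rewrite odet_vbasis => E.
by apply: contra_eq_neq E => ->; rewrite mulr0 oner_eq0.
Qed.

Lemma det_head n (b : nat -> nat -> R) :
  \det (\matrix_(j < n.+1, i < n.+1) (if (j == 0 :> nat) || (i == 0 :> nat) then (i == j)%:R else b i.-1 j.-1))
  = \det (\matrix_(j < n, i < n) b i j).
Proof.
rewrite (expand_det_row _ ord0) (bigD1 ord0) //= big1 ?addr0 => [|i i0].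
  rewrite mxE eqxx mul1r /cofactor expr0 mul1r; congr (\det _).
  by apply/matrixP => i j; rewrite !mxE.
by rewrite mxE /= (negbTE i0) mul0r.
Qed.

(** The change of basis from [w :: vbasis T] to [w :: e] is block diagonal. *)
Lemma odet_cons S T w e : \dim S = (\dim T).+1 -> (forall i, e`_i \in T) ->
  odet S (w :: e) = odet T e * odet S (w :: vbasis T).
Proof.
move=> d eT; pose b i j := vcoord T i e`_j.
rewrite (@odet_change S (w :: vbasis T) (w :: e) (fun i j =>
  if (j == 0)%N || (i == 0)%N then (i == j)%:R else b i.-1 j.-1)); last first.
  move=> [|j]; rewrite d big_ord_recl /=.
    by move=> _; rewrite scale1r big1 ?addr0 // => i _; rewrite scale0r.
  by move=> _; rewrite scale0r add0r {1}(vcoord_sum (eT j)).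
congr (_ * _); rewrite d (@det_head (\dim T) b); congr (\det _).
by apply/matrixP => j i; rewrite !mxE /b vcoord_ord.
Qed.

Lemma odet_addl S w e (a : R) (c : nat -> R) : (0 < \dim S)%N ->
  odet S (a *: w + \sum_(i < (\dim S).-1) c i *: e`_i :: e) = a * odet S (w :: e).
Proof.
move=> d0.
rewrite (@odet_change S (w :: e) (a *: w + \sum_(i < (\dim S).-1) c i *: e`_i :: e) (fun i j =>
  if (j == 0)%N then if (i == 0)%N then a else c i.-1 else (i == j)%:R)); last first.
  move=> j jS; case: j jS => [|j] jS /=.
    by rewrite -[in RHS](prednK d0) big_ord_recl.
  rewrite (bigD1 (Ordinal jS)) //= eqxx scale1r big1 ?addr0 //.
  move=> i ij; rewrite (negbTE (_ : (i : nat) != j.+1)) ?scale0r //.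
congr (_ * _); rewrite -det_tr det_trig; last first.
  apply/is_trig_mxP => i j ij; rewrite !mxE.
  by case: ifP => [/eqP j0|_]; [rewrite j0 in ij|rewrite ltn_eqF].
rewrite (bigD1 (Ordinal d0)) //= !mxE /= big1 ?mulr1 // => i i0.
rewrite !mxE eqxx ifN //.
Qed.

Lemma odet_head S T w t (a : R) : \dim S = (\dim T).+1 -> t \in T ->
  odet S (a *: w + t :: vbasis T) = a * odet S (w :: vbasis T).
Proof.
move=> d tT; have := @odet_addl S w (vbasis T) a (vcoord T ^~ t); rewrite d => /(_ isT).
by rewrite -vcoord_sum.
Qed.

Lemma odet_swap S u w e : (1 < \dim S)%N -> odet S (u :: w :: e) = - odet S (w :: u :: e).
Proof.
move=> d1; pose i0 := Ordinal (ltnW d1); pose i1 := Ordinal d1.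
have -> : odet S (u :: w :: e) = \det (xrow i0 i1 (coord_mx S (w :: u :: e))).
  congr (\det _); apply/matrixP => i j; rewrite !mxE; congr (coord _ _ _).
  case: tpermP => [->|->|] //; case: i => [[|[|i]] iS] //= H1 H2.
    by case: H1; apply: val_inj.
  by case: H2; apply: val_inj.
by rewrite xrowE det_mulmx det_perm odd_tperm /= expr1 mulN1r.
Qed.

(** For [u] in a facet and [w] in the cell, [u - w] points outwards; this relates the basis
    given by an outward vector to the one given by a point of the cell. *)
Lemma odet_step S u w e : (1 < \dim S)%N -> odet S (u :: u - w :: e) = odet S (w :: u :: e).
Proof.
move=> d1; rewrite [LHS]odet_swap //; apply: oppr_inj; rewrite opprK -mulN1r.
rewrite -(@odet_addl S w (u :: e) (-1) (fun i => (i == 0)%:R)) ?(ltnW d1) //.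
have d2 : (0 < (\dim S).-1)%N by case: (\dim S) d1 => [|[]].
rewrite scaleN1r (bigD1 (Ordinal d2)) //= scale1r big1 => [|i i0].
  by rewrite addr0 addrC.
by rewrite (negbTE (_ : (i : nat) != 0%N)) ?scale0r.
Qed.

Definition orient (F : comNzRingType) S T w : F := signr F (odet S (w :: vbasis T)).
End OrientedBases.

(** For [or_swap], both products are the sign of the determinant of one basis of [S], made of
    [u], [w] and [vbasis Q], but with [u] and [w] exchanged. *)
Lemma orientP (R : realFieldType) (W : vectType R) (F : comNzRingType) :
  orientation_system (@orient R W F).
Proof.
have nz (S T : {vspace W}) w : (T <= S)%VS -> \dim S = (\dim T).+1 -> w \in S -> w \notin T ->
    odet S (w :: vbasis T) != 0.
  move=> TS d wS wT; apply: odet_basis; first by rewrite /= size_tuple.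
  rewrite span_cons (span_basis (vbasisP T)) addvC.
  have -> : S = (T + <[w]>)%VS; last exact: subvv.
  by apply/esym/eqP; rewrite eqEdim subv_add TS -memvE wS dim_line_add // d leqnn.
split.
- by move=> S T w; apply: signr_sq.
- move=> S T w t a TS d wS wT tT a0; rewrite /orient odet_head //.
  by rewrite /signr pmulr_rgt0.
- move=> S T w TS d wS wT; rewrite /orient -[- w]addr0 -scaleN1r.
  by rewrite odet_head ?mem0v // mulN1r; apply: signrN; apply: nz.
- move=> S Q u w QS d uS wS uw wu.
  have uQ : u \notin Q by apply: contraNN uw; apply: (subvP (addvSl _ _)).
  have wQ : w \notin Q by apply: contraNN wu; apply: (subvP (addvSl _ _)).
  have du := dim_line_add uQ; have dw := dim_line_add wQ.
  have sub x : x \in S -> (Q + <[x]> <= S)%VS by move=> xS; rewrite subv_add QS -memvE.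
  have E x y : x \in S -> y \in S -> x \notin Q -> y \notin (Q + <[x]>)%VS ->
      orient F S (Q + <[x]>) y * orient F (Q + <[x]>) Q x = signr F (odet S (y :: x :: vbasis Q)) /\
      odet S (y :: x :: vbasis Q) != 0.
    move=> xS yS xQ yx; have dx := dim_line_add xQ.
    have xx : x \in (Q + <[x]>)%VS by rewrite memvE addvSr.
    have eT i : (x :: vbasis Q)`_i \in (Q + <[x]>)%VS.
      case: i => //= i; apply: (subvP (addvSl Q <[x]>)).
      case: (ltnP i (size (vbasis Q))) => iQ; first by rewrite vbasis_mem ?mem_nth.
      by rewrite nth_default ?mem0v.
    rewrite /orient (@odet_cons _ _ S (Q + <[x]>)%VS y (x :: vbasis Q)) ?dx //.
    have n1 : odet S (y :: vbasis (Q + <[x]>)) != 0 by apply: nz; rewrite ?sub ?dx.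
    have n2 : odet (Q + <[x]>) (x :: vbasis Q) != 0 by apply: nz; rewrite ?addvSl.
    by split; [rewrite mulrC; apply/esym/signrM|rewrite mulf_neq0].
  have [-> n1] := E _ _ wS uS wQ uw; have [-> n2] := E _ _ uS wS uQ wu.
  rewrite odet_swap ?d //; exact: signrN.
Qed.

(** * Homogenisation of a periodic arrangement *)

Lemma sface_map (T : Type) (f g : T -> sign) (l : seq T) :
  sface (map f l) (map g l) = all (fun a => (f a == None) || (f a == g a)) l.
Proof. by elim: l => //= a l ->. Qed.

Section Periodic.
Context (R : realType) (V : vectType R) (n : nat) (H : 'I_n -> 'Hom(V, R^o)).
Context (Hsep : forall x, (forall i, H i x = 0) -> x = 0).
Implicit Types (x y : V) (i : 'I_n) (c : int).

Definition level_sign i c x : sign := sgn ((H i x : R) - c%:~R).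

Definition level_face y x := forall i c, level_sign i c y = None \/ level_sign i c y = level_sign i c x.
Definition same_levels x y := forall i c, level_sign i c x = level_sign i c y.

Lemma level_face_refl x : level_face x x. Proof. by move=> i c; right. Qed.

Definition integral x i : bool := `[< exists c, (H i x : R) = c%:~R >].

(** The directions along which the stratum of [x] extends. *)
Definition level_dir x : {vspace V} := (\bigcap_(i | integral x i) lker (H i))%VS.

Lemma mem_level_dir x w : (w \in level_dir x) <-> forall i c, (H i x : R) = c%:~R -> H i w = 0.
Proof.
rewrite memvE; split=> [/subv_bigcapP wD i c xc|wD].
  by have := wD i; rewrite -memvE memv_ker => /(_ _)/eqP; apply; apply/asboolP; exists c.
by apply/subv_bigcapP => i /asboolP[c xc]; rewrite -memvE memv_ker (wD i c).
Qed.

(** Homogenisation: [x] becomes the ray through [(x, 1)], the hyperplane [H i = c]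
    becomes a linear one, and a finite window becomes a cone. *)
Local Notation W := (V * R^o)%type.

Definition hcoord : 'Hom(W, R^o) := linfun (@snd V R^o).
Definition hplane i (c : R) : 'Hom(W, R^o) := linfun (H i \o @fst V R^o) - c *: hcoord.
Definition hpt x : W := (x, 1).
Definition hdir x : W := (x, 0).

Lemma hcoordE (w : W) : hcoord w = w.2. Proof. by rewrite lfunE. Qed.
Lemma hplaneE i (c : R) (w : W) : hplane i c w = (H i w.1 : R) - c * w.2 :> R.
Proof. by rewrite add_lfunE opp_lfunE scale_lfunE hcoordE lfunE. Qed.

Context (N : nat) (u : 'I_n -> int) (uN : forall i, - (N%:Z) <= u i <= N%:Z).

Definition levels : seq int := [seq a%:Z - N%:Z | a <- iota 0 (N + N).+1].

Lemma mem_levels c : (c \in levels) = (- (N%:Z) <= c <= N%:Z).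
Proof.
apply/mapP/idP => [[a]|cN]; first by rewrite mem_iota => aN ->; lia.
exists (absz (c + N%:Z)); last by lia.
by rewrite mem_iota; lia.
Qed.

(** The functionals of [cutting] subdivide the window, those of [bounding] constrain it.  As
    the bounds are integers, the window is a union of strata. *)
Definition cutting : seq 'Hom(W, R^o) := [seq hplane i c%:~R | i <- enum 'I_n, c <- levels].

Definition bounding : seq 'Hom(W, R^o) :=
  hcoord :: [seq - hplane i (u i)%:~R | i <- enum 'I_n] ++
            [seq hplane i (- N%:R) | i <- enum 'I_n].

Definition window := cutting ++ bounding.
Definition window_constraints : seq constraint :=
  nseq (size cutting) None ++ [seq Some a | a <- nseq (size bounding) (Some true)].

Definition point_in_window x := forall i, - N%:R <= (H i x : R) <= (u i)%:~R.

Lemma admissible_cat (k k' : seq constraint) (s s' : seq sign) : size k = size s ->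
  admissible (k ++ k') (s ++ s') = admissible k s && admissible k' s'.
Proof.
by elim: k s => [|a k IH] [|b s] //= [/IH ->]; rewrite andbA.
Qed.

Lemma sface_pos (l : seq 'Hom(W, R^o)) w :
  sface (svec l w) (nseq (size l) (Some true)) = all (fun h : 'Hom(W, R^o) => 0 <= (h w : R)) l.
Proof.
elim: l => //= h l ->; congr (_ && _).
by rewrite sgn_eq0 sgn_pos le_eqVlt eq_sym.
Qed.

Lemma admissible_window w : admissible window_constraints (svec window w) <->
  0 <= (w.2 : R) /\ forall i, - N%:R * w.2 <= (H i w.1 : R) <= (u i)%:~R * w.2.
Proof.
rewrite /svec map_cat admissible_cat ?size_nseq ?size_map //.
rewrite (_ : admissible (nseq _ _) _ = true); last first.
  by rewrite -(size_map (fun h : 'Hom(W, R^o) => sgn (h w : R)) cutting); elim: (map _ _).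
rewrite admissible_closed -/(svec bounding w) sface_pos /= all_cat !all_map hcoordE.
split=> [/and3P[-> /allP H1 /allP H2]|[-> HH]].
  split=> // i; have ie : i \in Finite.enum 'I_n by rewrite -enumT mem_enum.
  have := H1 i ie; have := H2 i ie => /=.
  by rewrite opp_lfunE !hplaneE; lra.
apply/andP; split=> //; apply/andP; split; apply/allP => i _ /=.
  by rewrite opp_lfunE hplaneE; have := HH i; lra.
by rewrite hplaneE; have := HH i; lra.
Qed.

Lemma admissible_hpt x : admissible window_constraints (svec window (hpt x)) <-> point_in_window x.
Proof.
rewrite admissible_window /=; split=> [[_ HH] i|HH]; first by have := HH i; lra.
by split=> // i; have := HH i; lra.
Qed.

(** The window is bounded since the [H i] separate points, so that its cone meets the
    hyperplane at infinity in 0 only. *)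
Lemma bounded_window w : admissible window_constraints (svec window w) -> w.2 = 0 -> w = 0.
Proof.
move=> /admissible_window[_]; case: w => w1 w2 /= HH w20; rewrite w20 in HH *.
congr pair; apply: Hsep => i; have := HH i; rewrite !mulr0 => HH'.
by apply/eqP; rewrite eq_le andbC.
Qed.

Lemma hplane_level_sign i c x : sgn (hplane i c%:~R (hpt x) : R) = level_sign i c x.
Proof. by rewrite hplaneE mulr1. Qed.

Lemma mem_cutting i c : - (N%:Z) <= c <= N%:Z -> hplane i c%:~R \in window.
Proof.
move=> cN; rewrite mem_cat; apply/orP; left; apply/allpairsP; exists (i, c).
by rewrite mem_enum mem_levels.
Qed.

(** Only integer levels between [- N] and [N] separate points of the window. *)
Lemma window_face x y : point_in_window x -> point_in_window y ->
  sface (svec window (hpt y)) (svec window (hpt x)) <-> level_face y x.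
Proof.
move=> wx wy; rewrite sface_map; split=> [/allP HH i c|HH].
  case: (boolP (- (N%:Z) <= c <= N%:Z)) => cN.
    have := HH _ (mem_cutting i cN); rewrite !hplane_level_sign.
    by case/orP => /eqP; [left|right].
  right; rewrite /level_sign; have := wx i; have := wy i => /andP[y1 y2] /andP[x1 x2].
  have ui : (u i)%:~R <= N%:R :> R by rewrite -[N%:R]/(N%:Z%:~R) ler_int; have /andP[] := uN i.
  move: cN; rewrite negb_and -!ltNge => /orP[cN|cN].
    have cN' : c%:~R < - N%:R :> R by rewrite -[N%:R]/(N%:Z%:~R) -rmorphN ltr_int.
    by transitivity (Some true); [|symmetry]; apply/eqP; rewrite sgn_pos; lra.
  have cN' : N%:R < c%:~R :> R by rewrite -[N%:R]/(N%:Z%:~R) ltr_int.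
  by transitivity (Some false); [|symmetry]; apply/eqP; rewrite sgn_neg; lra.
have P i c : (level_sign i c y == None) || (level_sign i c y == level_sign i c x).
  by have [->|->] := HH i c; rewrite eqxx ?orbT.
rewrite all_cat /= !hcoordE eqxx orbT /= all_cat; apply/and3P; split; apply/allP.
- by move=> _ /allpairsP[[i c] /= [_ _ ->]]; rewrite !hplane_level_sign.
- move=> _ /mapP[i _ ->]; rewrite !opp_lfunE !sgnN !hplane_level_sign.
  by case/orP: (P i (u i)) => /eqP ->; rewrite ?eqxx ?orbT.
- move=> _ /mapP[i _ ->].
  by rewrite -[N%:R]/(N%:Z%:~R) -rmorphN !hplane_level_sign.
Qed.

Lemma level_face_anti x y : level_face x y -> level_face y x -> same_levels x y.
Proof. by move=> xy yx i c; case: (xy i c) (yx i c) => [->|->] // [] ->. Qed.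

Lemma window_same x y : point_in_window x -> point_in_window y ->
  svec window (hpt x) = svec window (hpt y) <-> same_levels x y.
Proof.
move=> wx wy; split=> [E|E].
  by apply: level_face_anti; apply/window_face => //; rewrite E sface_refl.
by apply: sface_anti; apply/window_face => // i c; right; rewrite E.
Qed.

Lemma same_levels_in_window x y : same_levels x y -> point_in_window x -> point_in_window y.
Proof.
move=> xy wx i; have /andP[x1 x2] := wx i; apply/andP; split.
  have := xy i (- (N%:Z)); rewrite /level_sign rmorphN /= -[_%:~R]/(N%:R).
  by do 2!case: sgnP => //; lra.
by have := xy i (u i); rewrite /level_sign; do 2!case: sgnP => //; lra.
Qed.

Lemma level_face_in_window x y : level_face y x -> point_in_window x -> point_in_window y.
Proof.
move=> yx wx i; have /andP[x1 x2] := wx i; apply/andP; split.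
  have := yx i (- (N%:Z)); rewrite /level_sign rmorphN /= -[_%:~R]/(N%:R).
  by do 2!case: sgnP => //; try lra; move=> ? ? [].
have := yx i (u i); rewrite /level_sign; do 2!case: sgnP => //; try lra; by move=> ? ? [].
Qed.

Lemma hpt_dir x w a : hpt x + a *: hdir w = hpt (x + a *: w).
Proof. by congr pair; rewrite /= scaler0 addr0. Qed.

Section FlatOfPoint.
Context (x : V) (wx : point_in_window x).
Local Notation S := (flat window fullv (svec window (hpt x))).

Lemma hpt_flat : hpt x \in S.
Proof. by apply: svec_flat; rewrite ?memvf. Qed.

Lemma hdir_flat w : (hdir w \in S) <-> w \in level_dir x.
Proof.
rewrite mem_flat ?size_svec // memvf /= mem_level_dir.
have E : szero (svec window (hdir w)) (svec window (hpt x)) =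
    all (fun h : 'Hom(W, R^o) => (sgn (h (hpt x) : R) == None) ==> (sgn (h (hdir w) : R) == None)) window.
  by rewrite /svec; elim: window => //= h l ->.
rewrite E; split=> [/allP HH i c xc|HH].
  have cN : - (N%:Z) <= c <= N%:Z.
    have /andP[x1 x2] := wx i; have /andP[_ ui] := uN i.
    by apply/andP; split; [rewrite -(ler_int R) rmorphN /= -xc|
      apply: le_trans ui; rewrite -(ler_int R) -xc].
  have := HH _ (mem_cutting i cN).
  by rewrite !sgn_eq0 !hplaneE /= mulr1 mulr0 subr0 xc subrr eqxx /= => /eqP.
have P i c : (level_sign i c x == None) ==> (sgn (hplane i c%:~R (hdir w) : R) == None).
  by apply/implyP; rewrite !sgn_eq0 hplaneE mulr0 subr0 subr_eq0 => /eqP/HH ->.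
rewrite all_cat /= !hcoordE sgn0 eqxx implybT /= all_cat; apply/and3P; split; apply/allP.
- by move=> _ /allpairsP[[i c] /= [_ _ ->]]; rewrite hplane_level_sign.
- move=> _ /mapP[i _ ->]; rewrite !opp_lfunE !sgnN !hplane_level_sign.
  have /implyP P' := P i (u i); apply/implyP => Q; rewrite (eqP (P' _)) //.
  by case: (level_sign _ _ _) Q.
- move=> _ /mapP[i _ ->].
  by rewrite -[N%:R]/(N%:Z%:~R) -rmorphN !hplane_level_sign.
Qed.

Lemma flat_split (w : W) : w \in S -> exists2 d, d \in level_dir x & w = w.2 *: hpt x + hdir d.
Proof.
move=> wS; exists (w.1 - w.2 *: x).
  apply/hdir_flat; rewrite (_ : hdir _ = w - w.2 *: hpt x).
    by rewrite memvB ?memvZ ?hpt_flat.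
  by case: w {wS} => w1 w2; congr pair; rewrite /= -[_ *: _]/(_ * _) mulr1 subrr.
by case: w {wS} => w1 w2; congr pair; rewrite /= ?subrKC // -[_ *: _]/(_ * _) mulr1 addr0.
Qed.

Lemma hdir_sum m (c : 'I_m -> R) (e : 'I_m -> V) :
  hdir (\sum_i c i *: e i) = \sum_i c i *: hdir (e i).
Proof.
elim/big_rec2: _ => [//|i a b _ <-].
by congr pair; rewrite /= scaler0 addr0.
Qed.

Lemma flat_span (e : seq V) : (level_dir x <= <<e>>)%VS -> (S <= <<hpt x :: map hdir e>>)%VS.
Proof.
move=> De; apply/subvP => w /flat_split[d /(subvP De)].
rewrite -{1}(in_tupleE e) => /coord_span -> ->; rewrite memvD //.
  by rewrite memvZ // memv_span ?mem_head.
rewrite hdir_sum memv_suml // => i _; rewrite memvZ // memv_span // inE; apply/orP; right.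
by apply/map_f/mem_nth; rewrite /= ltn_ord.
Qed.

Lemma dim_flat : \dim S = (\dim (level_dir x)).+1.
Proof.
have lin : linear hdir by move=> a d d'; congr pair; rewrite /= scaler0 addr0.
pose hl := GRing.isLinear.Build R V W *:%R hdir lin.
pose hdirl : {linear V -> W} := HB.pack hdir hl.
pose f := linfun hdirl.
have fE d : f d = hdir d by rewrite lfunE.
have -> : S = (f @: level_dir x + <[hpt x]>)%VS.
  apply/eqP; rewrite eqEsubv subv_add -memvE hpt_flat andbT; apply/andP; split.
    apply/subvP => w /flat_split[d dD ->]; rewrite addrC memv_add //.
      by rewrite -fE memv_img.
    by rewrite memvZ // memv_line.
  by apply/subvP => _ /memv_imgP[d dD ->]; rewrite fE; apply/hdir_flat.
rewrite dim_line_add ?limg_dim_eq //.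
  apply/eqP; rewrite -subv0; apply/subvP => d; rewrite memv_cap memv_ker fE memv0.
  by case/andP => _ /eqP/(congr1 fst)/= ->.
apply/negP => /memv_imgP[d _]; rewrite fE => /(congr1 snd)/eqP /=.
by rewrite oner_eq0.
Qed.
End FlatOfPoint.
End Periodic.

(** * Homomorphisms out of a lattice *)

Section Lattice.
Context (U : zmodType) (m : nat) (b : 'I_m -> U) (hb : is_zbasis b).

Definition zcoord x : {ffun 'I_m -> int} := projT1 (cid (hb x)).

Lemma zcoordE x : x = \sum_i b i *~ zcoord x i.
Proof. by rewrite /zcoord; case: cid => c []. Qed.

Lemma zcoord_unique x (c : {ffun 'I_m -> int}) : x = \sum_i b i *~ c i -> zcoord x = c.
Proof. by rewrite /zcoord; case: cid => d [dx dU] /= /dU. Qed.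

Lemma zcoordB x y : zcoord (x - y) = [ffun i => zcoord x i - zcoord y i].
Proof.
apply: zcoord_unique; rewrite {1}(zcoordE x) {1}(zcoordE y) -sumrB.
by apply: eq_bigr => i _; rewrite ffunE mulrzBr.
Qed.

Lemma zcoord_basis j : zcoord (b j) = [ffun i => (j == i)%:Z].
Proof.
apply: zcoord_unique; rewrite (bigD1 j) //= ffunE eqxx mulr1z big1 ?addr0 // => i ij.
by rewrite ffunE eq_sym (negbTE ij) mulr0z.
Qed.

Section Hom.
Context (Y : zmodType).

Definition zhom_fun (y : 'I_m -> Y) (x : U) : Y := \sum_i y i *~ zcoord x i.

Fact zhom_zmod_morphism y : zmod_morphism (zhom_fun y).
Proof.
by move=> a c; rewrite /zhom_fun zcoordB -sumrB; apply: eq_bigr => i _; rewrite ffunE mulrzBr.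
Qed.
HB.instance Definition _ y := GRing.isZmodMorphism.Build U Y (zhom_fun y) (zhom_zmod_morphism y).

Definition zhom (y : 'I_m -> Y) : {additive U -> Y} := zhom_fun y.

Lemma zhomE y i : zhom y (b i) = y i.
Proof.
rewrite /zhom /= /zhom_fun zcoord_basis (bigD1 i) //= ffunE eqxx mulr1z big1 ?addr0 // => j ji.
by rewrite ffunE eq_sym (negbTE ji) mulr0z.
Qed.

Lemma zhom_ext (f g : {additive U -> Y}) : (forall i, f (b i) = g (b i)) -> f = g.
Proof.
move=> fg; apply: additive_ext => x; rewrite (zcoordE x) !raddf_sum.
by apply: eq_bigr => i _; rewrite !raddfMz fg.
Qed.
End Hom.
End Lattice.

Section HomSpace.
Context (R : realType) (Lam : zmodType) (k : nat) (b : 'I_k -> Lam) (hb : is_zbasis b).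

(** The basis is a parameter of the type because it gives the dimension and the coordinates. *)
Definition hom_space of is_zbasis b := {additive Lam -> R}.
Local Notation V := (hom_space hb).
HB.instance Definition _ := GRing.Lmodule.on V.

Definition hom_row (f : V) : 'rV[R]_k := \row_i (f : {additive Lam -> R}) (b i).

Fact hom_space_vect : Vector.axiom k V.
Proof.
exists hom_row.
  by move=> a f g; apply/rowP => i; rewrite !mxE.
exists (fun r : 'rV_k => zhom hb (r 0) : V) => [f|r].
  by apply: (zhom_ext hb) => i; rewrite zhomE mxE.
by apply/rowP => i; rewrite mxE zhomE.
Qed.
HB.instance Definition _ := Lmodule_hasFinDim.Build R V hom_space_vect.
End HomSpace.

(** * Strata, their closures and their faces *)

(** Two of the multiples of [l] coincide in the finite cokernel. *)
Lemma finite_coker_multiple (U V : zmodType) (f : {additive U -> V}) (l : V) :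
  finite_set [set: coker f] -> exists j x, f x = l *+ j.+1.
Proof.
move=> fin; apply: contrapT => no.
have inj : injective (fun j : nat => coker_proj f (l *+ j)).
  have lt i j : (i < j)%N -> coker_proj f (l *+ j) = coker_proj f (l *+ i) -> False.
    move=> ij /coker_projP[x xE]; apply: no; exists (j - i).-1, x.
    by rewrite xE prednK ?subn_gt0 // mulrnBr // ltnW.
  move=> i j ij; apply/eqP; rewrite eqn_leq.
  by case: (ltngtP i j) => // /lt; rewrite ij => /(_ erefl).
have := @finite_preimage _ _ [set: coker f] (fun j : nat => coker_proj f (l *+ j)).
rewrite preimage_setT => /(_ _ fin) finN; apply: infinite_nat; apply: finN.
by move=> i j _ _; apply: inj.
Qed.

Section Strata.
Context (R : realType) (n k : nat) (L Lam : zmodType).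
Context (v : 'I_n -> L) (psi : {additive L -> Lam}).
Context (hv : is_zbasis v) (b : 'I_k -> Lam) (hb : is_zbasis b).
Context (hpsi : finite_set [set: coker psi]).

Local Notation V := (hom_space R hb).
Implicit Types (x y w : V) (i : 'I_n) (A B : set V).

Definition hheight i (f : V) : R^o := height v psi i f.

Fact hheight_linear i : linear (hheight i).
Proof. by []. Qed.
HB.instance Definition _ i := GRing.isLinear.Build R V R^o *:%R (hheight i) (hheight_linear i).

Definition hform i : 'Hom(V, R^o) := linfun (hheight i).

Lemma hformE i x : hform i x = height v psi i x.
Proof. by rewrite lfunE. Qed.

(** Every element of the lattice has a multiple in the image of [psi].  The finiteness of the
    cokernel enters the proof here only. *)
Lemma hom_vanish (Y : zmodType) (f : {additive Lam -> Y}) :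
  (forall (y : Y) j, y *+ j.+1 = 0 -> y = 0) ->
  (forall i, f (psi (v i)) = 0) -> f = 0.
Proof.
move=> tf f0; apply: additive_ext => l.
have [j [x xE]] := finite_coker_multiple l hpsi.
apply: (tf _ j); rewrite -raddfMn -xE.
have E : (f \o psi : {additive L -> Y}) = (\0 : {additive L -> Y}).
  by apply: (zhom_ext hv) => i; exact: f0.
exact: (congr1 (fun g : {additive L -> Y} => g x) E).
Qed.

Lemma hform_sep x : (forall i, hform i x = 0) -> x = 0.
Proof.
move=> x0; apply: hom_vanish => [y j|i]; last by have := x0 i; rewrite hformE.
by move/eqP; rewrite mulrn_eq0 => /eqP.
Qed.

Lemma same_stratumP x y : same_stratum v psi x y <-> same_levels hform x y.
Proof.
split=> [xy i c|xy i].
  have [a ac] := xy i; rewrite /level_sign !hformE; case: ac => [[-> ->] //|[/andP[x1 x2] /andP[y1 y2]]].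
  case: (lerP c a) => ca.
    have ca' : c%:~R <= a%:~R :> R by rewrite ler_int.
    by transitivity (Some true); [|symmetry]; apply/eqP; rewrite sgn_pos; lra.
  have ca' : (a + 1)%:~R <= c%:~R :> R by rewrite ler_int lezD1.
  by transitivity (Some false); [|symmetry]; apply/eqP; rewrite sgn_neg; lra.
exists (Num.floor (height v psi i x)).
have := xy i (Num.floor (height v psi i x)); have := xy i (Num.floor (height v psi i x) + 1).
rewrite /level_sign !hformE; have /andP[f1 f2] := floor_itv (height v psi i x).
set a := Num.floor _ in f1 f2 *.
case: (eqVneq (height v psi i x) a%:~R) => xa.
  move=> _; rewrite xa subrr sgn0 => /esym/eqP; rewrite sgn_eq0 subr_eq0 => /eqP ->.
  by left.
have xa' : a%:~R < height v psi i x by rewrite lt_neqAle eq_sym xa.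
have /eqP -> : sgn (height v psi i x - (a + 1)%:~R) == Some false by rewrite sgn_neg subr_lt0.
have /eqP -> : sgn (height v psi i x - a%:~R) == Some true by rewrite sgn_pos subr_gt0.
move=> /esym/eqP; rewrite sgn_neg subr_lt0 => y2 /esym/eqP; rewrite sgn_pos subr_gt0 => y1.
by right; rewrite xa' f2 y1 y2.
Qed.

Lemma stratumP A x : is_stratum v psi A -> A x -> forall y, A y <-> same_levels hform x y.
Proof.
case=> z -> /same_stratumP zx y.
split=> [/same_stratumP zy i c|xy]; first by rewrite -zx zy.
by apply/same_stratumP => i c; rewrite zx.
Qed.

Lemma stratum_nonempty A : is_stratum v psi A -> exists x, A x.
Proof. by case=> z ->; exists z; apply/same_stratumP. Qed.

Lemma stratum_eq A B x : is_stratum v psi A -> is_stratum v psi B -> A x -> B x -> A = B.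
Proof.
move=> sA sB Ax Bx; apply/seteqP; split=> y /=.
  by move/(stratumP sA Ax) => xy; apply/(stratumP sB Bx).
by move/(stratumP sB Bx) => xy; apply/(stratumP sA Ax).
Qed.

Lemma segment_in_stratum x y (t : R) : level_face hform y x -> 0 < t -> t <= 1 ->
  same_levels hform x ((1 - t) *: y + t *: x).
Proof.
move=> yx t0 t1 i c; rewrite /level_sign linearD !linearZ /= -![_ *: _]/(_ * _).
have -> : (1 - t) * (hform i y : R) + t * (hform i x : R) - c%:~R =
   (1 - t) * ((hform i y : R) - c%:~R) + t * ((hform i x : R) - c%:~R) by ring.
have := yx i c; rewrite /level_sign; move: ((hform i y : R) - c%:~R) ((hform i x : R) - c%:~R) => p q.
have t1' : 0 <= 1 - t by lra.
have [-> _|p0] := eqVneq p 0; first by rewrite mulr0 add0r sgnM.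
case=> [/eqP|]; first by rewrite sgn_eq0 (negbTE p0).
case: (sgnP p) p0 => [->|{}p0 _|{}p0 _] /esym/eqP; rewrite ?eqxx // ?sgn_pos ?sgn_neg => q0.
  transitivity (Some true); [|symmetry]; apply/eqP; rewrite sgn_pos //.
  by rewrite ltr_wpDl ?mulr_gt0 ?mulr_ge0 // ltW.
transitivity (Some false); [|symmetry]; apply/eqP; rewrite sgn_neg // -oppr_gt0 opprD -!mulrN.
by rewrite ltr_wpDl ?mulr_gt0 ?mulr_ge0 ?oppr_ge0 ?oppr_gt0 // ltW.
Qed.

(** If [y] is a face of [x], then the segment from [x] to [y] stays in the stratum of [x] until
    it reaches [y], by [segment_in_stratum].  Conversely, a nonzero sign at [y] persists
    nearby. *)
Lemma closureP A x y : is_stratum v psi A -> A x -> hom_closure A y <-> level_face hform y x.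
Proof.
move=> sA Ax; have AP := stratumP sA Ax; split=> [yA i c|yx s e e0].
  case: (eqVneq (level_sign hform i c y) None) => [|ny]; first by left.
  right; have d0 : 0 < `|(hform i y : R) - c%:~R|.
    by rewrite normr_gt0; move: ny; rewrite /level_sign sgn_eq0.
  have [x' /AP xx'] := yA [:: psi (v i)] _ d0.
  move=> /(_ _ (mem_head _ _)); rewrite (xx' i c) /level_sign !hformE in d0 *.
  rewrite -[x' _]/(height v psi i x') -[_ (psi (v i))]/(height v psi i y).
  move: (height v psi i x') (height v psi i y) => p q.
  case: (sgnP (q - _)) => q0; first by rewrite q0 normr0 normr_lt0.
    by rewrite (gtr0_norm q0) ltr_norml => pq; apply/esym/eqP; rewrite sgn_pos; lra.
  by rewrite (ltr0_norm q0) ltr_norml => pq; apply/esym/eqP; rewrite sgn_neg; lra.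
pose M := 1 + \sum_(l <- s) `|(x : {additive Lam -> R}) l - (y : {additive Lam -> R}) l|.
have M1 : 1 <= M by rewrite lerDl sumr_ge0.
have M0 : 0 < M by apply: lt_le_trans M1.
pose t := Num.min 1 (e / (M + M)).
have t0 : 0 < t by rewrite lt_min ltr01 /= divr_gt0 // addr_gt0.
have t1 : t <= 1 by rewrite ge_min lexx.
exists ((1 - t) *: y + t *: x); first by apply/AP/segment_in_stratum.
move=> l ls; set q := (x : {additive Lam -> R}) l; set p := (y : {additive Lam -> R}) l.
have -> : (((1 - t) *: y + t *: x : V) : {additive Lam -> R}) l - p = t * (q - p).
  transitivity ((1 - t) * p + t * q - p); [by []|ring].
rewrite normrM (gtr0_norm t0).
have lM : `|q - p| <= M.
  rewrite /M (perm_big _ (perm_to_rem ls)) big_cons /= addrCA lerDl addr_ge0 ?sumr_ge0 //.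
apply: le_lt_trans (_ : e / (M + M) * M < e); first by rewrite ler_pM ?(ltW t0) // ge_min lexx orbT.
rewrite mulrAC ltr_pdivrMr; last by rewrite addr_gt0.
by rewrite ltr_pM2l // -subr_gt0 addrK.
Qed.
End Strata.

Section Faces.
Context (R : realType) (n k : nat) (L Lam : zmodType).
Context (v : 'I_n -> L) (psi : {additive L -> Lam}).
Context (b : 'I_k -> Lam) (hb : is_zbasis b).

Local Notation V := (hom_space R hb).
Local Notation H := (hform R v psi hb).
Implicit Types (x y w : V) (i : 'I_n) (A B : set V).

Lemma height_bound (l : seq V) : exists N : nat,
  forall x, x \in l -> forall i, `|H i x : R| <= N%:R.
Proof.
elim: l => [|y l [N HN]]; first by exists 0%N.
pose M := (\max_(i < n) Num.bound (H i y : R))%N.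
exists (maxn N M) => x; rewrite inE => /orP[/eqP -> i|/HN xN i].
  apply: le_trans (_ : M%:R <= _); last by rewrite ler_nat leq_maxr.
  apply: le_trans (ltW (archi_boundP (normr_ge0 _))) _.
  rewrite ler_nat /M; apply: leq_trans (leq_bigmax i); rewrite /Num.bound normr_id //.
by apply: le_trans (xN i) _; rewrite ler_nat leq_maxl.
Qed.

Lemma bound_in_window x (N : nat) : (forall i, `|H i x : R| <= N%:R) -> point_in_window H N (fun=> N%:Z) x.
Proof. by move=> xN i; rewrite -ler_norml. Qed.

Lemma const_bound (N : nat) : forall i : 'I_n, - (N%:Z) <= (fun=> N%:Z) i <= N%:Z.
Proof. by move=> i; lia. Qed.

Lemma stratum_perturb A x w : is_stratum v psi A -> A x -> w \in level_dir H x ->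
  exists2 e : R, 0 < e & A (x + e *: w).
Proof.
move=> sA Ax wx; have [N xN] := height_bound [:: x].
have {}xN := bound_in_window (xN x (mem_head _ _)).
have [e e0 He] := svec_perturb (window H N (fun=> N%:Z)) (hpt x) (hdir w).
exists e => //; have := He e e0 (lexx _); rewrite scomp_szero => [E|]; last first.
  have := hdir_flat (const_bound N) xN w => -[_ /(_ wx)].
  by rewrite mem_flat ?size_svec // => /andP[].
rewrite hpt_dir in E; apply/(stratumP sA Ax).
apply/(window_same (const_bound N) xN); last by [].
by apply/(admissible_hpt H N (fun=> N%:Z)); rewrite E; apply/admissible_hpt.
Qed.

Lemma directionP A x : is_stratum v psi A -> A x ->
  forall w, direction A w <-> w \in level_dir H x.
Proof.
move=> sA Ax w; split=> [[m [c [z [zA ->]]]]|wx].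
  rewrite memv_suml // => j _; rewrite memvZ //.
  have [p [q [/(stratumP sA Ax) xp /(stratumP sA Ax) xq ->]]] := zA j.
  apply/mem_level_dir => i a xa; rewrite linearB /=.
  have E y : same_levels H x y -> H i y = a%:~R.
    move=> /(_ i a); rewrite /level_sign xa subrr sgn0 => /esym/eqP.
    by rewrite sgn_eq0 subr_eq0 => /eqP.
  by rewrite !E // subrr.
have [e e0 Ae] := stratum_perturb sA Ax wx.
exists 1%N, (fun=> e^-1), (fun=> e *: w); split=> [_|].
  by exists x, (x + e *: w); split=> //; rewrite addrAC subrr add0r.
by rewrite big_ord1 scalerA mulVf ?scale1r // gt_eqF.
Qed.

Lemma is_basisP A x m (e : m.-tuple V) : is_stratum v psi A -> A x ->
  is_basis (direction A) e <-> basis_of (level_dir H x) e.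
Proof.
move=> sA Ax; have dP := directionP sA Ax; split=> [[eA euniq]|eb].
  rewrite basisEfree; apply/and3P; split.
  - apply/freeP => c c0 i; have [d [_ dU]] := euniq 0 (proj2 (dP 0) (mem0v _)).
    have := dU [ffun=> 0]; rewrite big1 => [/(_ erefl) d0|j _]; last by rewrite ffunE scale0r.
    have := dU [ffun j => c j]; rewrite -[X in X = _ -> _]c0 => /(_ _)/(congr1 (fun f : {ffun _ -> _} => f i)).
    by rewrite d0 !ffunE => <- //; apply: eq_bigr => j _; rewrite ffunE.
  - apply/span_subvP => w /(nthP 0)[j]; rewrite size_tuple => jm <-.
    by apply/dP; apply: (eA (Ordinal jm)).
  - rewrite size_tuple; have : (level_dir H x <= <<e>>)%VS.
      apply/subvP => w /dP/euniq[c [-> _]]; rewrite memv_suml // => i _.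
      by rewrite memvZ // memv_span // mem_nth // size_tuple.
    by move=> /dimvS/leq_trans; apply; rewrite -{2}(size_tuple e) dim_span.
have fe := basis_free eb; have se := span_basis eb.
split=> [i|w /dP wD].
  by apply/dP/(basis_mem eb); rewrite mem_nth // size_tuple.
exists [ffun i => coord e i w]; split.
  rewrite {1}(coord_basis eb wD); apply: eq_bigr => i _; by rewrite ffunE.
by move=> c ->; apply/ffunP => i; rewrite ffunE coord_sum_free.
Qed.

Lemma has_dimP A x m : is_stratum v psi A -> A x -> has_dim A m <-> \dim (level_dir H x) = m.
Proof.
move=> sA Ax; split=> [[e /(is_basisP _ sA Ax)/vector.size_basis/esym]|dm]; first exact.
have sz : size (vbasis (level_dir H x)) == m by rewrite size_tuple dm.
by exists (Tuple sz); apply/(is_basisP _ sA Ax); apply: vbasisP.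
Qed.

Lemma level_face_trans x y z : level_face H z y -> level_face H y x -> level_face H z x.
Proof.
move=> zy yx i c; case: (zy i c) => [->|->]; [by left|exact: yx].
Qed.

Definition face_form (a : 'I_n -> R) (z : V) : R := \sum_i a i * (H i z : R).

Fact face_form_linear a : scalar (face_form a).
Proof.
move=> t y z; rewrite /face_form mulr_sumr -big_split /=; apply: eq_bigr => i _.
by rewrite linearP /= -[_ *: _]/(_ * _) mulrDr mulrCA.
Qed.
HB.instance Definition _ a := GRing.isLinear.Build R V R *%R (face_form a) (face_form_linear a).

Lemma level_sign_None i c z : level_sign H i c z = None <-> (H i z : R) = c%:~R.
Proof.
rewrite /level_sign; split=> [/eqP|->]; last by rewrite subrr sgn0.
by rewrite sgn_eq0 subr_eq0 => /eqP.
Qed.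

(** The face of [y] is cut out by the sum of those [H i] that are integral at [y] but not at
    [x], each with the sign that makes [y] maximal. *)
Lemma face_closureP A B x y : is_stratum v psi A -> is_stratum v psi B -> A x -> B y ->
  is_face (hom_closure A) (hom_closure B) <-> level_face H y x.
Proof.
move=> sA sB Ax By; split=> [[l [c [lc BE]]]|yx].
  have : hom_closure B y by apply/(closureP _ sB By); apply: level_face_refl.
  by rewrite BE => -[/(closureP _ sA Ax)].
pose a i : R := if integral H y i && ~~ integral H x i then
  if (H i x : R) < (H i y : R) then 1 else -1 else 0.
have term z i : level_face H z x -> a i * (H i z : R) <= a i * (H i y : R).
  move=> zx; rewrite /a; case: ifP => [|_]; last by rewrite !mul0r.
  case/andP => /asboolP[c yc] /asboolP nx.
  have xc : (H i x : R) != c%:~R by apply/eqP => xc; apply: nx; exists c.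
  have := zx i c; rewrite /level_sign yc; case: (ltgtP (H i x : R)) xc => // xc _.
    rewrite !mul1r; have /eqP -> : sgn ((H i x : R) - c%:~R) == Some false by rewrite sgn_neg subr_lt0.
    by case: (sgnP ((H i z : R) - c%:~R)) => zc; [lra|case|lra].
  rewrite !mulN1r lerN2; have /eqP -> : sgn ((H i x : R) - c%:~R) == Some true by rewrite sgn_pos subr_gt0.
  by case: (sgnP ((H i z : R) - c%:~R)) => zc; [lra|lra|case].
exists (face_form a), (face_form a y); split=> [z /(closureP _ sA Ax) zx|].
  by apply: ler_sum => i _; apply: term.
apply/seteqP; split=> z.
  move=> /(closureP _ sB By) zy; have zx := level_face_trans zy yx.
  split=> /=; first by apply/(closureP _ sA Ax).
  apply: eq_bigr => i _; rewrite /a; case: ifP => [|_]; last by rewrite !mul0r.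
  case/andP => /asboolP[c yc] _; rewrite yc.
  have : level_sign H i c z = None by case: (zy i c) => // ->; apply/level_sign_None.
  by move/level_sign_None ->.
case=> /(closureP _ sA Ax) zx /= lz; apply/(closureP _ sB By) => i c.
have az j : a j * (H j z : R) = a j * (H j y : R).
  apply/eqP; have : \sum_j (a j * (H j y : R) - a j * (H j z : R)) == 0.
    by rewrite sumrB -/(face_form a y) -/(face_form a z) lz subrr.
  rewrite psumr_eq0 => [/allP/(_ j)|m _]; last by rewrite subr_ge0 term.
  by rewrite mem_index_enum /= subr_eq0 eq_sym => /(_ isT).
have [->|zc] := zx i c; first by left.
have [yc|yc] := yx i c; last by right; rewrite zc yc.
left; have := az i; rewrite /a.
have -> : integral H y i by apply/asboolP; exists c; apply/level_sign_None.
case: (boolP (integral H x i)) => [/asboolP[c' xc']|nx] /=.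
  have yc' : level_sign H i c' y = None.
    by case: (yx i c') => // ->; apply/level_sign_None.
  move: yc yc' => /level_sign_None yc /level_sign_None; rewrite yc => cc'.
  by rewrite zc => _; apply/level_sign_None; rewrite xc'.
move=> E; apply/level_sign_None; move/level_sign_None: yc => <-.
by apply: mulfI E; case: ifP; rewrite ?oppr_eq0 oner_eq0.
Qed.

Lemma ceil_heightP A x i c : is_stratum v psi A -> A x ->
  (ceil_height v psi i A <= c) = ((H i x : R) <= c%:~R).
Proof.
move=> sA Ax; rewrite /ceil_height; case: xgetP => [y _ Ay|/(_ x)//].
have /(_ i c) := proj1 (stratumP sA Ax y) Ay.
rewrite real_ceil_le_int ?num_real // /level_sign hformE.
have -> : H i y = height v psi i y by rewrite hformE.
by do 2!case: sgnP => //; lra.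
Qed.
End Faces.

(** * Comparison of the orientations *)

Section Incidence.
Context (R : realType) (n k : nat) (L Lam : zmodType).
Context (v : 'I_n -> L) (psi : {additive L -> Lam}).
Context (b : 'I_k -> Lam) (hb : is_zbasis b) (F : comNzRingType).
Context (orn : forall m, strata R v psi m -> m.-tuple {additive Lam -> R} -> bool).
Context (horn : forall m (A : cover_strata R v psi m),
   is_orientation (direction (val A)) (orn (stratum_image A))).

Local Notation V := (hom_space R hb).
Local Notation H := (hform R v psi hb).
Local Notation CS := (cover_strata R v psi).
Implicit Types (x y w : V) (m : nat).

Definition signb (a : bool) : F := if a then 1 else -1.

Lemma signb_sq a : signb a * signb a = 1.
Proof. by case: a; rewrite /signb ?mulrNN mulr1. Qed.

Lemma signb_eq a c : signb a * signb c = if a == c then 1 else -1.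
Proof. by case: a c => [] []; rewrite /signb ?mulrNN ?mulr1 ?mul1r. Qed.

Lemma cover_stratum m (A : CS m) : is_stratum v psi (val A).
Proof. by case: (set_valP A). Qed.

Lemma cover_dim m (A : CS m) : has_dim (val A) m.
Proof. by case: (set_valP A). Qed.

Definition stratum_pt m (A : CS m) : V := projT1 (cid (stratum_nonempty (hb := hb) (cover_stratum A))).

Lemma stratum_ptP m (A : CS m) : val A (stratum_pt A).
Proof. exact: projT2 (cid (stratum_nonempty (hb := hb) (cover_stratum A))). Qed.

Definition stratum_basis m (A : CS m) : m.-tuple V := projT1 (cid (cover_dim A)).

Lemma stratum_basisP m (A : CS m) : is_basis (direction (val A)) (stratum_basis A).
Proof. exact: projT2 (cid (cover_dim A)). Qed.

Lemma dim_level_dir m (A : CS m) x : val A x -> \dim (level_dir H x) = m.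
Proof. by move=> Ax; apply/(has_dimP _ (cover_stratum A) Ax)/cover_dim. Qed.

Lemma is_facetP m (A : CS m.+1) (B : CS m) x y : val A x -> val B y ->
  is_facet A B <-> level_face H y x.
Proof. by move=> Ax By; apply: face_closureP Ax By; apply: cover_stratum. Qed.

Section Window.
Context (N : nat) (u : 'I_n -> int) (uN : forall i, - (N%:Z) <= u i <= N%:Z).

Local Notation J := (window H N u).

Definition in_window m (A : CS m) := point_in_window H N u (stratum_pt A).
Definition window_signs m (A : CS m) := svec J (hpt (stratum_pt A)).
Definition flat_of m (A : CS m) := flat J fullv (window_signs A).

(** The sign that compares the given orientation of [A], extended to the cone over [A] by a
    point of [A] in front, with the determinantal one.  It is computed from one basis, but
    [orn_sign_any] shows that it does not depend on it. *)
Definition orn_sign m (A : CS m) : F :=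
  signr F (odet (flat_of A) (hpt (stratum_pt A) :: map (@hdir R V) (stratum_basis A))) * signb (orn (stratum_image A) (stratum_basis A)).

Lemma in_window_pt m (A : CS m) x : in_window A -> val A x -> point_in_window H N u x.
Proof. by move=> KA Ax; apply: same_levels_in_window KA; apply/(stratumP (cover_stratum A) (stratum_ptP A)). Qed.

Lemma window_signs_pt m (A : CS m) x : in_window A -> val A x -> svec J (hpt x) = window_signs A.
Proof.
move=> KA Ax; apply/(window_same uN (in_window_pt KA Ax) KA).
by apply/(stratumP (cover_stratum A) Ax)/stratum_ptP.
Qed.

Lemma dim_flat_of m (A : CS m) : in_window A -> \dim (flat_of A) = m.+1.
Proof. by move=> KA; rewrite (dim_flat uN KA) (dim_level_dir (stratum_ptP A)). Qed.

Lemma hpt_flat_of m (A : CS m) x : in_window A -> val A x -> hpt x \in flat_of A.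
Proof. by move=> KA Ax; rewrite /flat_of -(window_signs_pt KA Ax); apply: svec_flat; rewrite ?memvf. Qed.

Lemma odet_flat_of_neq0 m (A : CS m) (x : V) (e : m.-tuple V) : in_window A -> hpt x \in flat_of A ->
  is_basis (direction (val A)) e -> odet (flat_of A) (hpt x :: map (@hdir R V) e) != 0.
Proof.
move=> KA xA eA; apply: odet_basis; first by rewrite /= size_map size_tuple dim_flat_of.
have /(is_basisP _ (cover_stratum A) (stratum_ptP A)) eb := eA.
have De : (level_dir H (stratum_pt A) <= <<e>>)%VS by rewrite (span_basis eb) subvv.
have sub := flat_span uN KA De; rewrite -/(window_signs A) -/(flat_of A) in sub.
apply: subv_trans sub _; apply/span_subvP => w; rewrite inE => /orP[/eqP ->|we]; last first.
  by rewrite memv_span // inE we orbT.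
have : hdir (stratum_pt A - x) \in flat_of A.
  rewrite (_ : hdir _ = hpt (stratum_pt A) - hpt x); last by congr pair; rewrite /= subrr.
  by rewrite memvB // hpt_flat_of //; apply: stratum_ptP.
move/(hdir_flat uN KA); rewrite -(span_basis eb) => /(coord_span (X := e)) dE.
rewrite (_ : hpt (stratum_pt A) = hpt x + hdir (stratum_pt A - x)); last first.
  by congr pair; rewrite /= ?addr0 // addrC subrK.
apply: memvD; first by rewrite memv_span // mem_head.
rewrite dE hdir_sum memv_suml // => i _.
rewrite memvZ // memv_span // inE map_f ?orbT // mem_nth // size_tuple //.
Qed.

(** Another point of the affine span changes the first vector by a combination of the others, and
    another basis multiplies both signs by that of the same determinant. *)
Lemma orn_sign_any m (A : CS m) (x : V) (e : m.-tuple V) : in_window A -> hpt x \in flat_of A ->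
  is_basis (direction (val A)) e ->
  orn_sign A = signr F (odet (flat_of A) (hpt x :: map (@hdir R V) e)) * signb (orn (stratum_image A) e).
Proof.
move=> KA xA eA; rewrite /orn_sign; set e0 := stratum_basis A; set x0 := stratum_pt A.
have e0A : is_basis (direction (val A)) e0 := stratum_basisP A.
have x0A : hpt x0 \in flat_of A := hpt_flat_of KA (stratum_ptP A).
have eb := proj1 (is_basisP _ (cover_stratum A) (stratum_ptP A)) eA.
have e0b := proj1 (is_basisP _ (cover_stratum A) (stratum_ptP A)) e0A.
have dm := dim_flat_of KA.
have sz (f : m.-tuple V) (i : nat) : (i < m)%N -> (map (@hdir R V) f)`_i = hdir f`_i.
  by move=> im; rewrite (nth_map 0) // size_tuple.
pose cf (w : V) (i : nat) : R := if insub i is Some j then coord e0 j w else 0.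
have cfE (w : V) : w \in level_dir H x0 -> w = \sum_(i < m) cf w i *: e0`_i.
  rewrite -(span_basis e0b) => /(coord_span (X := e0)) {1}->.
  by apply: eq_bigr => i _; rewrite /cf valK.
have -> : odet (flat_of A) (hpt x0 :: map (@hdir R V) e0) = odet (flat_of A) (hpt x :: map (@hdir R V) e0).
  have xx0 : x0 - x \in level_dir H x0.
    apply/(hdir_flat uN KA); rewrite (_ : hdir _ = hpt x0 - hpt x).
      by rewrite memvB.
    by congr pair; rewrite /= subrr.
  rewrite -[RHS]mul1r -(odet_addl _ _ _ (cf (x0 - x))) dm //= scale1r; congr (odet _ (_ :: _)).
  rewrite (eq_bigr (fun i : 'I_m => cf (x0 - x) i *: hdir e0`_i)) => [|i _]; last by congr (_ *: _); apply: sz.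
  rewrite -hdir_sum -cfE //; congr pair; rewrite /= ?addr0 //.
  by rewrite addrC subrK.
pose P : 'M[R]_m := \matrix_(i, j) cf e`_j i.
have eP (j : 'I_m) : e`_j = \sum_i P i j *: e0`_i.
  have eD : e`_j \in level_dir H x0 by apply: (basis_mem eb); rewrite mem_nth // size_tuple.
  by rewrite {1}(cfE _ eD); apply: eq_bigr => i _; rewrite mxE.
have dE : odet (flat_of A) (hpt x :: map (@hdir R V) e) = \det P * odet (flat_of A) (hpt x :: map (@hdir R V) e0).
  rewrite (@odet_change _ _ _ (hpt x :: map (@hdir R V) e0) (hpt x :: map (@hdir R V) e) (fun i j =>
    if (j == 0)%N || (i == 0)%N then (i == j)%:R else cf e`_(j.-1) i.-1)); last first.
    move=> [|j]; rewrite dm big_ord_recl /=.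
      by move=> _; rewrite scale1r big1 ?addr0 // => i _; rewrite scale0r.
    move=> jm; rewrite scale0r add0r; pose jo := Ordinal (jm : (j < m)%N).
    transitivity (hdir (\sum_i P i jo *: e0`_i)); first by rewrite -eP; exact: (sz e).
    rewrite hdir_sum; apply: eq_bigr => i _; rewrite mxE /= !add0n; congr (_ *: _).
    exact: (esym (sz e0 i (ltn_ord i))).
  congr (_ * _); rewrite dm (@det_head R m (fun i j => cf e`_j i)) -det_tr; congr (\det _).
  by apply/matrixP => i j; rewrite !mxE.
have n1 := odet_flat_of_neq0 KA xA eA; have n0 := odet_flat_of_neq0 KA xA e0A.
have nP : \det P != 0 by apply: contraNneq n1 => dP; rewrite dE dP mul0r.
have sD : signb (orn (stratum_image A) e) * signb (orn (stratum_image A) e0) = signr F (\det P).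
  by rewrite signb_eq (horn e0A eA eP).
rewrite dE signrM // -sD; set s := signb (orn _ e); set s0 := signb _.
transitivity (signr F (odet (flat_of A) (hpt x :: map (@hdir R V) e0)) * s0 * (s * s)); last by ring.
by rewrite signb_sq mulr1.
Qed.

Section Pair.
Context (m : nat) (A : CS m.+1) (B : CS m) (KA : in_window A) (AB : is_facet A B).
Implicit Types (e : m.-tuple V).

Lemma facet_in_window : in_window B.
Proof. by apply: level_face_in_window KA; apply/(is_facetP (stratum_ptP A) (stratum_ptP B)). Qed.

Lemma window_facet : facet J fullv (window_signs A) (window_signs B).
Proof.
have KB := facet_in_window; apply/facetP; split.
- by exists (hpt (stratum_pt A)); rewrite memvf.
- by exists (hpt (stratum_pt B)); rewrite memvf.
- by apply/(window_face uN KA KB)/(is_facetP (stratum_ptP A) (stratum_ptP B)).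
- by rewrite -/(flat_of A) -/(flat_of B) !dim_flat_of.
Qed.

Lemma flat_of_sub : (flat_of B <= flat_of A)%VS.
Proof. by apply: flat_face; case/facetP: window_facet. Qed.

Lemma facet_basis x y e : val A x -> val B y -> is_basis (direction (val B)) e ->
  is_basis (direction (val A)) [tuple of y - x :: e].
Proof.
move=> Ax By eB; have KB := facet_in_window.
have yB := hpt_flat_of KB By; have xA := hpt_flat_of KA Ax; have yA := subvP flat_of_sub _ yB.
have /(is_basisP _ (cover_stratum B) By) eb := eB.
have dE : hdir (y - x) = hpt y - hpt x by congr pair; rewrite /= subrr.
have dirA (d : V) : (d \in level_dir H x) <-> hdir d \in flat_of A.
  by rewrite /flat_of -(window_signs_pt KA Ax); symmetry; apply: (hdir_flat uN (in_window_pt KA Ax)).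
have dirB (d : V) : (d \in level_dir H y) <-> hdir d \in flat_of B.
  by rewrite /flat_of -(window_signs_pt KB By); symmetry; apply: (hdir_flat uN (in_window_pt KB By)).
have yx : y - x \in level_dir H x by apply/dirA; rewrite dE memvB.
have nyx : y - x \notin level_dir H y.
  apply/negP => /dirB; rewrite dE => d; have := facet_notin window_facet (memvf (hpt x)) (window_signs_pt KA Ax).
  by rewrite -/(flat_of B) -[hpt x](subKr (hpt y)) memvB.
apply/(is_basisP _ (cover_stratum A) Ax); rewrite basisEfree; apply/and3P; split.
- by rewrite free_cons (basis_free eb) (span_basis eb) nyx.
- apply/span_subvP => d; rewrite inE => /orP[/eqP -> //|de].
  by apply/dirA/(subvP flat_of_sub)/dirB; exact: (basis_mem eb de).
- by rewrite size_tuple (dim_level_dir Ax).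
Qed.

Lemma incidence_orn x y e : val A x -> val B y -> is_basis (direction (val B)) e ->
  signb (orn (stratum_image A) [tuple of y - x :: e]) * signb (orn (stratum_image B) e) =
  orn_sign A * orn_sign B * incidence (@orient R _ F) J fullv (window_signs A) (window_signs B).
Proof.
move=> Ax By eB; have KB := facet_in_window; have eA := facet_basis Ax By eB.
have yB := hpt_flat_of KB By; have xA := hpt_flat_of KA Ax; have yA := subvP flat_of_sub _ yB.
have dA := dim_flat_of KA; have dB := dim_flat_of KB.
rewrite (orn_sign_any KA yA eA) (orn_sign_any KB yB eB).
rewrite (incidence_pt (orientP _ F) window_facet (memvf (hpt x)) (window_signs_pt KA Ax)) -/(flat_of A) -/(flat_of B).
have tailB i : (hpt y :: map (@hdir R V) e)`_i \in flat_of B.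
  case: i => [//|i] /=; case: (ltnP i m) => im; last by rewrite nth_default ?mem0v // size_map size_tuple.
  rewrite (nth_map 0) ?size_tuple // /flat_of -(window_signs_pt KB By); apply/(hdir_flat uN (in_window_pt KB By)).
  have /(is_basisP _ (cover_stratum B) By) eb := eB.
  by apply: (basis_mem eb); rewrite mem_nth // size_tuple.
have detE : odet (flat_of A) (hpt y :: map (@hdir R V) [tuple of y - x :: e]) =
    odet (flat_of B) (hpt y :: map (@hdir R V) e) * odet (flat_of A) (hpt x :: vbasis (flat_of B)).
  rewrite /= (_ : hdir (y - x) = hpt y - hpt x); last by congr pair; rewrite /= subrr.
  by rewrite odet_step ?dA // -odet_cons ?dA ?dB.
have := odet_flat_of_neq0 KA yA eA; rewrite /orient detE.
rewrite mulf_eq0 negb_or => /andP[n1 n2]; rewrite signrM //.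
set p := signr F (odet (flat_of B) (_ :: _)); set q := signr F (odet (flat_of A) _).
transitivity (signb (orn (stratum_image A) [tuple of y - x :: e]) * signb (orn (stratum_image B) e)
  * (p * p) * (q * q)); first by rewrite !signr_sq !mulr1.
ring.
Qed.

(** The outward vector [y - x] of a facet becomes the point [hpt x] of the cell in the
    homogenisation ([odet_step]), and the determinant of a basis adapted to the facet is a
    product ([odet_cons]). *)
Lemma compatible_incidence : (if `[< compatible orn A B >] then 1 else -1 : F) =
  orn_sign A * orn_sign B * incidence (@orient R _ F) J fullv (window_signs A) (window_signs B).
Proof.
case: asboolP => [[e [x [y [eB Ax By /eqP oe]]]]|nc].
  by rewrite -(incidence_orn Ax By eB) signb_eq oe.
rewrite -(incidence_orn (stratum_ptP A) (stratum_ptP B) (stratum_basisP B)) signb_eq; case: eqP => // oe.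
by case: nc; exists (stratum_basis B), (stratum_pt A), (stratum_pt B); split=> //; [exact: stratum_basisP|exact: stratum_ptP|exact: stratum_ptP].
Qed.
End Pair.
End Window.
End Incidence.

(** * The cellular complex of a dominated region *)

Lemma sum_support (F : nmodType) (T : eqType) (l l' : seq T) (f : T -> F) :
  uniq l -> uniq l' -> (forall x, f x != 0 -> x \in l) -> (forall x, f x != 0 -> x \in l') ->
  \sum_(x <- l) f x = \sum_(x <- l') f x.
Proof.
move=> ul ul' fl fl'.
have E (s : seq T) : \sum_(x <- s) f x = \sum_(x <- [seq x <- s | f x != 0]) f x.
  rewrite big_filter (bigID (fun x => f x != 0)) /= addrC big1 ?add0r // => x.
  by rewrite negbK => /eqP.
rewrite E [RHS]E; apply/perm_big/uniq_perm; rewrite ?filter_uniq // => x.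
rewrite !mem_filter; case: (boolP (f x != 0)) => //= fx.
by rewrite fl // fl'.
Qed.

Section Cover.
Context (R : realType) (n k : nat) (L Lam : zmodType).
Context (v : 'I_n -> L) (psi : {additive L -> Lam}).
Context (hv : is_zbasis v) (hpsi : finite_set [set: coker psi]).
Context (b : 'I_k -> Lam) (hb : is_zbasis b) (F : comNzRingType).
Context (orn : forall m, strata R v psi m -> m.-tuple {additive Lam -> R} -> bool).
Context (horn : forall m (A : cover_strata R v psi m),
   is_orientation (direction (val A)) (orn (stratum_image A))).

Local Notation V := (hom_space R hb).
Local Notation H := (hform R v psi hb).
Local Notation CS := (cover_strata R v psi).
Local Notation stratum_pt := (stratum_pt hb).
Implicit Types (x y w : V) (m : nat).

Definition face_sign m (A : CS m.+1) (B : CS m) : F :=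
  if `[< is_facet A B >] then if `[< compatible orn A B >] then 1 else -1 else 0.

(** An orientation of a point is a sign, which enters the augmentation. *)
Definition vertex_sign (B : CS 0) : F := if orn (stratum_image B) [tuple] then 1 else -1.

(** By [dominatedP] the stratum is contained in the polyhedron [H i <= u i]. *)
Definition dominated (u : 'I_n -> int) m (A : CS m) := forall i, ceil_height v psi i (val A) <= u i.

Lemma dominatedP (u : 'I_n -> int) m (A : CS m) x : val A x ->
  dominated u A <-> forall i, (H i x : R) <= (u i)%:~R.
Proof.
by move=> Ax; split=> uA i; have := uA i; rewrite (ceil_heightP i _ (cover_stratum A) Ax).
Qed.

Lemma dominated_facet (u : 'I_n -> int) m (A : CS m.+1) (B : CS m) :
  is_facet A B -> dominated u A -> dominated u B.
Proof.
move=> /(is_facetP (hb := hb) (stratum_ptP hb A) (stratum_ptP hb B)) AB /(dominatedP u (stratum_ptP hb A)) uA.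
apply/(dominatedP u (stratum_ptP hb B)) => i; have := AB i (u i); have := uA i; rewrite /level_sign.
by do 2!case: sgnP => //; try lra; move=> ? ? ? [].
Qed.

Section Window.
Context (N : nat) (u : 'I_n -> int) (uN : forall i, - (N%:Z) <= u i <= N%:Z).

Local Notation J := (window H N u).
Local Notation in_window := (in_window hb N u).
Local Notation window_signs := (window_signs hb N u).
Local Notation orn_sign := (orn_sign hb F orn N u).
Local Notation Kc := (window_constraints H N u).
Local Notation winc := (incidence (@orient R _ F) J fullv).

(** The apex of the cone over the window.  Its incidence with the cones over the vertices is
    the augmentation ([orn_sign_apex]). *)
Definition apex_cell : seq sign := svec J 0.

Lemma apex_realizable : realizable J fullv apex_cell.
Proof. by exists 0; rewrite memvf. Qed.

Lemma apex_face s : realizable J fullv s -> sface apex_cell s.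
Proof.
move=> /realizable_size; rewrite /apex_cell svec0; elim: (size J) s => [|j IH] [|a s] //= [] /IH.
by [].
Qed.

Lemma apex_flat : flat J fullv apex_cell = 0%VS.
Proof.
apply/eqP; rewrite -subv0; apply/subvP => w; rewrite mem_flat ?size_svec // memv0.
case/andP => _ zw; apply/eqP/(bounded_window (hform_sep hv hpsi) (N := N) (u := u)).
  apply: admissible_face (_ : sface (svec J w) apex_cell) _.
    have -> : svec J w = apex_cell.
      apply/esym/(sface_szero_eq _ zw); apply: apex_face.
      by exists w; rewrite memvf.
    exact: sface_refl.
  by apply/admissible_window; rewrite /= mulr0 lexx; split=> // i; rewrite linear0 !mulr0 lexx.
have hJ : hcoord V \in J by rewrite mem_cat mem_head orbT.
move: zw; rewrite /apex_cell svec0 => zw.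
have : nth None (svec J w) (index (hcoord V) J) = None.
  have /szeroP := zw; rewrite size_svec size_nseq => /(_ erefl); apply.
  by rewrite nth_nseq if_same.
rewrite nth_svec ?index_mem // nth_index // => /eqP; rewrite sgn_eq0 hcoordE.
by move/eqP.
Qed.

Lemma window_signs_cell m (A : CS m) : in_window A -> cone_cell J fullv Kc (window_signs A).
Proof.
move=> KA; rewrite /cone_cell; apply/andP; split; last exact/admissible_hpt.
by apply/asboolP; exists (hpt (stratum_pt A)); rewrite memvf.
Qed.

(** A nonzero point of the cone has a positive last coordinate, and scales to a point of the
    window. *)
Lemma cell_cases s : cone_cell J fullv Kc s ->
  s = apex_cell \/ exists m (A : CS m), in_window A /\ window_signs A = s.
Proof.
case/andP => /asboolP[w [_ <-]] ks; have [w20 kw] := proj1 (admissible_window _ _ _ _) ks.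
have [w2|w2] := eqVneq (w.2 : R) 0.
  by left; rewrite (bounded_window (hform_sep hv hpsi) ks).
have {w20}w20 : 0 < (w.2 : R) by rewrite lt_def w2.
right; pose x := (w.2 : R)^-1 *: w.1.
have xE : hpt x = (w.2 : R)^-1 *: w.
  rewrite [RHS]surjective_pairing; congr pair; rewrite /= -[_ *: _]/(_ * _) mulVf //.
have sE : svec J (hpt x) = svec J w by rewrite xE svecZ // invr_gt0.
have xin : point_in_window H N u x by apply/admissible_hpt; rewrite sE.
pose A0 : set V := same_stratum v psi x.
have sA0 : is_stratum v psi A0 by exists x.
have A0x : A0 x by apply/same_stratumP.
have dA0 : has_dim A0 (\dim (level_dir H x)) by apply/(has_dimP _ sA0 A0x).
have mA : cover_strata R v psi (\dim (level_dir H x)) A0 by split.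
pose A : CS (\dim (level_dir H x)) := SigSub (mem_set mA).
have KA : in_window A by apply: same_levels_in_window xin; apply/(stratumP sA0 A0x)/(stratum_ptP hb A).
by exists (\dim (level_dir H x)), A; split=> //; rewrite -sE -(window_signs_pt uN KA A0x).
Qed.

Lemma window_signs_inj m (A B : CS m) : in_window A -> in_window B -> window_signs A = window_signs B -> A = B.
Proof.
move=> KA KB /(window_same uN KA KB) AB; apply/val_inj.
apply: (stratum_eq (hb := hb) (x := stratum_pt B)); [exact: cover_stratum|exact: cover_stratum| |exact: stratum_ptP].
by apply/(stratumP (cover_stratum A) (stratum_ptP hb A)).
Qed.

Definition cell_stratum m (s : seq sign) : option (CS m) :=
  if pselect (exists A : CS m, in_window A /\ window_signs A = s) is left e then Some (projT1 (cid e)) else None.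

Definition window_strata m : seq (CS m) := undup (pmap (@cell_stratum m) (sign_vectors (size J))).

Lemma mem_window_strata m (A : CS m) : (A \in window_strata m) <-> in_window A.
Proof.
rewrite mem_undup mem_pmap; split=> [/mapP[s _]|KA].
  rewrite /cell_stratum; case: pselect => // e [->].
  by case: (projT2 (cid e)).
apply/mapP; exists (window_signs A); first by rewrite mem_sign_vectors size_svec.
rewrite /cell_stratum; case: pselect => [e|[]]; last by exists A.
by case: (projT2 (cid e)) => KB /esym/(window_signs_inj KA KB) {1}->.
Qed.

Lemma window_strata_uniq m : uniq (window_strata m). Proof. exact: undup_uniq. Qed.

Lemma window_sum m (G : seq sign -> F) :
  (forall s, G s != 0 -> exists A : CS m, in_window A /\ window_signs A = s) ->
  \sum_(s <- sign_vectors (size J)) G s = \sum_(A <- window_strata m) G (window_signs A).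
Proof.
move=> Gs; rewrite -(big_map (fun A : CS m => window_signs A) predT G).
apply: sum_support; rewrite ?sign_vectors_uniq //.
- rewrite map_inj_in_uniq ?window_strata_uniq // => A B /mem_window_strata KA /mem_window_strata KB.
  exact: window_signs_inj.
- by move=> s /Gs[A [_ <-]]; rewrite mem_sign_vectors size_svec.
- by move=> s /Gs[A [KA <-]]; apply/map_f/mem_window_strata.
Qed.

Lemma face_sign_in_window m (A : CS m.+1) (B : CS m) : in_window A -> face_sign A B != 0 -> in_window B.
Proof. by move=> KA; rewrite /face_sign; case: asboolP => [/(facet_in_window KA)|]; rewrite ?eqxx. Qed.

Lemma face_sign_incidence m (A : CS m.+1) (B : CS m) : in_window A -> in_window B ->
  face_sign A B = orn_sign A * orn_sign B * winc (window_signs A) (window_signs B).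
Proof.
move=> KA KB; rewrite /face_sign; case: asboolP => AB; first exact: (compatible_incidence F horn uN KA AB).
rewrite incidence_nfacet ?mulr0 //; apply/negP => /facetP[_ _ /(window_face uN KA KB) f _].
by apply/AB/(is_facetP (stratum_ptP hb A) (stratum_ptP hb B)).
Qed.

Lemma orn_sign_sq m (A : CS m) : orn_sign A * orn_sign A = 1.
Proof. by rewrite /orn_sign mulrACA signr_sq signb_sq mulr1. Qed.

Lemma facet_apex (B : CS 0) : in_window B -> facet J fullv (window_signs B) apex_cell.
Proof.
move=> KB; have rB : realizable J fullv (window_signs B) by case/andP: (window_signs_cell KB) => /asboolP.
apply/facetP; split=> //; [exact: apex_realizable|exact: apex_face|].
by rewrite apex_flat dimv0; apply: dim_flat_of.
Qed.

Lemma orn_sign_apex (B : CS 0) : in_window B -> orn_sign B * winc (window_signs B) apex_cell = vertex_sign B.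
Proof.
move=> KB; rewrite (incidence_pt (orientP _ F) (facet_apex KB) (memvf _) erefl).
rewrite /orient apex_flat /orn_sign -/(flat_of hb N u B).
have vb0 : vbasis (0%VS : {vspace (V * R^o)%type}) = [::] :> seq _.
  by apply: size0nil; rewrite size_tuple dimv0.
by rewrite vb0 (tuple0 (stratum_basis hb B)) /= mulrAC signr_sq mul1r.
Qed.

Lemma facet_cell_dim m (A : CS m) s : in_window A -> facet J fullv s (window_signs A) -> cone_cell J fullv Kc s ->
  exists B : CS m.+1, in_window B /\ window_signs B = s.
Proof.
move=> KA sA /cell_cases[sz|[m' [B [KB Bs]]]].
  have /facetP[_ _ /flat_face f d] := sA; move: d.
  by rewrite sz apex_flat dimv0.
have /facetP[_ _ _] := sA; rewrite -Bs -/(flat_of hb N u A) -/(flat_of hb N u B) !dim_flat_of // => -[mm].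
by move: B KB Bs; rewrite mm => B KB Bs; exists B.
Qed.

Lemma cell_facet_dim m (A : CS m.+1) s : in_window A -> facet J fullv (window_signs A) s ->
  exists B : CS m, in_window B /\ window_signs B = s.
Proof.
move=> KA As; have /facetP[_ rs ts d] := As.
have : cone_cell J fullv Kc s.
  rewrite /cone_cell asboolT //=; case/andP: (window_signs_cell KA) => _; exact: admissible_face.
case/cell_cases => [sz|[m' [B [KB Bs]]]].
  by move: d; rewrite sz apex_flat dimv0 -/(flat_of hb N u A) dim_flat_of.
move: d; rewrite -Bs -/(flat_of hb N u A) -/(flat_of hb N u B) !dim_flat_of // => -[mm].
by move: B KB Bs; rewrite -mm => B KB Bs; exists B.
Qed.

(** The last hypothesis ranges over all cells [s], including the apex when [m] is 0: it makes
    [f] a cycle of the cone, and so of the augmented complex of the window. *)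
Lemma window_exact m (f : CS m -> F) (l : seq (CS m)) : uniq l ->
  (forall A, f A != 0 -> A \in l /\ in_window A) ->
  (forall s, \sum_(A <- l) f A * orn_sign A * winc (window_signs A) s = 0) ->
  exists f' : CS m.+1 -> F, (forall A, f' A != 0 -> in_window A) /\
    forall A, \sum_(A' <- window_strata m.+1) f' A' * face_sign A' A = f A.
Proof.
move=> ul fl cyc.
have [A0|no] := pselect (exists A, f A != 0); last first.
  exists (fun=> 0); split=> [A|A]; first by rewrite eqxx.
  rewrite big1 => [|A' _]; last by rewrite mul0r.
  by apply/esym/eqP; apply: contrapT => /negP nz; apply: no; exists A.
have pointK : nonlinear_cone J fullv Kc.
  case: A0 => A /fl[_ KA]; exists (hpt (stratum_pt A)); split; rewrite ?memvf //.
    exact/admissible_hpt.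
  by apply/negP => /admissible_window[]; rewrite /= oppr_ge0 leNgt ltr01.
pose c s := \sum_(A <- l) (if window_signs A == s then f A * orn_sign A else 0).
have cA A : in_window A -> c (window_signs A) = f A * orn_sign A.
  move=> KA; rewrite /c; have [Al|nAl] := boolP (A \in l).
    rewrite (bigD1_seq A) //= eqxx big1 ?addr0 // => B BA; case: eqP => // BAs.
    have [->|/fl[_ KB]] := eqVneq (f B) 0; first by rewrite mul0r.
    by rewrite (window_signs_inj KB KA BAs) eqxx in BA.
  have -> : f A = 0 by apply/eqP; apply: contraNT nAl => /fl[].
  rewrite mul0r big_seq big1 // => B Bl; case: eqP => // BAs.
  have [->|/fl[_ KB]] := eqVneq (f B) 0; first by rewrite mul0r.
  by rewrite -(window_signs_inj KB KA BAs) Bl in nAl.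
have cs : supported J fullv Kc c.
  move=> s ns; rewrite /c big1 // => A _; case: eqP => // As.
  have [->|/fl[_ KA]] := eqVneq (f A) 0; first by rewrite mul0r.
  by rewrite -As window_signs_cell in ns.
have dc t : boundary (@orient R _ F) J fullv c t = 0.
  rewrite -[RHS](cyc t) /boundary; under eq_bigr do rewrite /c mulr_suml.
  rewrite exchange_big /=; apply: eq_bigr => A _.
  rewrite (bigD1_seq (window_signs A)) ?sign_vectors_uniq ?mem_sign_vectors ?size_svec //= eqxx.
  by rewrite big1 ?addr0 // => s; rewrite eq_sym => /negbTE ->; rewrite mul0r.
have [|g gs dg] := exact_nonlinear_cone (orientP _ F) _ pointK cs dc.
  by rewrite size_nseq /window size_cat.
exists (fun A => if `[< in_window A >] then g (window_signs A) * orn_sign A else 0); split=> [A|A].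
  by case: asboolP; rewrite ?eqxx.
have [KA|nKA] := pselect (in_window A); last first.
  have -> : f A = 0 by apply/eqP; apply: contrapT => /negP/fl[_].
  rewrite big_seq big1 // => A' /mem_window_strata KA'; rewrite asboolT //.
  have [->|/(face_sign_in_window KA')//] := eqVneq (face_sign A' A) 0; by rewrite mulr0.
transitivity (orn_sign A * \sum_(A' <- window_strata m.+1) g (window_signs A') * winc (window_signs A') (window_signs A)).
  rewrite mulr_sumr; apply: eq_big_seq => A' /mem_window_strata KA'; rewrite asboolT // face_sign_incidence //.
  transitivity (orn_sign A' * orn_sign A' * (orn_sign A * (g (window_signs A') * winc (window_signs A') (window_signs A)))); first by ring.
  by rewrite orn_sign_sq mul1r.
rewrite -(window_sum (G := fun s => g s * winc s (window_signs A))); last first.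
  move=> s gnz; apply: (facet_cell_dim KA).
    by apply: contraNT gnz => ns; rewrite incidence_nfacet ?mulr0.
  by apply: contraNT gnz => ns; rewrite gs ?mul0r.
rewrite -/(boundary _ J fullv g (window_signs A)) dg cA // mulrC -mulrA orn_sign_sq mulr1 //.
Qed.

Lemma window_dd m (A : CS m.+2) (C : CS m) : in_window A -> in_window C ->
  \sum_(B <- window_strata m.+1) face_sign A B * face_sign B C = 0.
Proof.
move=> KA KC.
transitivity (orn_sign A * orn_sign C * \sum_(B <- window_strata m.+1) winc (window_signs A) (window_signs B) * winc (window_signs B) (window_signs C)).
  rewrite mulr_sumr; apply: eq_big_seq => B /mem_window_strata KB; rewrite !face_sign_incidence //.
  transitivity (orn_sign B * orn_sign B * (orn_sign A * orn_sign C * (winc (window_signs A) (window_signs B) * winc (window_signs B) (window_signs C)))).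
    by ring.
  by rewrite orn_sign_sq mul1r.
rewrite -(window_sum (G := fun s => winc (window_signs A) s * winc s (window_signs C))).
  by rewrite (diamond (orientP _ F)) mulr0.
move=> s snz; apply: (cell_facet_dim KA).
by apply: contraNT snz => ns; rewrite incidence_nfacet ?mul0r.
Qed.

Lemma window_augmentation (A : CS 1) : in_window A -> \sum_(B <- window_strata 0) face_sign A B * vertex_sign B = 0.
Proof.
move=> KA.
transitivity (orn_sign A * \sum_(B <- window_strata 0) winc (window_signs A) (window_signs B) * winc (window_signs B) apex_cell).
  rewrite mulr_sumr; apply: eq_big_seq => B /mem_window_strata KB; rewrite face_sign_incidence // -orn_sign_apex //.
  transitivity (orn_sign B * orn_sign B * (orn_sign A * (winc (window_signs A) (window_signs B) * winc (window_signs B) apex_cell))).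
    by ring.
  by rewrite orn_sign_sq mul1r.
rewrite -(window_sum (G := fun s => winc (window_signs A) s * winc s apex_cell)).
  by rewrite (diamond (orientP _ F)) mulr0.
move=> s snz; apply: (cell_facet_dim KA).
by apply: contraNT snz => ns; rewrite incidence_nfacet ?mul0r.
Qed.

(** The apex is a cycle of the cone over the window, hence a boundary; so there is an edge of
    the cone, which is the cone over a vertex. *)
Lemma window_vertex x : point_in_window H N u x -> exists B : CS 0, in_window B.
Proof.
move=> Kx.
have pointK : nonlinear_cone J fullv Kc.
  exists (hpt x); split; rewrite ?memvf //; first exact/admissible_hpt.
  by apply/negP => /admissible_window[]; rewrite /= oppr_ge0 leNgt ltr01.
have zK : cone_cell J fullv Kc apex_cell.
  rewrite /cone_cell asboolT; last exact: apex_realizable.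
  by apply/admissible_window; rewrite /= lexx; split=> // i; rewrite linear0 !mulr0 lexx.
pose c s : F := if s == apex_cell then 1 else 0.
have [|||g gs dg] := @exact_nonlinear_cone _ _ _ _ (orientP _ F) J fullv _ _ _ pointK c.
- by rewrite size_nseq /window size_cat.
- by move=> s; rewrite /c; case: eqP => // -> /negP.
- move=> t; rewrite /boundary big1 // => s _; rewrite /c; case: eqP => [->|]; last by rewrite mul0r.
  rewrite incidence_nfacet ?mulr0 //; apply/facetP => -[_ _ _].
  by rewrite apex_flat dimv0.
have [s sz] : exists s, g s * winc s apex_cell != 0.
  apply: contrapT => no; have := dg apex_cell; rewrite /c eqxx /boundary big1.
    by move/esym/eqP; rewrite oner_eq0.
  by move=> s _; apply/eqP; apply: contrapT => /negP nz; apply: no; exists s.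
have Ks : cone_cell J fullv Kc s by apply: contraNT sz => ns; rewrite gs ?mul0r.
have fs : facet J fullv s apex_cell by apply: contraNT sz => ns; rewrite incidence_nfacet ?mulr0.
have [sz0|[m [B [KB Bs]]]] := cell_cases Ks.
  by have := facet_neq fs; rewrite sz0 eqxx.
have /facetP[_ _ _] := fs; rewrite -Bs -/(flat_of hb N u B) dim_flat_of // apex_flat dimv0 => -[mm].
by move: B KB Bs; rewrite mm => B KB _; exists B.
Qed.
End Window.

Lemma window_for (u : 'I_n -> int) (l : seq V) : exists N : nat,
  (forall i, - (N%:Z) <= u i <= N%:Z) /\
  forall x, x \in l -> (forall i, (H i x : R) <= (u i)%:~R) -> point_in_window H N u x.
Proof.
have [N1 HN] := @height_bound R n k L Lam v psi b hb l.
pose N2 := (\max_(i < n) absz (u i))%N.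
have uN2 i : (absz (u i) <= N2)%N by apply: (leq_bigmax i).
exists (maxn N1 N2); split=> [i|x xl xu i]; first by have := uN2 i; lia.
rewrite xu andbT; have := HN x xl i; rewrite ler_norml => /andP[h _]; apply: le_trans h.
by rewrite lerN2 ler_nat leq_maxl.
Qed.

Lemma window_single m (A : CS m) : exists N (u : 'I_n -> int),
  (forall i, - (N%:Z) <= u i <= N%:Z) /\ in_window hb N u A.
Proof.
have [N HN] := @height_bound R n k L Lam v psi b hb [:: stratum_pt A].
exists N, (fun=> N%:Z); split; first exact: const_bound.
by apply: bound_in_window; apply: HN; rewrite mem_head.
Qed.

Lemma facets_listed m (A : CS m.+1) :
  exists l : seq (CS m), uniq l /\ forall B, is_facet A B -> B \in l.
Proof.
have [N [u [uN KA]]] := window_single A.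
exists (window_strata N u m); split; first exact: window_strata_uniq.
by move=> B AB; apply/(mem_window_strata uN)/(facet_in_window KA AB).
Qed.

Lemma face_sign_facet m (A : CS m.+1) (B : CS m) : face_sign A B != 0 -> is_facet A B.
Proof. by rewrite /face_sign; case: asboolP; rewrite ?eqxx. Qed.

Lemma cover_dd m (A : CS m.+2) (C : CS m) (l : seq (CS m.+1)) : uniq l ->
  (forall B, is_facet A B -> B \in l) -> \sum_(B <- l) face_sign A B * face_sign B C = 0.
Proof.
move=> ul Al; have [N [u [uN KA]]] := window_single A.
have nz B : face_sign A B * face_sign B C != 0 -> is_facet A B /\ is_facet B C.
  move=> nz; split; apply: face_sign_facet; apply: contraNneq nz => ->; by rewrite ?mul0r ?mulr0.
rewrite (@sum_support _ _ _ (window_strata N u m.+1)) //.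
- have [KC|nKC] := pselect (in_window hb N u C); first exact: window_dd.
  rewrite big1 // => B _; apply/eqP; apply: contrapT => /negP/nz[AB BC].
  by apply: nKC; apply: (facet_in_window _ BC); apply: (facet_in_window KA AB).
- exact: window_strata_uniq.
- by move=> B /nz[/Al].
- by move=> B /nz[AB _]; apply/(mem_window_strata uN)/(facet_in_window KA AB).
Qed.

Lemma cover_aug (A : CS 1) (l : seq (CS 0)) : uniq l ->
  (forall B, is_facet A B -> B \in l) -> \sum_(B <- l) face_sign A B * vertex_sign B = 0.
Proof.
move=> ul Al; have [N [u [uN KA]]] := window_single A.
have nz B : face_sign A B * vertex_sign B != 0 -> is_facet A B.
  by move=> nz; apply: face_sign_facet; apply: contraNneq nz => ->; rewrite mul0r.
rewrite (@sum_support _ _ _ (window_strata N u 0)) //.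
- exact: window_augmentation.
- exact: window_strata_uniq.
- by move=> B /nz/Al.
- by move=> B /nz AB; apply/(mem_window_strata uN)/(facet_in_window KA AB).
Qed.

Lemma in_window_dominated N (u : 'I_n -> int) m (A : CS m) : in_window hb N u A -> dominated u A.
Proof. by move=> KA; apply/(dominatedP u (stratum_ptP hb A)) => i; case/andP: (KA i). Qed.

(** A finitely supported chain fits into one window, so that its cycle condition has to be
    checked there only. *)
Lemma cover_filling m (u : 'I_n -> int) (f : CS m -> F) (l : seq (CS m)) : uniq l ->
  (forall A, f A != 0 -> A \in l /\ dominated u A) ->
  (forall N, (forall i, - (N%:Z) <= u i <= N%:Z) ->
     (forall A, f A != 0 -> in_window hb N u A) ->
     forall A0 s, f A0 != 0 -> facet (window H N u) fullv (window_signs hb N u A0) s ->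
     \sum_(A <- l) f A * orn_sign hb F orn N u A *
       incidence (@orient R _ F) (window H N u) fullv (window_signs hb N u A) s = 0) ->
  exists (f' : CS m.+1 -> F) (l' : seq (CS m.+1)), [/\ uniq l',
    forall A, f' A != 0 -> A \in l' /\ dominated u A
  & forall A, \sum_(A' <- l') f' A' * face_sign A' A = f A].
Proof.
move=> ul fl cyc; have [N [uN HN]] := window_for u [seq stratum_pt A | A <- l].
have fK A : f A != 0 -> A \in l /\ in_window hb N u A.
  move=> /fl[Al uA]; split=> //; apply: HN; first exact: map_f.
  exact/(dominatedP u (stratum_ptP hb A)).
have [s|f' [f'K df']] := window_exact uN ul fK; last first.
  exists f', (window_strata N u m.+1); split=> //; first exact: window_strata_uniq.
  by move=> A /f'K KA; split; [apply/(mem_window_strata uN)|apply: in_window_dominated KA].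
have [[A0 [fA0 A0s]]|no] := pselect (exists A, f A != 0 /\
    facet (window H N u) fullv (window_signs hb N u A) s); last first.
  rewrite big1 // => A _; have [->|fA] := eqVneq (f A) 0; first by rewrite !mul0r.
  by rewrite incidence_nfacet ?mulr0 //; apply/negP => As; apply: no; exists A.
by apply: (cyc N uN _ A0) => // A /fK[].
Qed.

Lemma cover_exact m (u : 'I_n -> int) (f : CS m.+1 -> F) (l : seq (CS m.+1)) : uniq l ->
  (forall A, f A != 0 -> A \in l /\ dominated u A) ->
  (forall B, \sum_(A <- l) f A * face_sign A B = 0) ->
  exists (f' : CS m.+2 -> F) (l' : seq (CS m.+2)), [/\ uniq l',
    forall A, f' A != 0 -> A \in l' /\ dominated u A
  & forall A, \sum_(A' <- l') f' A' * face_sign A' A = f A].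
Proof.
move=> ul fl cyc; apply: cover_filling ul fl _ => N uN fK A0 s /fK KA0 A0s.
have [B [KB <-]] := cell_facet_dim uN KA0 A0s.
transitivity (orn_sign hb F orn N u B * \sum_(A <- l) f A * face_sign A B); last by rewrite cyc mulr0.
rewrite mulr_sumr; apply: eq_bigr => A _.
have [->|/fK KA] := eqVneq (f A) 0; first by rewrite !mul0r mulr0.
rewrite (face_sign_incidence uN KA KB); set e := orn_sign _ _ _ _ _ A; set e' := orn_sign _ _ _ _ _ B.
set w := incidence _ _ _ _ _.
transitivity (e' * e' * (f A * e * w)); first by rewrite orn_sign_sq mul1r.
ring.
Qed.

Lemma cover_exact0 (u : 'I_n -> int) (f : CS 0 -> F) (l : seq (CS 0)) : uniq l ->
  (forall A, f A != 0 -> A \in l /\ dominated u A) ->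
  \sum_(A <- l) f A * vertex_sign A = 0 ->
  exists (f' : CS 1 -> F) (l' : seq (CS 1)), [/\ uniq l',
    forall A, f' A != 0 -> A \in l' /\ dominated u A
  & forall A, \sum_(A' <- l') f' A' * face_sign A' A = f A].
Proof.
move=> ul fl cyc; apply: cover_filling ul fl _ => N uN fK A0 s /fK KA0 A0s.
have /facetP[_ rs _] := A0s.
rewrite -/(flat_of hb N u A0) dim_flat_of // => -[ds].
have -> : s = apex_cell N u.
  apply/eqP; apply: contrapT => /negP nz.
  have := flat_face_lt rs (apex_face rs); rewrite eq_sym => /(_ nz).
  by rewrite -ds ltn0.
rewrite -[RHS]cyc; apply: eq_bigr => A _.
have [->|/fK KA] := eqVneq (f A) 0; first by rewrite !mul0r.
by rewrite -(orn_sign_apex uN KA) mulrA.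
Qed.

Lemma cover_vertex (u : 'I_n -> int) x : (forall i, (H i x : R) <= (u i)%:~R) ->
  exists B : CS 0, dominated u B.
Proof.
move=> xu; have [N [uN HN]] := window_for u [:: x].
have [B KB] := window_vertex uN (HN x (mem_head _ _) xu).
by exists B; apply: in_window_dominated KB.
Qed.
End Cover.

(** * Translations by the dual lattice *)

Section Translation.
Context (R : realType) (n k : nat) (L Lam : zmodType).
Context (v : 'I_n -> L) (psi : {additive L -> Lam}).
Context (b : 'I_k -> Lam) (hb : is_zbasis b) (F : comNzRingType).
Context (orn : forall m, strata R v psi m -> m.-tuple {additive Lam -> R} -> bool).

Local Notation V := (hom_space R hb).
Local Notation H := (hform R v psi hb).
Local Notation CS := (cover_strata R v psi).
Local Notation stratum_pt := (stratum_pt hb).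
Implicit Types (x y w : V) (lam : {additive Lam -> int}).

Lemma real_hom_height lam i : height v psi i (real_hom R lam) = (lam (psi (v i)))%:~R.
Proof. by []. Qed.

Lemma level_sign_translate lam i c x :
  level_sign H i c (x + (real_hom R lam : V)) = level_sign H i (c - lam (psi (v i))) x.
Proof.
rewrite /level_sign linearD /= (hformE v psi i (real_hom R lam : V)) real_hom_height rmorphB /=.
by congr sgn; ring.
Qed.

Lemma same_levels_translate lam x y :
  same_levels H (x + (real_hom R lam : V)) (y + (real_hom R lam : V)) <-> same_levels H x y.
Proof.
split=> xy i c; last by rewrite !level_sign_translate.
have := xy i (c + lam (psi (v i))); by rewrite !level_sign_translate addrK.
Qed.

Lemma level_face_translate lam x y :
  level_face H (x + (real_hom R lam : V)) (y + (real_hom R lam : V)) <-> level_face H x y.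
Proof.
split=> xy i c; last by rewrite !level_sign_translate; apply: xy.
have := xy i (c + lam (psi (v i))); by rewrite !level_sign_translate addrK.
Qed.

Definition translate lam (A : set V) : set V := [set x | A (x - (real_hom R lam : V))].

Lemma translateP lam (A : set V) x : translate lam A (x + (real_hom R lam : V)) <-> A x.
Proof. by rewrite /translate /= addrK. Qed.

Lemma translate_stratum lam (A : set V) : is_stratum v psi A -> is_stratum v psi (translate lam A).
Proof.
move=> sA; have [x Ax] := stratum_nonempty (hb := hb) sA.
exists (x + (real_hom R lam : V)); apply/seteqP; split=> y /=.
  move/(stratumP sA Ax) => xy; apply/(same_stratumP v psi (hb := hb)).
  by rewrite -[y](subrK (real_hom R lam : V)); apply/same_levels_translate.
move/(same_stratumP v psi (hb := hb)) => xy; apply/(stratumP sA Ax).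
by apply/(same_levels_translate lam); rewrite subrK.
Qed.

Lemma translate_direction lam (A : set V) : direction (translate lam A) = direction A.
Proof.
rewrite /direction; congr (Defs.span _); apply/seteqP; split=> w [x [y [Ax Ay ->]]].
  exists (x - (real_hom R lam : V)), (y - (real_hom R lam : V)); split=> //.
  by rewrite opprB addrA subrK.
exists (x + (real_hom R lam : V)), (y + (real_hom R lam : V)).
by split; rewrite ?translateP // opprD addrACA subrr addr0.
Qed.

Fact translate_cover m lam (A : CS m) : cover_strata R v psi m (translate lam (val A)).
Proof.
split; first exact/translate_stratum/cover_stratum.
by rewrite /has_dim translate_direction; apply: cover_dim.
Qed.

Definition shift m lam (A : CS m) : CS m := SigSub (mem_set (translate_cover lam A)).

Lemma shift_image m lam (A : CS m) : stratum_image (shift lam A) = stratum_image A.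
Proof.
apply/val_inj/seteqP; split=> t [x Ax <-] /=.
  exists (x - (real_hom R lam : V)) => //.
  apply/coker_projP; exists (- lam); rewrite raddfN.
  by rewrite addrAC subrr add0r.
exists (x + (real_hom R lam : V)); first exact/translateP.
by apply/coker_projP; exists lam; rewrite addrAC subrr add0r.
Qed.

(** A point of [A] and a point of [B] with the same image in the torus differ by an element of
    the dual lattice, and a stratum is determined by one of its points. *)
Lemma same_image_shift m (A B : CS m) : stratum_image A = stratum_image B ->
  exists lam, B = shift lam A.
Proof.
move=> AB; pose x : V := stratum_pt A.
have : (@torus_proj R Lam @` val B) (torus_proj (x : {additive Lam -> R})).
  by rewrite -[_ @` _]/(val (stratum_image B)) -AB; exists x => //; apply: stratum_ptP.
case=> y By /coker_projP[lam lamE]; exists lam; apply/val_inj.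
apply: (stratum_eq (hb := hb) (x := y)) By _; [exact: cover_stratum|exact: cover_stratum|].
have -> : y = x + (real_hom R lam : V) by rewrite lamE addrC subrK.
by apply/translateP/stratum_ptP.
Qed.

Lemma shift_ceil m lam (A : CS m) i :
  ceil_height v psi i (val (shift lam A)) = ceil_height v psi i (val A) + lam (psi (v i)).
Proof.
have Ax := stratum_ptP hb A; have Tx := proj2 (translateP lam (val A) (stratum_pt A)) Ax.
have E c : (ceil_height v psi i (val (shift lam A)) <= c) =
    (ceil_height v psi i (val A) + lam (psi (v i)) <= c).
  rewrite (ceil_heightP i c (cover_stratum (shift lam A)) Tx).
  rewrite -lerBrDr (ceil_heightP i _ (cover_stratum A) Ax).
  by rewrite linearD /= (hformE v psi i (real_hom R lam : V)) real_hom_height rmorphB /= lerBrDr.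
by apply/le_anti; rewrite E lexx -E lexx.
Qed.

Lemma shift_facet m lam (A : CS m.+1) (B : CS m) :
  is_facet (shift lam A) (shift lam B) <-> is_facet A B.
Proof.
have Ax := stratum_ptP hb A; have Tx := proj2 (translateP lam (val A) (stratum_pt A)) Ax.
have By := stratum_ptP hb B; have Ty := proj2 (translateP lam (val B) (stratum_pt B)) By.
rewrite (is_facetP (hb := hb) (A := shift lam A) (B := shift lam B) Tx Ty).
by rewrite (is_facetP (hb := hb) Ax By); apply: level_face_translate.
Qed.

Lemma shift_compatible m lam (A : CS m.+1) (B : CS m) :
  compatible orn (shift lam A) (shift lam B) <-> compatible orn A B.
Proof.
rewrite /compatible !shift_image /= translate_direction.
split=> -[e [x [y [eB Ax By o]]]].
  exists e, (x - (real_hom R lam : V)), (y - (real_hom R lam : V)); split=> //.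
  by rewrite (_ : _ - _ - _ = y - x) // opprB addrA subrK.
exists e, (x + (real_hom R lam : V)), (y + (real_hom R lam : V)).
split=> //; [exact/translateP|exact/translateP|].
by rewrite (_ : _ + _ - _ = y - x) // opprD addrACA subrr addr0.
Qed.

Lemma shiftK m lam : cancel (@shift m lam) (shift (- lam)).
Proof.
move=> A; apply/val_inj/seteqP; split=> x; rewrite /= /translate /= raddfN opprK addrK //.
Qed.

Lemma shiftVK m lam : cancel (@shift m (- lam)) (shift lam).
Proof. by move=> A; rewrite -{1}[lam]opprK shiftK. Qed.
End Translation.

(** * The grading by the Gale group *)

Section Grading.
Context (R : realType) (n k : nat) (L Lam : zmodType).
Context (v : 'I_n -> L) (psi : {additive L -> Lam}).
Context (hv : is_zbasis v) (hpsi : finite_set [set: coker psi]).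
Context (b : 'I_k -> Lam) (hb : is_zbasis b).
Context (lift : forall m, strata R v psi m -> cover_strata R v psi m).
Context (hlift : forall m (s : strata R v psi m), stratum_image (lift s) = s).
Context (orn : forall m, strata R v psi m -> m.-tuple {additive Lam -> R} -> bool).

Local Notation CS := (cover_strata R v psi).
Local Notation M := (gale_group psi).
Local Notation F := (R[i]).
Local Notation Rx := {mpoly R[i][n]}.
Local Notation cst := (@mpolyC n F).
Local Notation face_sign := (face_sign F orn).
Implicit Types (g : M) (lam : {additive Lam -> int}).

Definition degree_rep g (i : 'I_n) : int := (coker_repr g : {additive L -> int}) (v i).

(** The exponent of the monomial on the cell [A] in the strand of [u]. *)
Definition expo (u : 'I_n -> int) m (A : CS m) : multinom n :=
  [multinom absz (u i - ceil_height v psi i (val A)) | i < n].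

Lemma expoE u m (A : CS m) i : dominated u A -> (expo u A i)%:Z = u i - ceil_height v psi i (val A).
Proof. by move=> uA; rewrite mnmE gez0_abs // subr_ge0. Qed.

(** The degree of the monomial is the class of [w].  The representative [degree_rep g] differs
    from [w] by an element of the dual lattice, by which the lift of [s] is translated. *)
Lemma monomial_cell m (s : strata R v psi m) (mm : multinom n) :
  exists g (A : CS m), [/\ dominated (degree_rep g) A, stratum_image A = s & expo (degree_rep g) A = mm].
Proof.
pose A0 := lift s.
pose w : {additive L -> int} := zhom hv (fun i => (mm i)%:Z + ceil_height v psi i (val A0)).
pose g : M := gale_class psi w.
have /coker_projP[lam lamE] : gale_class psi (coker_repr g) = gale_class psi w by exact: coker_reprK.
have uE i : degree_rep g i = (mm i)%:Z + ceil_height v psi i (val (shift hb lam A0)).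
  rewrite shift_ceil addrA -(zhomE hv (fun i => (mm i)%:Z + ceil_height v psi i (val A0))) -/w.
  rewrite /degree_rep -[lam (psi (v i))]/((dual_map psi lam : {additive L -> int}) (v i)) lamE.
  by rewrite /= addrC subrK.
exists g, (shift hb lam A0); split.
- by move=> i; rewrite uE; lia.
- by rewrite shift_image hlift.
- by apply/mnmP => i; rewrite mnmE uE addrK.
Qed.

(** Two cells over the same stratum differ by a translation by some [lam]; when the exponents
    agree, the representatives of the degrees differ by [lam] too.  So the degrees are equal,
    their representatives as well, and [lam] is 0. *)
Lemma monomial_cell_unique m g g' (A A' : CS m) :
  dominated (degree_rep g) A -> dominated (degree_rep g') A' ->
  stratum_image A = stratum_image A' -> expo (degree_rep g) A = expo (degree_rep g') A' ->
  g = g' /\ A = A'.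
Proof.
move=> uA uA' AA' EE; have [lam A'E] := same_image_shift hb AA'.
have uE i : degree_rep g' i = degree_rep g i + lam (psi (v i)).
  have := congr1 (fun m : multinom n => (m i)%:Z) EE; rewrite !expoE // A'E shift_ceil; lia.
have gg' : g = g'.
  rewrite -[g](coker_reprK (f := dual_map psi)) -[g'](coker_reprK (f := dual_map psi)).
  apply/esym/coker_projP; exists lam; apply: (zhom_ext hv) => i.
  have := uE i; rewrite /degree_rep /= => ->; by rewrite addrC addrA addNr add0r.
split=> //; rewrite A'E (_ : lam = 0).
  apply/val_inj/seteqP; split=> x; rewrite /= /translate /= raddf0 subr0 //.
apply: (hom_vanish hv hpsi) => [y j|i]; first by move/eqP; rewrite mulrn_eq0 => /eqP.
by have := uE i; rewrite gg' => /eqP; rewrite -subr_eq0 opprD addNKr oppr_eq0 => /eqP.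
Qed.

Definition strand_mon (u : 'I_n -> int) m (A : CS m) : chains R v psi m :=
  << 'X_[expo u A] *g stratum_image A >>.

Lemma scale_gen m (p q : Rx) (s : strata R v psi m) :
  p *: (<< q *g s >> : chains R v psi m) = << p * q *g s >>.
Proof. by apply/malgP => t; rewrite mcoeffZ !mcoeffU mulrnAr. Qed.

Lemma differential_U m (p : Rx) (s : strata R v psi m.+1) :
  differential lift orn << p *g s >> = p *: differential_gen lift orn s.
Proof. by rewrite (differentialw lift orn msuppU_le) big_seq_fset1 mcoeffUU. Qed.

(** Within a strand the coefficients become scalars, as the exponents of [facet_monomial] are
    the differences of those of [expo]. *)
Lemma differential_mon u m (A : CS m.+1) (l : seq (CS m)) : dominated u A -> uniq l ->
  (forall B, is_facet A B -> B \in l) ->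
  differential lift orn (strand_mon u A) = \sum_(B <- l) cst (face_sign A B) *: strand_mon u B.
Proof.
move=> uA ul Al; rewrite /strand_mon differential_U /differential_gen.
set s := stratum_image A.
have [lam lamE] : exists lam, lift s = shift hb lam A.
  by apply: same_image_shift; rewrite hlift.
pose lf := [seq B <- l | `[< is_facet A B >]].
have -> : [set B | is_facet (lift s) B] = [set` [seq shift hb lam B | B <- lf]].
  apply/seteqP; split=> B /=.
    move=> sB; apply/mapP; exists (shift hb (- lam) B); last by rewrite shiftVK.
    have AB : is_facet A (shift hb (- lam) B).
      by apply/(shift_facet hb lam); rewrite shiftVK -lamE.
    by rewrite mem_filter asboolT //= Al.
  case/mapP => B' + ->; rewrite mem_filter => /andP[/asboolP AB' _].
  by rewrite lamE; apply/shift_facet.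
rewrite -fsbig_seq; last first.
  by rewrite map_inj_uniq ?filter_uniq //; apply: can_inj (shiftK hb lam).
rewrite big_map big_filter scaler_sumr [LHS]big_mkcond; apply: eq_bigr => B _.
case: asboolP => AB; last by rewrite /face_sign asboolF // rmorph0 scale0r.
rewrite !scale_gen shift_image; congr mkmalgU.
rewrite lamE /incidence_sign.
have -> : `[< compatible orn (shift hb lam A) (shift hb lam B) >] = `[< compatible orn A B >].
  by apply/asbool_equiv_eq/shift_compatible.
rewrite /face_sign (asboolT AB) mulrCA; congr (_ * _).
  by case: asboolP => _; rewrite ?rmorphN ?rmorph1.
rewrite /facet_monomial.
under eq_bigr do rewrite !shift_ceil opprD addrACA subrr addr0.
have uB := dominated_facet hb AB uA.
pose d : multinom n := [multinom absz (ceil_height v psi i (val A) - ceil_height v psi i (val B)) | i < n].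
have -> : \prod_(i < n) 'X_i ^+ absz (ceil_height v psi i (val A) - ceil_height v psi i (val B)) = 'X_[d] :> Rx.
  by rewrite mpolyXE_id; apply: eq_bigr => i _; rewrite mnmE.
rewrite -mpolyXD; congr mpolyX; apply/mnmP => i; rewrite mnmDE !mnmE.
have AB' : ceil_height v psi i (val B) <= ceil_height v psi i (val A).
  by apply: (dominated_facet hb AB (u := fun i => ceil_height v psi i (val A))) => j.
by have := uA i; lia.
Qed.
End Grading.

(** * Exactness in positive degrees *)

Section Strands.
Context (R : realType) (n k : nat) (L Lam : zmodType).
Context (v : 'I_n -> L) (psi : {additive L -> Lam}).
Context (hv : is_zbasis v) (hpsi : finite_set [set: coker psi]).
Context (b : 'I_k -> Lam) (hb : is_zbasis b).
Context (lift : forall m, strata R v psi m -> cover_strata R v psi m).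
Context (hlift : forall m (s : strata R v psi m), stratum_image (lift s) = s).
Context (orn : forall m, strata R v psi m -> m.-tuple {additive Lam -> R} -> bool).
Context (horn : forall m (A : cover_strata R v psi m),
   is_orientation (direction (val A)) (orn (stratum_image A))).

Local Notation CS := (cover_strata R v psi).
Local Notation M := (gale_group psi).
Local Notation F := (R[i]).
Local Notation Rx := {mpoly R[i][n]}.
Local Notation cst := (@mpolyC n F).
Local Notation face_sign := (face_sign F orn).
Local Notation C := (chains R v psi).
Local Notation d := (differential lift orn).
Local Notation urep := (degree_rep v).
Implicit Types (g : M) (m : nat).

Lemma differentialD m (c c' : C m.+1) : d (c + c') = d c + d c'.
Proof. exact: (raddfD (@differential R n L Lam v psi lift orn m)). Qed.

Lemma differential0 m : d (0 : C m.+1) = 0.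
Proof. exact: (raddf0 (@differential R n L Lam v psi lift orn m)). Qed.

Lemma differentialZ m (p : Rx) (c : C m.+1) : d (p *: c) = p *: d c.
Proof. by rewrite -[p *: c]addr0 (differential_linear lift orn p c 0) differential0 addr0. Qed.

Lemma differential_sum m I (r : seq I) (f : I -> C m.+1) : d (\sum_(i <- r) f i) = \sum_(i <- r) d (f i).
Proof. exact: (big_morph _ (@differentialD m) (differential0 m)). Qed.

(** The coefficient of [c] at the cell [A], when the strand of degree [g] is viewed as a chain
    complex of the polyhedron dominated by [g]. *)
Definition strand_coef g m (A : CS m) (c : C m) : F :=
  if `[< dominated (urep g) A >] then mpoly.mcoeff (expo (urep g) A) (mcoeff (stratum_image A) c) else 0.

Lemma strand_coef0 g m (A : CS m) : strand_coef g A 0 = 0.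
Proof. by rewrite /strand_coef mcoeff0 mpoly.mcoeff0 if_same. Qed.

Lemma strand_coefD g m (A : CS m) c c' : strand_coef g A (c + c') = strand_coef g A c + strand_coef g A c'.
Proof. by rewrite /strand_coef mcoeffD mpoly.mcoeffD; case: ifP => _; rewrite ?addr0. Qed.

Lemma strand_coefZ g m (A : CS m) a c : strand_coef g A (cst a *: c) = a * strand_coef g A c.
Proof. by rewrite /strand_coef mcoeffZ mpoly.mcoeffCM; case: ifP => _; rewrite ?mulr0. Qed.

Lemma strand_coef_sum g m (A : CS m) I (r : seq I) (f : I -> C m) :
  strand_coef g A (\sum_(i <- r) f i) = \sum_(i <- r) strand_coef g A (f i).
Proof. exact: (big_morph (strand_coef g A) (strand_coefD g A) (strand_coef0 g A)). Qed.

Lemma strand_coef_mon g g' m (A A' : CS m) : dominated (urep g') A' ->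
  strand_coef g A (strand_mon (urep g') A') = ((g == g') && (A == A'))%:R.
Proof.
move=> uA'; rewrite /strand_coef /strand_mon mcoeffU.
case: (asboolP (dominated (urep g) A)) => uA; last first.
  by case: eqP => //= gg; case: eqP => // AA; case: uA; rewrite gg AA.
have [ss|ns] := eqVneq (stratum_image A') (stratum_image A); last first.
  rewrite mpoly.mcoeff0; case: eqP => //= _; case: eqP => // AA.
  by rewrite AA eqxx in ns.
rewrite mulr1n mpoly.mcoeffX; have [ee|ne] := eqVneq (expo (urep g') A') (expo (urep g) A).
  have [-> ->] := monomial_cell_unique hv hpsi hb uA' uA ss ee.
  by rewrite !eqxx.
by case: eqP => //= gg; case: eqP => // AA; rewrite gg AA eqxx in ne.
Qed.

Lemma chains_ind m (P : C m -> Prop) : P 0 -> (forall c c', P c -> P c' -> P (c + c')) ->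
  (forall a g (A : CS m), dominated (urep g) A -> P (cst a *: strand_mon (urep g) A)) -> forall c, P c.
Proof.
move=> P0 PD PM c; rewrite (monalgE c); elim/big_ind: _ => // s _.
rewrite (mpolyE (mcoeff s c)) (big_morph (fun p => << p *g s >>) (fun p q => monalgUD s p q) (monalgU0 s)).
elim/big_ind: _ => // mm _.
have [g [A [uA <- <-]]] := monomial_cell hv hb hlift s mm.
by rewrite -mul_mpolyC -(scale_gen (cst _)); apply: PM.
Qed.

Lemma strand_coef_separates m (c : C m) : (forall g (A : CS m), strand_coef g A c = 0) -> c = 0.
Proof.
move=> c0; apply/malgP => s; apply/mpolyP => mm.
have [g [A [uA <- <-]]] := monomial_cell hv hb hlift s mm.
by have := c0 g A; rewrite /strand_coef asboolT // mcoeff0 mpoly.mcoeff0.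
Qed.

Lemma strand_coef_inj m (c c' : C m) : (forall g (A : CS m), strand_coef g A c = strand_coef g A c') -> c = c'.
Proof.
move=> cc; apply/eqP; rewrite -subr_eq0; apply/eqP/strand_coef_separates => g A.
apply: (@addIr _ (strand_coef g A c')); by rewrite -strand_coefD subrK cc add0r.
Qed.

Lemma strand_coef_finite m (c : C m) : exists l : seq (M * CS m), uniq l /\
  forall g A, strand_coef g A c != 0 -> (g, A) \in l.
Proof.
elim/chains_ind: c => [|c c' [l [ul lc]] [l' [ul' lc']]|a g A uA].
- by exists [::]; split=> // g A; rewrite strand_coef0 eqxx.
- exists (undup (l ++ l')); split=> [|g A]; first exact: undup_uniq.
  rewrite mem_undup mem_cat strand_coefD => nz.
  have [z|/lc ->//] := eqVneq (strand_coef g A c) 0; rewrite lc' ?orbT //.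
  by move: nz; rewrite z add0r.
- exists [:: (g, A)]; split=> // g' A'; rewrite strand_coefZ strand_coef_mon // inE xpair_eqE.
  by case: (_ && _); rewrite ?mulr0 ?eqxx.
Qed.

Lemma strand_coef_dominated g m (A : CS m) c : strand_coef g A c != 0 -> dominated (urep g) A.
Proof. by rewrite /strand_coef; case: asboolP; rewrite ?eqxx. Qed.

Lemma facet_list m (A : CS m.+1) : exists l : seq (CS m), uniq l /\ forall B, B \in l <-> is_facet A B.
Proof.
have [l [ul Al]] := facets_listed hb A.
exists [seq B <- l | `[< is_facet A B >]]; split=> [|B]; first exact: filter_uniq.
rewrite mem_filter; split=> [/andP[/asboolP]//|AB].
by rewrite asboolT //= Al.
Qed.

Lemma strand_coef_differential_mon g g' m (A : CS m.+1) (B : CS m) : dominated (urep g') A ->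
  strand_coef g B (d (strand_mon (urep g') A)) = if g == g' then face_sign A B else 0.
Proof.
move=> uA; have [l [ul Al]] := facet_list A.
rewrite (differential_mon hb hlift orn uA ul) => [|B' /Al//]; rewrite strand_coef_sum.
have E B' : B' \in l -> strand_coef g B (cst (face_sign A B') *: strand_mon (urep g') B') = face_sign A B' * ((g == g') && (B == B'))%:R.
  by move=> /Al AB'; rewrite strand_coefZ strand_coef_mon //; apply: dominated_facet uA.
rewrite (eq_big_seq _ E); case: eqP => gg /=; last by rewrite big1 // => B' _; rewrite mulr0.
have [Bl|nBl] := boolP (B \in l).
  rewrite (bigD1_seq B) //= eqxx mulr1 big1 ?addr0 // => B'; rewrite eq_sym => /negbTE ->.
  by rewrite mulr0.
rewrite big_seq big1 => [|B' B'l]; last first.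
  by case: eqP => [BB|_]; [rewrite BB B'l in nBl|rewrite mulr0].
apply/esym/eqP; apply: contraNT nBl => /face_sign_facet AB; exact/Al.
Qed.

(** A linear form on the strand is determined by its values on monomials.  In the induction on
    [c] the list [l] is replaced by all sufficiently large lists, since cancellations can make
    the support of a sum smaller than those of its terms. *)
Lemma strand_coef_expansion g m (phi : C m -> F) (w : CS m -> F) (c : C m) (l : seq (CS m)) :
  phi 0 = 0 -> (forall c c', phi (c + c') = phi c + phi c') ->
  (forall a g' A, dominated (urep g') A ->
     phi (cst a *: strand_mon (urep g') A) = if g == g' then a * w A else 0) ->
  uniq l -> (forall A, strand_coef g A c != 0 -> A \in l) ->
  phi c = \sum_(A <- l) strand_coef g A c * w A.
Proof.
move=> phi0 phiD phiM ul lc.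
suff [l0 [l0c H0]] : exists l0 : seq (CS m), (forall A, strand_coef g A c != 0 -> A \in l0) /\
    forall l1, uniq l1 -> {subset l0 <= l1} -> phi c = \sum_(A <- l1) strand_coef g A c * w A.
  rewrite (H0 (undup l0)) ?undup_uniq => [|//|A]; last by rewrite mem_undup.
  have nz A : strand_coef g A c * w A != 0 -> strand_coef g A c != 0.
    by apply: contraNneq => ->; rewrite mul0r.
  apply: sum_support; rewrite ?undup_uniq // => A /nz.
    by rewrite mem_undup => /l0c.
  exact: lc.
elim/chains_ind: c {l ul lc} => [|c c' [l [lc H]] [l' [lc' H']]|a g' A uA].
- exists [::]; split=> [A|l1 _ _]; first by rewrite strand_coef0 eqxx.
  by rewrite phi0 big1 // => A _; rewrite strand_coef0 mul0r.
- exists (l ++ l'); split=> [A|l1 ul1 sub].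
    rewrite mem_cat strand_coefD => nz; have [z|/lc ->//] := eqVneq (strand_coef g A c) 0; rewrite lc' ?orbT //.
    by move: nz; rewrite z add0r.
  have sub1 : {subset l <= l1} by move=> A Al; apply: sub; rewrite mem_cat Al.
  have sub2 : {subset l' <= l1} by move=> A Al; apply: sub; rewrite mem_cat Al orbT.
  rewrite phiD; apply: etrans (congr2 +%R (H l1 ul1 sub1) (H' l1 ul1 sub2)) _.
  by rewrite -big_split /=; apply: eq_bigr => A _; rewrite strand_coefD mulrDl.
- exists [:: A]; split=> [A'|l1 ul1 sub].
    rewrite strand_coefZ strand_coef_mon // inE; case: (A' == A) => //.
    by rewrite andbF mulr0 eqxx.
  rewrite phiM // (bigD1_seq A) ?sub ?mem_head //= strand_coefZ strand_coef_mon // eqxx andbT big1 ?addr0.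
    by case: eqP => _; rewrite ?mulr0 ?mul0r ?mulr1.
  by move=> A' A'A; rewrite strand_coefZ strand_coef_mon // (negbTE A'A) andbF mulr0 mul0r.
Qed.

Lemma strand_coef_differential g m (B : CS m) (c : C m.+1) (l : seq (CS m.+1)) : uniq l ->
  (forall A, strand_coef g A c != 0 -> A \in l) -> strand_coef g B (d c) = \sum_(A <- l) strand_coef g A c * face_sign A B.
Proof.
move=> ul lc; apply: (@strand_coef_expansion g m.+1 (fun c => strand_coef g B (d c)) (fun A => face_sign A B) c l _ _ _ ul lc).
- by rewrite differential0 strand_coef0.
- by move=> c1 c2; rewrite differentialD strand_coefD.
move=> a g' A uA; rewrite differentialZ strand_coefZ strand_coef_differential_mon //.
by case: eqP; rewrite ?mulr0.
Qed.

Lemma differential_differential m (c : C m.+2) : d (d c) = 0.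
Proof.
elim/chains_ind: c => [|c c' dc dc'|a g A uA]; first by rewrite (differential0 m.+1) differential0.
  by rewrite (@differentialD m.+1) differentialD; apply: etrans (congr2 +%R dc dc') (addr0 _).
rewrite (@differentialZ m.+1) differentialZ; have [l [ul Al]] := facet_list A.
rewrite (differential_mon hb hlift orn uA ul) => [|B' /Al//]; rewrite differential_sum.
apply: strand_coef_separates => g' B; rewrite strand_coefZ strand_coef_sum big_seq (eq_bigr (fun B' => if g' == g then face_sign A B' * face_sign B' B else 0)).
  case: eqP => _; last by rewrite big1 ?mulr0.
  by rewrite -big_seq (cover_dd hv hpsi hb F horn) ?mulr0 // => B' /Al.
move=> B' /Al AB'; rewrite differentialZ strand_coefZ strand_coef_differential_mon; last exact: dominated_facet uA.
by case: eqP; rewrite ?mulr0.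
Qed.

Definition strand_list g m (l : seq (M * CS m)) : seq (CS m) := undup [seq p.2 | p <- l & p.1 == g].

Lemma strand_listP g m (l : seq (M * CS m)) (A : CS m) : ((g, A) \in l) = (A \in strand_list g l).
Proof.
rewrite mem_undup; apply/idP/mapP => [gA|[[g' A'] + ->]]; last by rewrite mem_filter => /andP[/eqP /= ->].
by exists (g, A) => //; rewrite mem_filter /= eqxx.
Qed.

(** A chain meets finitely many degrees, so that it is a boundary as soon as each of its
    strands is one. *)
Lemma assemble m (c : C m) : (forall g, exists (f : CS m.+1 -> F) (l : seq (CS m.+1)), [/\ uniq l,
    forall A, f A != 0 -> A \in l /\ dominated (urep g) A
  & forall A, \sum_(A' <- l) f A' * face_sign A' A = strand_coef g A c]) -> exists c', d c' = c.
Proof.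
move=> /choice[f /choice[l H]]; have [lc [ulc lcP]] := strand_coef_finite c.
pose G := undup [seq p.1 | p <- lc].
have Gc g A : strand_coef g A c != 0 -> g \in G.
  by move/lcP => gA; rewrite mem_undup; apply/mapP; exists (g, A).
pose c' : C m.+1 := \sum_(g <- G) \sum_(A <- l g) cst (f g A) *: strand_mon (urep g) A.
have coc' g A : strand_coef g A c' = if g \in G then f g A else 0.
  rewrite /c' strand_coef_sum.
  have E g' : strand_coef g A (\sum_(A' <- l g') cst (f g' A') *: strand_mon (urep g') A') = if g == g' then f g' A else 0.
    have [ul lf _] := H g'.
    rewrite strand_coef_sum (eq_bigr (fun A' => if (g == g') && (A == A') then f g' A' else 0)) => [|A' _]; last first.
      rewrite strand_coefZ; have [->|/lf[_ uA']] := eqVneq (f g' A') 0; first by rewrite mul0r if_same.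
      by rewrite strand_coef_mon //; case: (_ && _); rewrite ?mulr1 ?mulr0.
    case: eqP => _ /=; last by rewrite big1.
    have [Al|nAl] := boolP (A \in l g').
      by rewrite (bigD1_seq A) //= eqxx big1 ?addr0 // => A'; rewrite eq_sym => /negbTE ->.
    rewrite big_seq big1 => [|A' A'l]; last by case: eqP => // AA; rewrite AA A'l in nAl.
    by apply/esym/eqP; apply: contraNT nAl => /lf[].
  rewrite (eq_bigr _ (fun g' _ => E g')); have [gG|ngG] := boolP (g \in G).
    rewrite (bigD1_seq g) ?undup_uniq //= eqxx big1 ?addr0 // => g'; rewrite eq_sym => /negbTE ->.
    by [].
  by rewrite big_seq big1 // => g' g'G; case: eqP => // gg; rewrite gg g'G in ngG.
exists c'; apply: strand_coef_inj => g B; have [ul lf df] := H g.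
rewrite (@strand_coef_differential g m B c' (l g)) // => [|A]; last first.
  by rewrite coc'; case: ifP => _; [move=> /lf[]|rewrite eqxx].
have [gG|ngG] := boolP (g \in G).
  by rewrite -df; apply: eq_bigr => A _; rewrite coc' gG.
rewrite big1 => [|A _]; last by rewrite coc' (negbTE ngG) mul0r.
by apply/esym/eqP; apply: contraNT ngG; apply: Gc.
Qed.

Lemma cycle_boundary m (c : C m.+1) : d c = 0 -> exists c', d c' = c.
Proof.
move=> dc; apply: assemble => g; have [lc [ulc lcP]] := strand_coef_finite c.
apply: (cover_exact hv hpsi hb horn (u := urep g) (f := fun A => strand_coef g A c) (l := strand_list g lc)).
- exact: undup_uniq.
- by move=> A nz; rewrite -strand_listP lcP //; split=> //; apply: strand_coef_dominated nz.
move=> B; rewrite -(@strand_coef_differential g m B c) ?undup_uniq //; first by rewrite dc strand_coef0.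
by move=> A nz; rewrite -strand_listP lcP.
Qed.
End Strands.

(** * The augmentation and the homology in degree zero *)

Section Augmentation.
Context (R : realType) (n k : nat) (L Lam : zmodType).
Context (v : 'I_n -> L) (psi : {additive L -> Lam}).
Context (hv : is_zbasis v) (hpsi : finite_set [set: coker psi]).
Context (b : 'I_k -> Lam) (hb : is_zbasis b).
Context (lift : forall m, strata R v psi m -> cover_strata R v psi m).
Context (hlift : forall m (s : strata R v psi m), stratum_image (lift s) = s).
Context (orn : forall m, strata R v psi m -> m.-tuple {additive Lam -> R} -> bool).
Context (horn : forall m (A : cover_strata R v psi m),
   is_orientation (direction (val A)) (orn (stratum_image A))).

Local Notation V := (hom_space R hb).
Local Notation CS := (cover_strata R v psi).
Local Notation M := (gale_group psi).
Local Notation F := (R[i]).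
Local Notation Rx := {mpoly R[i][n]}.
Local Notation cst := (@mpolyC n F).
Local Notation face_sign := (face_sign F orn).
Local Notation vertex_sign := (vertex_sign F orn).
Local Notation C := (chains R v psi).
Local Notation d := (differential lift orn).
Local Notation urep := (degree_rep v).
Local Notation S := (cone_semigroup R v psi).
Local Notation SA := (cone_algebra R v psi).
Local Notation conep := (@cone_pred R n L Lam v psi).
Local Notation smap := (structure_map R v psi).
Local Notation strand_coef := (@strand_coef R n L Lam v psi).
Implicit Types (g : M) (m : nat).

Lemma dual_basisE i j : dual_basis v i (v j) = (i == j)%:R.
Proof.
rewrite /dual_basis; case: xgetP => [f _ -> //|/(_ (zhom hv (fun j => (i == j)%:R)))[]].
by move=> j'; rewrite zhomE.
Qed.

(** The class of [w] lies in the image of the orthant when [w] minus some point [x] of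
    Hom(Lam, R) has nonnegative coordinates, that is, when [x] lies in the polyhedron of [w]. *)
Lemma cone_classP (w : {additive L -> int}) :
  (gale_class psi w \in conep) <->
  exists x : V, forall i, height v psi i x <= (w (v i))%:~R.
Proof.
have sumE (c : 'I_n -> R) j : (\sum_i c i *: real_hom R (dual_basis v i) : {additive L -> R}) (v j) = c j.
  rewrite (big_morph (fun f : {additive L -> R} => f (v j)) (id1 := 0) (op1 := +%R)) //.
  rewrite (bigD1 j) //= dual_basisE eqxx mulr1 big1 ?addr0 // => i ij.
  by rewrite dual_basisE (negbTE ij) mulr0.
split=> [/asboolP|[x xw]].
  rewrite gale_real_class => -[f [c [c0 fE]] /coker_projP[x xE]].
  pose y : {additive Lam -> R} := - x; exists y => i.
  suff : 0 <= (w (v i))%:~R - - x (psi (v i)) by rewrite subr_ge0.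
  have := congr1 (fun f : {additive L -> R} => f (v i)) xE; rewrite /= fE sumE => E.
  rewrite E opprB; have := c0 i; lra.
apply/asboolP; rewrite gale_real_class.
pose c i := (w (v i))%:~R - height v psi i x.
exists (\sum_i c i *: real_hom R (dual_basis v i)).
  by exists c; split=> // i; rewrite subr_ge0.
apply/esym/coker_projP; exists (x : {additive Lam -> R}); apply: (zhom_ext hv) => i.
rewrite -[RHS]/((w (v i))%:~R - (\sum_i c i *: real_hom R (dual_basis v i) : {additive L -> R}) (v i)).
by rewrite sumE /c opprB addrCA subrr addr0.
Qed.

Lemma gale_class_rep g : gale_class psi (coker_repr g) = g.
Proof. exact: coker_reprK. Qed.

Lemma cone_dominated g : g \in conep <-> exists B : CS 0, dominated (urep g) B.
Proof.
rewrite -{1}(gale_class_rep g) cone_classP; split=> [[x xw]|[B uB]].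
  by apply: (cover_vertex hv hpsi (hb := hb) F (x := x)) => i; rewrite hformE; apply: xw.
exists (stratum_pt hb B) => i; have := proj1 (dominatedP (urep g) (stratum_ptP hb B)) uB i.
by rewrite hformE.
Qed.

Lemma dominated_cone g m (B : CS m) : dominated (urep g) B -> g \in conep.
Proof.
move=> uB; rewrite -(gale_class_rep g); apply/cone_classP.
exists (stratum_pt hb B) => i; have := proj1 (dominatedP (urep g) (stratum_ptP hb B)) uB i.
by rewrite hformE.
Qed.

(** The least integer point that dominates the vertex [A]; its class is the degree of the
    generator over [A]. *)
Definition corner (A : CS 0) : {additive L -> int} := zhom hv (fun i => ceil_height v psi i (val A)).

Lemma corner_cone A : gale_class psi (corner A) \in conep.
Proof.
apply/cone_classP; exists (stratum_pt hb A) => i; rewrite zhomE.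
by have := proj1 (dominatedP (fun i => ceil_height v psi i (val A)) (stratum_ptP hb A)) (fun i => lexx _) i; rewrite hformE.
Qed.

Definition vertex_degree (s : strata R v psi 0) : S := ConeElt (corner_cone (lift s)).

Definition torus_vertex_sign (s : strata R v psi 0) : F := if orn s [tuple] then 1 else -1.

Definition vertex_value (s : strata R v psi 0) : SA :=
  @sgconst F S (torus_vertex_sign s) * sgmon F (vertex_degree s).

(** The augmentation is defined on generators, so that it is linear over the polynomials;
    [augment_mon] says that it sends a monomial to the basis element of its degree, up to the
    sign of the vertex. *)
Definition augment (c : C 0) : SA := \sum_(s <- msupp c) smap (mcoeff s c) * vertex_value s.

Lemma augmentw (c : C 0) (e : {fset strata R v psi 0}) : fsubset (msupp c) e ->
  augment c = \sum_(s <- e) smap (mcoeff s c) * vertex_value s.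
Proof.
move=> ce; rewrite /augment (big_fset_incl _ ce) //=.
by move=> s _ /mcoeff_outdom ->; rewrite rmorph0 mul0r.
Qed.

Lemma augmentP (p : Rx) (c c' : C 0) : augment (p *: c + c') = smap p * augment c + augment c'.
Proof.
have cu : fsubset (msupp c) (fsetU (msupp c) (msupp c')) by exact: fsubsetUl.
have du : fsubset (msupp c') (fsetU (msupp c) (msupp c')) by exact: fsubsetUr.
have su : fsubset (msupp (p *: c + c')) (fsetU (msupp c) (msupp c')).
  apply: fsubset_trans (msuppD_le _ _) _.
  by apply: fsetSU; exact: msuppZ_le.
apply: (etrans (augmentw su)); apply: esym.
apply: (etrans (congr2 (fun x y => smap p * x + y) (augmentw cu) (augmentw du))).
apply: (etrans (congr2 +%R (mulr_sumr _ _ _ _) (erefl _))).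
apply: (etrans (esym (big_split _ _ _ _ _))).
apply: eq_bigr => s _; apply: esym.
by rewrite mcoeffD mcoeffZ rmorphD rmorphM mulrDl -(mulrA (smap p)).
Qed.

Lemma augment0 : augment 0 = 0.
Proof. by rewrite /augment msupp0 big_seq_fset0. Qed.

Lemma augmentD c c' : augment (c + c') = augment c + augment c'.
Proof.
apply: (etrans (congr1 (fun x => augment (x + c')) (esym (scale1r c)))).
by apply: (etrans (augmentP 1 c c')); congr (_ + _); rewrite rmorph1 mul1r.
Qed.

Lemma augmentZ p c : augment (p *: c) = smap p * augment c.
Proof.
apply: (etrans (congr1 augment (esym (addr0 (p *: c))))).
by apply: (etrans (augmentP p c 0)); rewrite augment0 addr0.
Qed.

Lemma augment_sum I (r : seq I) (f : I -> C 0) : augment (\sum_(i <- r) f i) = \sum_(i <- r) augment (f i).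
Proof. exact: (big_morph augment augmentD augment0). Qed.

Lemma augment_gen (p : Rx) s : augment (<< p *g s >> : C 0) = smap p * vertex_value s.
Proof. by rewrite (augmentw msuppU_le) big_seq_fset1 mcoeffUU. Qed.

Lemma sgmon0 : sgmon F (0 : S) = 1. Proof. by []. Qed.

Lemma sgmonMn (s : S) j : sgmon F s ^+ j = sgmon F (s *+ j).
Proof.
elim: j => [//|j IH]; rewrite exprS mulrS sgmonD.
by apply: congr2 IH.
Qed.

Lemma smapC a : smap (cst a) = @sgconst F S a.
Proof. by rewrite /= mpoly.mmapC. Qed.

Lemma smapX (e : multinom n) :
  smap 'X_[e] = sgmon F (\sum_(i < n) dual_basis_class R v psi i *+ e i).
Proof.
rewrite /= mpoly.mmapX /mpoly.mmap1 (big_morph _ (sgmonD F (S := S)) sgmon0).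
by apply: eq_bigr => i _; rewrite sgmonMn.
Qed.

Lemma cone_valD (s t : S) : cone_val (s + t) = cone_val s + cone_val t.
Proof. exact: (raddfD (\val : S -> M)). Qed.

Lemma cone_val0 : cone_val (0 : S) = 0.
Proof. exact: (raddf0 (\val : S -> M)). Qed.

Lemma cone_valMn (s : S) j : cone_val (s *+ j) = cone_val s *+ j.
Proof. exact: (raddfMn (\val : S -> M)). Qed.

Lemma gale_classD (f f' : {additive L -> int}) :
  gale_class psi (f + f') = gale_class psi f + gale_class psi f'.
Proof. exact: (raddfD (@coker_proj _ _ (@dual_map int L Lam psi))). Qed.

Lemma gale_class0 : gale_class psi 0 = 0.
Proof. exact: (raddf0 (@coker_proj _ _ (@dual_map int L Lam psi))). Qed.

Lemma gale_classMn (f : {additive L -> int}) j : gale_class psi (f *+ j) = gale_class psi f *+ j.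
Proof. exact: (raddfMn (@coker_proj _ _ (@dual_map int L Lam psi))). Qed.

Lemma augment_mon g (B : CS 0) (s : S) : dominated (urep g) B -> cone_val s = g ->
  augment (strand_mon (urep g) B) = @sgconst F S (vertex_sign B) * sgmon F s.
Proof.
move=> uB sg; apply: (etrans (augment_gen _ _)); rewrite smapX /vertex_value.
apply: (etrans (mulrCA _ _ _)); apply: congr2 => //.
apply: (etrans (esym (sgmonD _ _ _))); congr (sgmon _ _).
apply/val_inj; rewrite -![\val _]/(cone_val _) sg cone_valD -[RHS](gale_class_rep g).
set e := expo (urep g) B; set A0 := lift (stratum_image B).
rewrite (big_morph (@cone_val _ _ _ _ _ _) cone_valD cone_val0).
have -> : \sum_(i < n) cone_val (dual_basis_class R v psi i *+ e i) =
    gale_class psi (\sum_(i < n) dual_basis v i *+ e i).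
  rewrite (big_morph (gale_class psi) gale_classD gale_class0); apply: eq_bigr => i _.
  by rewrite cone_valMn gale_classMn.
rewrite -[cone_val _]/(gale_class psi (corner A0)) -gale_classD.
have [lam BE] : exists lam, B = shift hb lam A0 by apply: same_image_shift; rewrite hlift.
apply/coker_projP; exists (- lam); apply: (zhom_ext hv) => j.
rewrite -[LHS]/(- lam (psi (v j))).
rewrite -[RHS]/((\sum_(i < n) dual_basis v i *+ e i : {additive L -> int}) (v j) + corner A0 (v j) - urep g j).
rewrite (big_morph (fun f : {additive L -> int} => f (v j)) (id1 := 0) (op1 := +%R)) //.
have E i : (dual_basis v i *+ e i : {additive L -> int}) (v j) = (i == j)%:R * (e i)%:Z.
  rewrite -dual_basisE; elim: (e i) => [|p IH]; first by rewrite mulr0n mulr0.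
  rewrite mulrS -[LHS]/(dual_basis v i (v j) + (dual_basis v i *+ p : {additive L -> int}) (v j)) IH.
  by rewrite intS mulrDr mulr1.
rewrite (eq_bigr _ (fun i _ => E i)) (bigD1 j) //= eqxx mul1r big1 ?addr0 => [|i ij]; last first.
  by rewrite (negbTE ij) mul0r.
rewrite expoE // zhomE BE shift_ceil; ring.
Qed.

Lemma augment_coef (s : S) (c : C 0) (l : seq (CS 0)) : uniq l ->
  (forall A, strand_coef (cone_val s) A c != 0 -> A \in l) ->
  mcoeff s (augment c) = \sum_(A <- l) strand_coef (cone_val s) A c * vertex_sign A.
Proof.
move=> ul lc; apply: (@strand_coef_expansion _ _ _ _ _ _ _ hv hpsi _ hb _ hlift (cone_val s) 0 (fun c => mcoeff s (augment c)) _ c l _ _ _ ul lc).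
- by rewrite augment0 mcoeff0.
- by move=> c1 c2; apply: (etrans (congr1 (mcoeff s) (augmentD _ _))); rewrite mcoeffD.
move=> a g A uA; pose s0 : S := ConeElt (dominated_cone uA).
have -> : (cone_val s == g) = (s0 == s) by rewrite eq_sym.
apply: (etrans (congr1 (mcoeff s) (augmentZ _ _))).
rewrite smapC (augment_mon (s := s0) uA) // mulrA -rmorphM.
rewrite [_ * _](sgmulUU _ _ (0 : S) s0) mulr1 add0r mcoeffU.
by case: (s0 == s).
Qed.

Lemma augment_differential (c : C 1) : augment (d c) = 0.
Proof.
apply/malgP => s; rewrite mcoeff0; set g := cone_val s.
have [lc [_ lcP]] := strand_coef_finite hv hpsi hb hlift c.
have [ld [_ ldP]] := strand_coef_finite hv hpsi hb hlift (d c).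
have /choice[fl flP] : forall A : CS 1, exists l : seq (CS 0), uniq l /\ forall B, B \in l <-> is_facet A B.
  exact: facet_list hb 0.
pose lA := strand_list g lc.
pose lB := undup (strand_list g ld ++ flatten [seq fl A | A <- lA]).
rewrite (@augment_coef s (d c) lB) ?undup_uniq // => [|B nz]; last first.
  by rewrite mem_undup mem_cat -strand_listP ldP.
have E B : strand_coef g B (d c) = \sum_(A <- lA) strand_coef g A c * face_sign A B.
  apply: (strand_coef_differential hv hpsi hb hlift); first exact: undup_uniq.
  by move=> A nz; rewrite -strand_listP lcP.
rewrite (eq_bigr (fun B => \sum_(A <- lA) strand_coef g A c * face_sign A B * vertex_sign B)) => [|B _]; last first.
  by rewrite E mulr_suml.
rewrite exchange_big /= big_seq big1 // => A Al.
rewrite (eq_bigr (fun B => strand_coef g A c * (face_sign A B * vertex_sign B))) => [|B _]; last by rewrite mulrA.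
rewrite -mulr_sumr (cover_aug hv hpsi hb F horn) ?undup_uniq ?mulr0 // => B AB.
rewrite mem_undup mem_cat; apply/orP; right; apply/flatten_mapP; exists A => //.
exact/(flP A).2.
Qed.

(** In a degree outside the cone there are no cells, and in a degree [g] of the cone the
    coefficient of [augment c] at [g] is the augmentation of the strand of [c]. *)
Lemma augment_kernel (c : C 0) : augment c = 0 -> exists c', d c' = c.
Proof.
move=> c0; apply: (assemble hv hpsi hb hlift) => g.
have [lc [_ lcP]] := strand_coef_finite hv hpsi hb hlift c.
have mem A : strand_coef g A c != 0 -> A \in strand_list g lc by move=> nz; rewrite -strand_listP lcP.
apply: (cover_exact0 hv hpsi hb horn (u := urep g) (f := fun A => strand_coef g A c) (l := strand_list g lc)).
- exact: undup_uniq.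
- by move=> A nz; split; [apply: mem|apply: strand_coef_dominated nz].
have [gc|ngc] := boolP (g \in conep).
  have /= <- := @augment_coef (ConeElt gc) c _ (undup_uniq _) mem.
  by rewrite c0 mcoeff0.
rewrite big1 // => A _; rewrite (_ : strand_coef g A c = 0) ?mul0r //.
by apply/eqP; apply: contraNT ngc => /strand_coef_dominated; apply: dominated_cone.
Qed.

(** The polyhedron of a degree in the cone has a vertex ([cone_dominated]). *)
Lemma augment_surj (y : SA) : exists c, augment c = y.
Proof.
have /choice[B BP] : forall s : S, exists B : CS 0, dominated (urep (cone_val s)) B.
  by move=> s; apply/cone_dominated/cone_valP.
exists (\sum_(s <- msupp y) cst (mcoeff s y * vertex_sign (B s)) *: strand_mon (urep (cone_val s)) (B s)).
rewrite augment_sum; apply: esym; apply: (etrans (monalgE y)); apply: eq_bigr => s _; apply: esym.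
apply: (etrans (augmentZ _ _)); rewrite smapC (augment_mon (BP s) erefl) mulrA -rmorphM.
rewrite [_ * _](sgmulUU _ _ (0 : S) s) mulr1 add0r -mulrA.
by rewrite (_ : vertex_sign (B s) * vertex_sign (B s) = 1) ?mulr1 //; apply: signb_sq.
Qed.

Local Notation HH := (hhl_homology lift orn 0).

Definition augment_homology (h : HH) : SA := augment (cycle_val (generic_quotient.repr h)).

Lemma augment_homologyE (z : cycles (outgoing lift orn 0)) :
  augment_homology (homology_class (@differential R n L Lam v psi lift orn 0) z) = augment (cycle_val z).
Proof.
rewrite /augment_homology; set r := generic_quotient.repr _.
have /homology_classP[c cE] : homology_class (@differential R n L Lam v psi lift orn 0) r =
    homology_class (@differential R n L Lam v psi lift orn 0) z by exact: homology_reprK.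
have /(congr1 (fun x => x + cycle_val z)) := cE; rewrite subrK => <-.
by apply: (etrans (augmentD _ _)); rewrite augment_differential add0r.
Qed.

Fact augment_homology_linear : linear_for (smap \; *%R) augment_homology.
Proof.
move=> a h h'; pose cl := @homology_class _ _ _ _ (@differential R n L Lam v psi lift orn 0) (outgoing lift orn 0).
have hE : cl (generic_quotient.repr h) = h := homology_reprK h.
have hE' : cl (generic_quotient.repr h') = h' := homology_reprK h'.
have E : a *: h + h' = cl (a *: generic_quotient.repr h + generic_quotient.repr h').
  rewrite -{1}hE -{1}hE' /cl raddfD; congr (_ + _).
  exact: homology_class_scale.
rewrite E augment_homologyE; exact: augmentP.
Qed.
HB.instance Definition _ := GRing.isLinear.Build Rx HH SA (smap \; *%R) augment_homology augment_homology_linear.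

Definition homology_iso : {linear HH -> SA | smap \; *%R} := augment_homology.

Lemma augment_homology_inj : injective augment_homology.
Proof.
move=> h h' hh; rewrite -[h]homology_reprK -[h']homology_reprK; apply/homology_classP.
apply: augment_kernel.
have -> : \val (generic_quotient.repr h) - \val (generic_quotient.repr h') = (-1 : Rx) *: cycle_val (generic_quotient.repr h') + cycle_val (generic_quotient.repr h).
  by rewrite scaleN1r addrC.
apply: (etrans (augmentP _ _ _)); rewrite -/(augment_homology h) -/(augment_homology h') hh.
by rewrite rmorphN rmorph1 mulN1r addNr.
Qed.

Lemma augment_homology_surj (y : SA) : exists h, augment_homology h = y.
Proof.
have [c cy] := augment_surj y.
have cz : c \in cycle_pred (outgoing lift orn 0) by rewrite unfold_in.
exists (homology_class (@differential R n L Lam v psi lift orn 0) (Cycle cz)).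
by rewrite augment_homologyE.
Qed.

Lemma augment_homology0 : augment_homology 0 = 0.
Proof. exact: (raddf0 augment_homology). Qed.

Lemma augment_homology_bij : bijective augment_homology.
Proof.
have /choice[f fK] := augment_homology_surj.
by exists f => // h; apply: augment_homology_inj; rewrite fK.
Qed.
End Augmentation.

Theorem theorem2p9 (R : realType) (n k : nat) (L Lam : zmodType)
    (v : 'I_n -> L) (psi : {additive L -> Lam})
    (hv : is_zbasis v)
    (hLam : is_lattice_of_rank Lam k)
    (hpsi : finite_set [set: coker psi])
    (lift : forall m, strata R v psi m -> cover_strata R v psi m)
    (hlift : forall m (s : strata R v psi m), stratum_image (lift m s) = s)
    (orn : forall m, strata R v psi m -> m.-tuple {additive Lam -> R} -> bool)
    (horn : forall m (A : cover_strata R v psi m),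
       is_orientation (direction (val A)) (orn m (stratum_image A))) :
  [/\ forall m (c : chains R v psi m.+1),
        outgoing lift orn m (differential lift orn c) = 0,
      forall m, (exists h : hhl_homology lift orn m, h != 0) <-> m = 0%N
    & exists f : {linear hhl_homology lift orn 0 -> cone_algebra R v psi |
                    structure_map R v psi \; *%R},
        bijective f].
Proof.
have [b hb] := hLam; split=> [[|m] c|m|].
- by [].
- exact: (differential_differential hv hpsi hb hlift horn).
- split=> [[h]|->].
    case: m h => // m h; apply: contraNeq => _; apply/eqP.
    rewrite -[h]homology_reprK -[RHS](raddf0 (homology_class (@differential R n L Lam v psi lift orn m.+1)
      (g := outgoing lift orn m.+1))).
    apply/homology_classP; rewrite subr0.
    apply: (cycle_boundary hv hpsi hb hlift horn).
    by apply/eqP; have := cycle_valP (generic_quotient.repr h); rewrite unfold_in.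
  have [h h1] := augment_homology_surj hv hpsi hb hlift horn (1 : cone_algebra R v psi).
  exists h; apply: contra_eq_neq h1 => ->.
  by rewrite (augment_homology0 hv hpsi hb hlift horn) eq_sym oner_neq0.
- exists (homology_iso hv hpsi hb hlift horn); exact: (augment_homology_bij hv hpsi hb hlift horn).
Qed.
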